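(* Let $p\in\{1,2\}$ and let $(z_t)_{t\in\mathbb Z}$ be a stationary AR($p$) process with mean $\mu$, $z_t-\mu=\sum_{j=1}^p\phi_j(z_{t-j}-\mu)+a_t$, where the $a_t$ are independent $N(0,\sigma^2)$ random variables, $\sigma^2>0$, and the coefficients lie in the admissible region ($|\phi_1|<1$ if $p=1$; $|\phi_2|<1$, $\phi_1+\phi_2<1$, $\phi_2-\phi_1<1$ if $p=2$). In the known mean case (with $\mu=0$) and also in the unknown mean case, let $\hat\phi_j^{B}$ and $\hat\phi_j^{LS}$ ($1\le j\le p$) denote respectively the Burg and the least squares estimators of $\phi_j$ computed from $z_1,\dots,z_n$. Then, in each of these cases, the biases of the Burg and the least squares estimators are equal to order $1/n$: for every $1\le j\le p$ the following two limits exist and $$\lim_{n\to\infty}n\,E(\hat\phi_j^{B}-\phi_j)=\lim_{n\to\infty}n\,E(\hat\phi_j^{LS}-\phi_j).$$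
   Context: The AR process is the (causal) stationary solution, so $a_t$ is independent of $z_s$ for $s<t$. Put $y_t=z_t$ in the known mean case ($\mu=0$), and $y_t=z_t-\overline z_n$ with $\overline z_n=\frac1n\sum_{t=1}^n z_t$ in the unknown mean case. Least squares estimators: $(\hat\phi_1^{LS},\dots,\hat\phi_p^{LS})$ minimizes $\sum_{t=p+1}^n\bigl(y_t-\sum_{j=1}^p\phi_jy_{t-j}\bigr)^2$ over $(\phi_1,\dots,\phi_p)\in\mathbb R^p$. Burg estimators: for $p=1$, $$\hat\phi_1^{B}=\frac{2\sum_{t=2}^n y_ty_{t-1}}{\sum_{t=2}^n(y_t^2+y_{t-1}^2)}.$$ For $p=2$, $$\hat\phi_2^{B}=1-\frac{CD^2-2ED^2}{CD^2+8F^2G-4FHD},\qquad \hat\phi_1^{B}=\frac{2F}{D}(1-\hat\phi_2^{B}),$$ where $$C=\frac1{n-2}\sum_{t=3}^n(y_t^2+y_{t-2}^2),\quad D=\frac1{n-1}\sum_{t=2}^n(y_t^2+y_{t-1}^2),\quad E=\frac1{n-2}\sum_{t=3}^n y_ty_{t-2},$$ $$F=\frac1{n-1}\sum_{t=2}^n y_ty_{t-1},\quad G=\frac1{n-2}\sum_{t=3}^n y_{t-1}^2,\quad H=\frac1{n-2}\sum_{t=3}^n(y_ty_{t-1}+y_{t-2}y_{t-1}).$$ (The statistic $E$ in these formulas is not the expectation operator $E(\cdot)$ in the claim. In the unknown mean case, replacing the normalizing factors $\frac1{n-1}$ and $\frac1{n-2}$ by $\frac1n$ does not change the estimators. Expectations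 are considered for $n$ large enough that they exist.) *)

(* Defs.v *)
From HB Require Import structures.
From mathcomp Require Import all_boot all_order all_algebra.
From mathcomp Require Import all_classical all_reals all_analysis.
Set Implicit Arguments.
Unset Strict Implicit.
Unset Printing Implicit Defensive.
Import Order.TTheory GRing.Theory Num.Theory.
Import numFieldNormedType.Exports.
Local Open Scope classical_set_scope.
Local Open Scope ring_scope.

(* Coefficients phi_1, ..., phi_p are given by phi : 'I_p -> R, the ordinal j  *)
(* standing for the mathematical index j + 1.                                 *)

Section Process.
Context (d : measure_display) (T : measurableType d) (R : realType).
Variable P : probability T R.

Definition mutually_independent (I : choiceType) (X : I -> {RV P >-> R}) : Prop :=
  forall (s : seq I) (B : I -> set R), uniq s ->
    (forall i, measurable (B i)) ->
    P (\bigcap_(i in [set` s]) (X i @^-1` B i))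
    = (\prod_(i <- s) P (X i @^-1` B i))%E.

Definition past_sigma_algebra (z : int -> {RV P >-> R}) (t : int) : set (set T) :=
  <<s [set E | exists (s : int) (B : set R),
         [/\ s < t, measurable B & E = z s @^-1` B] ]>>.

(* a_t is independent of the whole family (z_s)_{s < t}. *)
Definition independent_of_past (a z : int -> {RV P >-> R}) : Prop :=
  forall (t : int) (B : set R) (E : set T), measurable B ->
    past_sigma_algebra z t E ->
    P ((a t @^-1` B) `&` E) = (P (a t @^-1` B) * P E)%E.

(* normal_prob takes the standard deviation and depends on it only through    *)
(* its square, so the variance is s ^+ 2.                                     *)
Definition gaussian_white_noise (s : R) (a : int -> {RV P >-> R}) : Prop :=
  mutually_independent a /\
  (forall t (B : set R), measurable B ->
     distribution P (a t) B = normal_prob 0 s B).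

(* Second-order stationarity. For the present Gaussian autoregressions it is  *)
(* equivalent to strict stationarity.                                         *)
Definition stationary_with_mean (mu : R) (z : int -> {RV P >-> R}) : Prop :=
  [/\ forall t, (z t : T -> R) \in Lfun P 2%:E,
      forall t, 'E_P[z t]%E = mu%:E &
      forall s t h : int, covariance P (z (s + h)) (z (t + h))
                    = covariance P (z s) (z t)].

Definition AR_equation (p : nat) (phi : 'I_p -> R) (mu : R)
    (a z : int -> {RV P >-> R}) : Prop :=
  forall t : int, {ae P, forall w,
    z t w - mu = \sum_(j < p) phi j * (z (t - (j.+1)%:Z) w - mu) + a t w}.

Definition causal_stationary_AR (p : nat) (phi : 'I_p -> R) (mu s : R)
    (a z : int -> {RV P >-> R}) : Prop :=
  [/\ gaussian_white_noise s a,
      stationary_with_mean mu z,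
      AR_equation phi mu a z &
      independent_of_past a z].

(* The series y_1, ..., y_n entering the estimators, at the outcome w; only   *)
(* the times 1 <= t <= n are ever used.                                       *)
Definition raw_data (z : int -> {RV P >-> R}) (n : nat) (w : T) (t : nat) : R :=
  z t%:Z w.

Definition demeaned_data (z : int -> {RV P >-> R}) (n : nat) (w : T) (t : nat) : R :=
  z t%:Z w - n%:R^-1 * \sum_(1 <= s < n.+1) z s%:Z w.

End Process.

Section Estimators.
Variable R : realType.

Definition admissible (p : nat) : ('I_p -> R) -> Prop :=
  match p return ('I_p -> R) -> Prop with
  | 1%N => fun phi => `|phi ord0| < 1
  | 2%N => fun phi => let phi1 := phi ord0 in let phi2 := phi ord_max in
      [/\ `|phi2| < 1, phi1 + phi2 < 1 & phi2 - phi1 < 1]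
  | _ => fun _ => False
  end.

Definition residual_sum_squares (p n : nat) (y : nat -> R) (phi : 'I_p -> R) : R :=
  \sum_(p.+1 <= t < n.+1) (y t - \sum_(j < p) phi j * y (t - j.+1)%N) ^+ 2.

Definition is_least_squares (p n : nat) (y : nat -> R) (phi : 'I_p -> R) : Prop :=
  forall psi : 'I_p -> R,
    residual_sum_squares n y phi <= residual_sum_squares n y psi.

Definition burg1 (n : nat) (y : nat -> R) : R :=
  (2 * \sum_(2 <= t < n.+1) y t * y t.-1)
  / \sum_(2 <= t < n.+1) (y t ^+ 2 + y t.-1 ^+ 2).

(* The pair (phi_1, phi_2). *)
Definition burg2 (n : nat) (y : nat -> R) : R * R :=
  let C := n.-2%:R^-1 * \sum_(3 <= t < n.+1) (y t ^+ 2 + y t.-2 ^+ 2) in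
  let D := n.-1%:R^-1 * \sum_(2 <= t < n.+1) (y t ^+ 2 + y t.-1 ^+ 2) in
  let E := n.-2%:R^-1 * \sum_(3 <= t < n.+1) y t * y t.-2 in
  let F := n.-1%:R^-1 * \sum_(2 <= t < n.+1) y t * y t.-1 in
  let G := n.-2%:R^-1 * \sum_(3 <= t < n.+1) y t.-1 ^+ 2 in
  let H := n.-2%:R^-1 *
             \sum_(3 <= t < n.+1) (y t * y t.-1 + y t.-2 * y t.-1) in
  let phi2 := 1 - (C * D ^+ 2 - 2 * E * D ^+ 2)
                  / (C * D ^+ 2 + 8 * F ^+ 2 * G - 4 * F * H * D) in
  (2 * F / D * (1 - phi2), phi2).

(* The orders p other than 1 and 2 get a dummy value. *)
Definition burg (p n : nat) (y : nat -> R) : 'I_p -> R :=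
  match p return 'I_p -> R with
  | 1%N => fun _ => burg1 n y
  | 2%N => fun j => if j == ord0 then (burg2 n y).1 else (burg2 n y).2
  | _ => fun _ => 0
  end.

End Estimators.

Section Bias.
Context (d : measure_display) (T : measurableType d) (R : realType).
Variable P : probability T R.

Definition eventually_integrable (X : nat -> T -> R) : Prop :=
  \forall n \near \oo, P.-integrable setT (EFin \o X n).

(* n E(X_n - c) tends to the real number l. *)
Definition bias_limit (X : nat -> T -> R) (c l : R) : Prop :=
  (n%:R%:E * 'E_P[fun w => (X n w - c)%R])%E @[n --> \oo] --> l%:E.

(* y n w t is the series at time t when the sample size is n and the outcome  *)
(* is w. The least squares minimizer is unique only almost surely and for     *)
(* large n, hence the quantification over all measurable choices of it.       *)
Definition same_bias_to_order_1n (p : nat) (phi : 'I_p -> R)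
    (y : nat -> T -> nat -> R) : Prop :=
  forall phiLS : nat -> 'I_p -> {RV P >-> R},
  (forall n, {ae P, forall w,
     is_least_squares n (y n w) (fun j => phiLS n j w)}) ->
  forall j : 'I_p,
    [/\ eventually_integrable (fun n w => burg n (y n w) j),
        eventually_integrable (fun n => phiLS n j) &
        exists l : R,
          bias_limit (fun n w => burg n (y n w) j) (phi j) l /\
          bias_limit (fun n => phiLS n j) (phi j) l].

End Bias.

(* Main.v *)
(* After centring, every average of y_t y_(t-k) entering either estimator equals the
   autocovariance g_k plus a martingale average U plus a quadratic remainder, and U
   and the limit of n times the mean of the remainder do not depend on the range of
   summation, since each average is divided by its own number of terms. Rational
   functions preserve this, and when the averages of equal lag are identified the
   Burg and the least squares formulas both become the Yule-Walker formula, so both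
   estimators have the same second-order expansion.

   It remains to ignore the event where the averages are not close to their limits,
   which has probability O(n^-2). Burg estimators are bounded. For least squares,
   minimality against 0 gives theta^2 Q <= 8 B sum_t x_t^2, where Q is a sum of
   squares of determinants of first differences with integrable negative powers,
   hence E theta^6 = O(n^3). *)

Require Import Defs.
From HB Require Import structures.
From mathcomp Require Import all_boot all_order all_algebra.
From mathcomp Require Import all_classical all_reals all_analysis.
From mathcomp Require Import measurable_realfun ring lra zify.
Set Implicit Arguments.
Unset Strict Implicit.
Unset Printing Implicit Defensive.
Import Order.TTheory GRing.Theory Num.Theory.
Import numFieldNormedType.Exports.
Local Open Scope classical_set_scope.
Local Open Scope ring_scope.

(** Least squares shapes the proof. Its coefficients are unbounded, so an expansion valid with high
    probability says nothing about their means before a moment bound is available. A sixth moment of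
    order n^3 is what a truncation at level e n tolerates, because n * n^3 / n^5 tends to 0. Cubing
    the bound theta^2 Q <= 8 B sum_t x_t^2 and splitting the product of three factors by s b d <=
    s^3 + b^3 + d^3 then calls for moments of order 9 of sum_t x_t^2 / n, of B and of 1 / Q. Since Q
    contains differences only, one bound serves raw and demeaned data, which are treated together as
    [x t - b * xbar] with b = 0 or b = 1.

    The linear parts come from the recursion itself: summed over t it gives for the sample
    autocovariances the Yule-Walker system, perturbed by martingales and by boundary terms, and this
    system can be solved exactly. As to the quadratic parts, a raw average divided by its own number
    of terms is exactly unbiased, and demeaning shifts every average, of whatever lag and range, by
    the same multiple of the squared sample mean. *)

Lemma measurable_inv (R : realType) : measurable_fun [set: R] (fun x : R => x^-1).
Proof.
have -> : [set: R] = [set x | x != 0] `|` [set 0].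
  apply/seteqP; split => x //= _.
  by have [->|x0] := eqVneq x 0; [right|left].
have o : open [set x : R | x != 0].
  rewrite (_ : mkset _ = ~` [set 0]); first exact/closed_openC/accessible_closed_set1/hausdorff_accessible/Rhausdorff.
  by apply/seteqP; split => x /= /eqP.
apply/measurable_funU => //; first exact: open_measurable.
split; last exact: measurable_fun_set1.
by apply: open_continuous_measurable_fun => // x /[!inE] x0; exact: inv_continuous.
Qed.

(** * Level sets, moments and Jensen's inequality *)

Section LevelSets.
Context (d : measure_display) (T : measurableType d) (R : realType).
Implicit Types (X : T -> R) (c : R).

Lemma measurable_gt X c : measurable_fun setT X -> measurable [set w | c < X w].
Proof.
move=> mX; have := mX measurableT `]c, +oo[%classic (measurable_itv _).
by rewrite setTI; congr measurable; apply/seteqP; split => w /=; rewrite in_itv/= andbT.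
Qed.

Lemma measurable_le X c : measurable_fun setT X -> measurable [set w | X w <= c].
Proof.
move=> mX; have := mX measurableT `]-oo, c]%classic (measurable_itv _).
by rewrite setTI; congr measurable; apply/seteqP; split => w /=; rewrite in_itv/=.
Qed.

End LevelSets.

Section Moments.
Context (d : measure_display) (T : measurableType d) (R : realType).
Variable P : probability T R.
Implicit Types X Y : T -> R.

Definition int1 X := P.-integrable setT (EFin \o X).
Definition Ex X : R := Rintegral P setT X.
(** Variables with finite moments of every order form an algebra, so the integrability of polynomial
    expressions becomes a mechanical side condition (tactic [momt]). *)
Definition mom X := measurable_fun setT X /\ forall q, int1 (fun w => X w ^+ q).

Lemma int1_meas X : int1 X -> measurable_fun setT X.
Proof. by move=> /measurable_int/measurable_EFinP. Qed.

Lemma int1_le X Y : measurable_fun setT X -> int1 Y ->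
  (forall w, `|X w| <= Y w) -> int1 X.
Proof.
move=> mX iY XY; apply: (le_integrable _ _ _ iY) => //; first exact/measurable_EFinP.
by move=> w _ /=; rewrite lee_fin (le_trans (XY w))// ler_norm.
Qed.

Lemma int1D X Y : int1 X -> int1 Y -> int1 (fun w => X w + Y w).
Proof. by move=> iX iY; exact: (integrableD _ iX iY). Qed.

Lemma int1Z c X : int1 X -> int1 (fun w => c * X w).
Proof. by move=> iX; exact: (integrableZl _ c iX). Qed.

Lemma int1N X : int1 X -> int1 (fun w => - X w).
Proof. by move=> iX; exact: (integrableN iX). Qed.

Lemma int1B X Y : int1 X -> int1 Y -> int1 (fun w => X w - Y w).
Proof. by move=> iX iY; exact: int1D (int1N iY). Qed.

Lemma int1_cst c : int1 (fun=> c).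
Proof. exact: finite_measure_integrable_cst. Qed.

Lemma int1_norm X : int1 X -> int1 (fun w => `|X w|).
Proof. by move=> iX; exact: (integrable_norm iX). Qed.

Lemma Ex_fin X : int1 X -> (Ex X)%:E = (\int[P]_w (X w)%:E)%E.
Proof. by move=> iX; rewrite /Ex /Rintegral fineK//; exact: integrable_fin_num. Qed.

Lemma ExD X Y : int1 X -> int1 Y -> Ex (fun w => X w + Y w) = Ex X + Ex Y.
Proof. by move=> iX iY; exact: RintegralD. Qed.

Lemma ExB X Y : int1 X -> int1 Y -> Ex (fun w => X w - Y w) = Ex X - Ex Y.
Proof. by move=> iX iY; exact: RintegralB. Qed.

Lemma ExZ c X : int1 X -> Ex (fun w => c * X w) = c * Ex X.
Proof. by move=> iX; exact: RintegralZl. Qed.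

Lemma Ex_cst c : Ex (fun=> c) = c.
Proof.
rewrite /Ex Rintegral_cst// [X in fine X](_ : _ = 1%E) ?mulr1//.
exact: probability_setT.
Qed.

Lemma Ex_le X Y : int1 X -> int1 Y -> (forall w, X w <= Y w) -> Ex X <= Ex Y.
Proof. by move=> iX iY XY; apply: le_Rintegral. Qed.

Lemma Ex_ge0 X : (forall w, 0 <= X w) -> 0 <= Ex X.
Proof. by move=> X0; exact: Rintegral_ge0. Qed.

Lemma Ex_norm X : int1 X -> `|Ex X| <= Ex (fun w => `|X w|).
Proof. by move=> iX; exact: le_normr_Rintegral. Qed.

Lemma eq_Ex X Y : (forall w, X w = Y w) -> Ex X = Ex Y.
Proof. by move=> XY; congr Ex; apply/funext. Qed.

Lemma eq_mom X Y : (forall w, X w = Y w) -> mom X -> mom Y.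
Proof. by move=> /funext ->. Qed.

Lemma mom_meas X : mom X -> measurable_fun setT X. Proof. by case. Qed.

Lemma mom_int X : mom X -> int1 X.
Proof. by move=> [_ /(_ 1%N)]; under [X in int1 X]eq_fun do rewrite expr1. Qed.

Lemma mom_normX X q : mom X -> int1 (fun w => `|X w| ^+ q).
Proof.
move=> [_ /(_ q)/int1_norm].
by under eq_fun do rewrite normrX.
Qed.

Lemma mom_of X : measurable_fun setT X -> (forall q, int1 (fun w => `|X w| ^+ q)) -> mom X.
Proof.
move=> mX iX; split => // q; apply: (int1_le _ (iX q)).
  exact: measurable_funX.
by move=> w; rewrite normrX.
Qed.

Lemma mom_cst c : mom (fun=> c).
Proof. by split => // q; exact: int1_cst. Qed.

Lemma momM X Y : mom X -> mom Y -> mom (fun w => X w * Y w).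
Proof.
move=> mX mY; apply: mom_of.
  by apply: measurable_funM; [case: mX|case: mY].
move=> q; apply: (@int1_le _ (fun w => `|X w| ^+ (q * 2) + `|Y w| ^+ (q * 2))).
- apply: measurable_funX; apply: measurableT_comp => //.
  by apply: measurable_funM; [case: mX|case: mY].
- by apply: int1D; exact: mom_normX.
- move=> w; rewrite normrX normr_id normrM exprMn !exprM.
  set a := _ ^+ q; set b := _ ^+ q.
  have a0 : 0 <= a by rewrite exprn_ge0.
  have b0 : 0 <= b by rewrite exprn_ge0.
  nra.
Qed.

Lemma exprD_le (a b : R) q : 0 <= a -> 0 <= b ->
  (a + b) ^+ q <= 2 ^+ q * (a ^+ q + b ^+ q).
Proof.
move=> a0 b0.
have H (x y : R) : 0 <= x -> 0 <= y -> x <= y ->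
    (x + y) ^+ q <= 2 ^+ q * (x ^+ q + y ^+ q).
  move=> x0 y0 xy; apply: (@le_trans _ _ ((2 * y) ^+ q)).
    by rewrite lerXn2r// ?nnegrE; lra.
  by rewrite exprMn ler_wpM2l ?exprn_ge0// lerDr exprn_ge0.
have [ab|/ltW ab] := leP a b; first exact: H.
by rewrite [a + b]addrC [X in _ * X]addrC; exact: H.
Qed.

Lemma momD X Y : mom X -> mom Y -> mom (fun w => X w + Y w).
Proof.
move=> mX mY; apply: mom_of.
  by apply: measurable_funD; [case: mX|case: mY].
move=> q; apply: (@int1_le _ (fun w => 2 ^+ q * (`|X w| ^+ q + `|Y w| ^+ q))).
- apply: measurable_funX; apply: measurableT_comp => //.
  by apply: measurable_funD; [case: mX|case: mY].
- by apply: int1Z; apply: int1D; exact: mom_normX.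
- move=> w; rewrite normrX normr_id.
  apply: le_trans (exprD_le _ _ _) => //.
  by rewrite lerXn2r ?nnegrE// ?addr_ge0// ler_normD.
Qed.

Lemma momZ c X : mom X -> mom (fun w => c * X w).
Proof. by move=> mX; exact: momM (mom_cst c) mX. Qed.

Lemma momN X : mom X -> mom (fun w => - X w).
Proof. by move=> mX; apply: eq_mom (momZ (-1) mX) => w; rewrite mulN1r. Qed.

Lemma momB X Y : mom X -> mom Y -> mom (fun w => X w - Y w).
Proof. by move=> mX mY; apply: momD => //; exact: momN. Qed.

Lemma momX X k : mom X -> mom (fun w => X w ^+ k).
Proof.
move=> mX; elim: k => [|k IH]; first exact: mom_cst.
by apply: eq_mom (momM mX IH) => w; rewrite exprS.
Qed.

Lemma mom_norm X : mom X -> mom (fun w => `|X w|).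
Proof.
move=> mX; apply: mom_of; first by apply: measurableT_comp => //; case: mX.
by move=> q; under [X in int1 X]eq_fun do rewrite normr_id; exact: mom_normX.
Qed.

Lemma mom_sum (I : Type) (s : seq I) (pr : pred I) (F : I -> T -> R) :
  (forall i, pr i -> mom (F i)) -> mom (fun w => \sum_(i <- s | pr i) F i w).
Proof.
move=> mF; elim: s => [|i s IH].
  by apply: eq_mom (mom_cst 0) => w; rewrite big_nil.
case: (boolP (pr i)) => pi.
  by apply: eq_mom (momD (mF i pi) IH) => w; rewrite big_cons pi.
by apply: eq_mom IH => w; rewrite big_cons (negbTE pi).
Qed.

Lemma Ex_sum (I : Type) (s : seq I) (F : I -> T -> R) :
  (forall i, mom (F i)) -> Ex (fun w => \sum_(i <- s) F i w) = \sum_(i <- s) Ex (F i).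
Proof.
move=> mF; elim: s => [|i s IH].
  by rewrite big_nil -[RHS](Ex_cst 0); apply: eq_Ex => w; rewrite big_nil.
rewrite big_cons -IH -ExD; [|exact: mom_int|by apply: mom_int; exact: mom_sum].
by apply: eq_Ex => w; rewrite big_cons.
Qed.

Lemma expr_convex (a x y : R) q : 0 <= a <= 1 -> 0 <= x -> 0 <= y ->
  (a * x + (1 - a) * y) ^+ q <= a * x ^+ q + (1 - a) * y ^+ q.
Proof.
move=> /andP[a0 a1] x0 y0; elim: q => [|q IH]; first by rewrite !expr0; lra.
rewrite 3!exprS.
have x1 : 0 <= x ^+ q by rewrite exprn_ge0.
have y1 : 0 <= y ^+ q by rewrite exprn_ge0.
(* The gap in the induction step is [a * (1 - a)] times this product, whose two factors have the
   same sign. *)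
have H : 0 <= (x - y) * (x ^+ q - y ^+ q).
  have [xy|/ltW xy] := leP x y.
    by rewrite mulr_le0// subr_le0// lerXn2r.
  by rewrite mulr_ge0// subr_ge0// lerXn2r.
apply: (@le_trans _ _ ((a * x + (1 - a) * y) * (a * x ^+ q + (1 - a) * y ^+ q))).
  by rewrite ler_wpM2l// addr_ge0// mulr_ge0// subr_ge0.
have aa : 0 <= a * (1 - a) by rewrite mulr_ge0// subr_ge0.
have := mulr_ge0 aa H; nra.
Qed.

(** Jensen for averages, by induction: the mean of one more term is a convex combination of the old
    mean and the new term, to which [expr_convex] applies. *)
Lemma expr_mean (u : nat -> R) q n : (forall t, 0 <= u t) ->
  (n.+1%:R^-1 * \sum_(1 <= t < n.+2) u t) ^+ q <=
  n.+1%:R^-1 * \sum_(1 <= t < n.+2) u t ^+ q.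
Proof.
move=> u0; elim: n => [|n IH]; first by rewrite invr1 !mul1r !big_nat1.
rewrite big_nat_recr//= [X in _ <= _ * X]big_nat_recr//=.
set S := \sum_(1 <= t < n.+2) u t in IH *.
set S' := \sum_(1 <= t < n.+2) u t ^+ q in IH *.
have n0 : n.+1%:R != 0 :> R by rewrite pnatr_eq0.
have n1 : n.+1%:R + 1 != 0 :> R by rewrite natr1 pnatr_eq0.
pose a : R := n.+1%:R / n.+2%:R.
have a1 : 1 - a = n.+2%:R^-1 by rewrite /a -[n.+2%:R]natr1; move: (n.+1%:R : R) n1 => N N1; field.
have -> : n.+2%:R^-1 * (S + u n.+2) = a * (n.+1%:R^-1 * S) + (1 - a) * u n.+2.
  rewrite a1 /a -[n.+2%:R]natr1; move: (n.+1%:R : R) n0 n1 => N N0 N1.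
  by field; rewrite N0 N1.
apply: (le_trans (expr_convex _ _ _ _)) => //.
- rewrite /a divr_ge0//= ler_pdivrMr ?ltr0n// mul1r ler_nat//.
- by rewrite mulr_ge0 ?invr_ge0// sumr_ge0.
rewrite a1 mulrDr lerD2r.
apply: le_trans (ler_wpM2l _ IH) _; first by rewrite divr_ge0.
by rewrite mulrA /a [n.+1%:R / _ / _]mulrAC mulfV// mul1r.
Qed.

End Moments.

Ltac momt := repeat first [ assumption | solve [trivial] | exact: mom_cst | apply: momB | apply: momD | apply: momN | apply: momM | apply: momX | apply: mom_norm | apply: mom_sum => ? _].

(** * Joint laws and tail bounds *)

Section JointLaw.
Context d d1 d2 (T : measurableType d) (T1 : measurableType d1)
  (T2 : measurableType d2) (R : realType).
Variables (P : probability T R) (A : {mfun T >-> T1}) (B : {mfun T >-> T2}).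
Hypothesis AB : forall X Y, measurable X -> measurable Y ->
  P (A @^-1` X `&` B @^-1` Y) = (P (A @^-1` X) * P (B @^-1` Y))%E.

Let C w := (A w, B w).

Let mC : measurable_fun setT C.
Proof. exact: measurable_fun_pair. Qed.

Lemma joint_law X : measurable X ->
  (distribution P A \x distribution P B)%E X = pushforward P C X.
Proof.
pose m' : {measure set (T1 * T2) -> \bar R} :=
  distribution P (HB.pack_for {mfun T >-> (T1 * T2)%type} C
    (isMeasurableFun.Build _ _ _ _ _ mC)).
exact: (@product_measure_unique _ _ _ _ _ (distribution P A) (distribution P B) m').
Qed.

(** Tonelli for an independent pair: the law of [(A, B)] is the product of the two laws. The target
    of [B] is left general because it will be the sample space itself, equipped with the past. *)
Lemma ge0_integral_joint (f : T1 * T2 -> \bar R) :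
  measurable_fun setT f -> (forall x, 0 <= f x)%E ->
  (\int[P]_w f (A w, B w) =
   \int[P]_w \int[distribution P A]_u f (u, B w))%E.
Proof.
move=> mf f0.
pose D : {mfun T >-> (T1 * T2)%type} := HB.pack_for {mfun T >-> (T1 * T2)%type} C
    (isMeasurableFun.Build _ _ _ _ _ mC).
have := @ge0_integral_distribution _ _ _ _ _ P D f mf f0.
rewrite /comp /D /= /C => <-.
have -> : (\int[distribution P D]_y f y =
    \int[distribution P A \x distribution P B]_y f y)%E.
  apply: eq_measure_integral => X mX _.
  by rewrite /= joint_law.
rewrite fubini_tonelli2//.
have := @ge0_integral_distribution _ _ _ _ _ P B (fubini_G (distribution P A) f).
rewrite /comp /fubini_G; apply.
  exact: measurable_fun_fubini_tonelli_G.
by move=> y; exact: integral_ge0.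
Qed.

End JointLaw.

Section Dyadic.
Context (d : measure_display) (T : measurableType d) (R : realType).
Variable P : probability T R.

Lemma int1_of_bound (X : T -> R) b : measurable_fun setT X -> (forall w, 0 <= X w) ->
  (\int[P]_w (X w)%:E <= b%:E)%E -> int1 P X /\ Ex P X <= b.
Proof.
move=> mX X0 Xb.
have iX : int1 P X.
  apply/integrableP; split; first exact/measurable_EFinP.
  under eq_integral => w _ do rewrite /= ger0_norm//.
  exact: le_lt_trans Xb (ltry _).
by split => //; rewrite -lee_fin Ex_fin.
Qed.

(** If k is the largest index with 16^k < X, then X^q <= 16^(q (k+1)), so X^q is at most 1 plus the
    sum of the [g k]. A tail of order q+1, one more than the moment, leaves the geometric series of
    ratio 1/16. The base 16 = 2^4 suits the estimate of [detsum], where a scale e = 2^-k produces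
    the level e^4. *)
Lemma dyadic_moment (X : T -> R) (q : nat) (c : R) : measurable_fun setT X -> (forall w, 0 <= X w) ->
  (0 <= c)%R ->
  (forall k, P [set w | (16 ^+ k < X w)%R] <= (c * 16^-1 ^+ (q.+1 * k))%:E)%E ->
  int1 P (fun w => X w ^+ q) /\ Ex P (fun w => X w ^+ q) <= 1 + 2 * 16 ^+ q * c.
Proof.
move=> mX X0 c0 tail.
have mE k : measurable [set w | 16 ^+ k < X w].
  exact: (measurable_gt _ mX).
pose g k w : R := 16 ^+ (q * k.+1) * \1_[set w | 16 ^+ k < X w] w.
have g0 k w : 0 <= g k w by rewrite mulr_ge0 ?exprn_ge0.
have mg k : measurable_fun setT (g k).
  by apply: measurable_funM => //; exact: measurable_indic.
have mS : measurable_fun setT (fun w => \sum_(k <oo) (g k w)%:E)%E.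
  apply: (ge0_emeasurable_sum (P := xpredT)) => [k w _ _|k _].
    by rewrite lee_fin.
  by apply/measurable_EFinP.
apply: (@int1_of_bound (fun w => X w ^+ q)); [exact: measurable_funX|by move=> w; rewrite exprn_ge0|].
apply: (@le_trans _ _ (\int[P]_w (1 + \sum_(k <oo) (g k w)%:E))%E).
  apply: ge0_le_integral => //.
  - by move=> w _; rewrite lee_fin exprn_ge0.
  - by apply/measurable_EFinP; exact: measurable_funX.
  - exact: emeasurable_funD.
  move=> w _; have [X1|X1] := leP (X w) 1.
    apply: (@le_trans _ _ 1%E); first by rewrite lee_fin exprn_ile1.
    by rewrite leeDl// nneseries_ge0// => k _ _; rewrite lee_fin.
  have ex : exists k, X w <= 16 ^+ k.
    exists (Num.truncn (X w)).+1; apply: (le_trans (ltW (Num.Theory.truncnS_gt _))).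
    by rewrite -natrX ler_nat ltnW// ltn_expl.
  case: (ex_minnP ex) => -[|k] Xk kmin; first by rewrite expr0 leNgt X1 in Xk.
  have kX : 16 ^+ k < X w.
    by rewrite ltNge; apply/negP => /kmin; rewrite ltnn.
  apply: (@le_trans _ _ (g k w)%:E).
    rewrite lee_fin /g indicE mem_set//= mulr1 mulnC exprM.
    by rewrite lerXn2r ?nnegrE// exprn_ge0.
  apply: (@le_trans _ _ (\sum_(0 <= k < k.+1) (g k w)%:E)%E).
    by rewrite big_nat_recr//= leeDr// sume_ge0// => i _; rewrite lee_fin.
  apply: (le_trans (nneseries_lim_ge _ _)); first by move=> i _ _; rewrite lee_fin.
  by rewrite leeDr.
rewrite ge0_integralD//=; last first.
  by move=> w _; apply: nneseries_ge0 => k _ _; rewrite lee_fin.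
rewrite integral_cst// mul1e [X in (X + _)%E](_ : _ = 1%E); last exact: probability_setT.
rewrite EFinD leeD2l//.
rewrite integral_nneseries//; last 2 first.
- by move=> k; apply/measurable_EFinP.
- by move=> k w _; rewrite lee_fin.
apply: lime_le.
  by apply: is_cvg_nneseries => k _ _; apply: integral_ge0 => w _; rewrite lee_fin.
apply: nearW => n.
apply: (@le_trans _ _ (\sum_(0 <= k < n) (16 ^+ q * c * 16^-1 ^+ k)%:E)%E).
  apply: lee_sum => k _.
  rewrite /g; under eq_integral do rewrite EFinM.
  rewrite integralZl//; last by apply: integrable_indic.
  rewrite integral_indic// setIT.
  apply: (@le_trans _ _ ((16 ^+ (q * k.+1))%:E * (c * 16^-1 ^+ (q.+1 * k))%:E)%E).
    by apply: lee_wpmul2l; [rewrite lee_fin exprn_ge0|exact: tail].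
  rewrite -EFinM lee_fin mulnS mulSn !exprD.
  have : 16 ^+ (q * k) * 16^-1 ^+ (q * k) = 1 :> R.
    by rewrite -exprMn mulfV// expr1n.
  move: (16 ^+ (q * k) : R) (16^-1 ^+ (q * k) : R) => x y xy.
  move: (16 ^+ q : R) (16^-1 ^+ k : R) => z t.
  have -> : z * x * (c * (t * y)) = z * c * t * (x * y) by ring.
  by rewrite xy mulr1.
rewrite sumEFin lee_fin -mulr_sumr -[X in _ <= X]mulrA [X in _ <= X]mulrC ler_wpM2l//.
  by rewrite mulr_ge0// exprn_ge0.
have := @geometric_le_lim R n 1 16^-1 ler01; rewrite /series /=.
under eq_bigr do rewrite mul1r.
have i16 : `|16^-1| = 16^-1 :> R by rewrite ger0_norm.
rewrite i16 mul1r => H; apply: (le_trans (H _ _)); [lra|lra|].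
by rewrite -[leRHS]invrK lef_pV2 ?posrE; lra.
Qed.

End Dyadic.

Section NormalLaw.
Context (R : realType).
Variable s : R.
Hypothesis s0 : s != 0.

Let mpdf : measurable_fun [set: R] (fun u => (normal_pdf 0 s u)%:E).
Proof. by apply/measurable_EFinP; exact: measurable_normal_pdf. Qed.

Lemma normal_prob_ball (c eta : R) : 0 <= eta ->
  (normal_prob 0 s [set u | (`|u + c| <= eta)%R] <= (2 * normal_peak s * eta)%:E)%E.
Proof.
move=> eta0; rewrite /normal_prob.
have -> : [set u | (`|u + c| <= eta)%R] = `[- c - eta, - c + eta]%classic.
  apply/seteqP; split => u /=; rewrite in_itv/= ler_norml => /andP[? ?]; apply/andP; split; lra.
apply: (@le_trans _ _ (\int[lebesgue_measure]_(x in `[(- c - eta)%R, (- c + eta)%R]) (normal_peak s)%:E)%E).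
  apply: ge0_le_integral => //.
  - by move=> u _; rewrite lee_fin normal_pdf_ge0.
  - by apply: measurable_funTS; exact: mpdf.
  - by move=> u _; rewrite lee_fin normal_pdf_ub.
rewrite integral_cst//= lebesgue_measure_itv/= lte_fin.
case: ifPn => _; last by rewrite mule0 lee_fin !mulr_ge0// normal_peak_ge0.
by rewrite -EFinD -EFinM lee_fin le_eqVlt; apply/orP; left; apply/eqP; ring.
Qed.

(** The density of deviation s is [K * exp (- b u^2)] times the density of deviation 2 s, and exp (-
    b u^2) is at most (m+1)! / (b u^2)^(m+1). The remaining density integrates to at most 1, so no
    Gaussian moment has to be computed. *)
Lemma normal_prob_tail (m : nat) : exists2 c : R, 0 <= c & forall k,
  (normal_prob 0 s [set u | (16 ^+ k < u ^+ 2)%R] <= (c * 16^-1 ^+ (m.+1 * k))%:E)%E.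
Proof.
have s2 : 0 < s ^+ 2 by rewrite exprn_even_gt0.
have s20 : 2 * s != 0 by rewrite mulf_neq0.
pose K := normal_peak s / normal_peak (2 * s).
have K0 : 0 <= K by rewrite divr_ge0 ?normal_peak_ge0.
pose b := 3 / (8 * s ^+ 2).
have b0 : 0 < b by rewrite divr_gt0// mulr_gt0.
have pdfE u : normal_pdf 0 s u = K * expR (- (b * u ^+ 2)) * normal_pdf 0 (2 * s) u.
  have p2 : normal_peak (2 * s) != 0 by rewrite gt_eqF// normal_peak_gt0.
  rewrite !normal_pdfE// /normal_fun !subr0.
  have -> : - u ^+ 2 / (s ^+ 2 *+ 2) = - (b * u ^+ 2) - u ^+ 2 / ((2 * s) ^+ 2 *+ 2).
    by rewrite /b; field.
  by rewrite expRD mulNr /K; field.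
exists (K * (b ^- m.+1 * m.+1`!%:R)).
  by rewrite mulr_ge0// mulr_ge0// invr_ge0 exprn_ge0// ltW.
move=> k; rewrite /normal_prob.
have mE : measurable [set u : R | (16 ^+ k < u ^+ 2)%R].
  apply: measurable_gt; exact: exprn_measurable.
pose c := K * (b ^- m.+1 * m.+1`!%:R) * 16^-1 ^+ (m.+1 * k).
have c0 : 0 <= c.
  rewrite mulr_ge0 ?exprn_ge0// mulr_ge0// mulr_ge0// invr_ge0 exprn_ge0// ltW//.
apply: (@le_trans _ _ (\int[lebesgue_measure]_(x in [set u | (16 ^+ k < u ^+ 2)%R])
    (c%:E * (normal_pdf 0 (2 * s) x)%:E))%E).
  apply: ge0_le_integral => //.
  - by move=> u _; rewrite lee_fin normal_pdf_ge0.
  - by apply: measurable_funTS; exact: mpdf.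
  - apply: measurable_funTS; apply: measurable_funeM.
    by apply/measurable_EFinP; exact: measurable_normal_pdf.
  move=> u /= uk; rewrite -EFinM lee_fin pdfE ler_wpM2r ?normal_pdf_ge0//.
  rewrite /c -mulrA ler_wpM2l// expRN.
  have y0 : 0 < (b * u ^+ 2) ^+ m.+1 / m.+1`!%:R.
    rewrite divr_gt0 ?ltr0n ?fact_gt0// exprn_gt0// mulr_gt0//.
    by apply: le_lt_trans uk; rewrite exprn_ge0.
  apply: (@le_trans _ _ ((b * u ^+ 2) ^+ m.+1 / m.+1`!%:R)^-1).
    rewrite lef_pV2 ?posrE ?expR_gt0//.
    have bu : 0 <= b * u ^+ 2 by rewrite mulr_ge0 ?(ltW b0)// sqr_ge0.
    by apply: le_trans (expR_ge1Dxn m bu); rewrite lerDr.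
  rewrite invf_div exprMn invfM mulrCA -[leRHS]mulrA ler_wpM2l ?invr_ge0 ?exprn_ge0 ?(ltW b0)//.
  have i16 : 0 <= 16^-1 ^+ k :> R by rewrite exprn_ge0// invr_ge0.
  have iu : 0 <= (u ^+ 2)^-1 by rewrite invr_ge0 sqr_ge0.
  rewrite ler_wpM2l// mulnC exprM -exprVn; apply: lerXn2r; rewrite ?nnegrE//.
  have u2 : 0 < u ^+ 2 by apply: le_lt_trans uk; rewrite exprn_ge0.
  have k2 : 0 < 16 ^+ k :> R by rewrite exprn_gt0.
  by rewrite exprVn lef_pV2 ?posrE// ltW.
rewrite ge0_integralZl//; last 2 first.
- by apply: measurable_funTS; apply/measurable_EFinP; exact: measurable_normal_pdf.
- by move=> u _; rewrite lee_fin normal_pdf_ge0.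
rewrite -[leRHS]mule1; apply: lee_wpmul2l; first by rewrite lee_fin.
exact: (@probability_le1 _ _ _ (normal_prob 0 (2 * s))).
Qed.

End NormalLaw.

(** * Innovations and the past *)

Section Innovation.
Context (d : measure_display) (T : measurableType d) (R : realType).
Variables (P : probability T R) (a : T -> R) (F : set (set T)).

(** The sample space is re-equipped with the sigma-algebra generated by [F]; the usual closure
    properties of measurable functions then hold for functions of the past. *)
Definition past_meas (Y : T -> R) :=
  measurable_fun [set: g_sigma_algebraType F] (Y : g_sigma_algebraType F -> R).

Lemma past_cst c : past_meas (fun=> c).
Proof. exact: measurable_cst. Qed.

Lemma pastD X Y : past_meas X -> past_meas Y -> past_meas (fun w => X w + Y w).
Proof. exact: measurable_funD. Qed.

Lemma pastM X Y : past_meas X -> past_meas Y -> past_meas (fun w => X w * Y w).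
Proof. exact: measurable_funM. Qed.

Lemma pastN X : past_meas X -> past_meas (fun w => - X w).
Proof. exact: measurableT_comp. Qed.

Lemma pastB X Y : past_meas X -> past_meas Y -> past_meas (fun w => X w - Y w).
Proof. by move=> mX mY; apply: pastD => //; exact: pastN. Qed.

Lemma pastX X k : past_meas X -> past_meas (fun w => X w ^+ k).
Proof. exact: measurable_funX. Qed.

Lemma past_norm X : past_meas X -> past_meas (fun w => `|X w|).
Proof. exact: measurableT_comp. Qed.

Lemma past_inv X : past_meas X -> past_meas (fun w => (X w)^-1).
Proof. by move=> mX; apply: measurableT_comp => //; exact: measurable_inv. Qed.

Lemma past_sum (I : Type) (r : seq I) (f : I -> T -> R) :
  (forall i, past_meas (f i)) -> past_meas (fun w => \sum_(i <- r) f i w).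
Proof. by move=> mf; exact: measurable_sum. Qed.

Lemma past_le X c : past_meas X -> <<s F >> [set w | X w <= c].
Proof.
move=> mX; have := mX measurableT `]-oo, c]%classic (measurable_itv _).
by rewrite setTI; congr (<<s F >> _); apply/seteqP; split => w /=; rewrite in_itv/=.
Qed.

Lemma past_gt X c : past_meas X -> <<s F >> [set w | c < X w].
Proof.
move=> mX; have := mX measurableT `]c, +oo[%classic (measurable_itv _).
by rewrite setTI; congr (<<s F >> _); apply/seteqP; split => w /=; rewrite in_itv/= andbT.
Qed.

Lemma pastI E1 E2 : <<s F >> E1 -> <<s F >> E2 -> <<s F >> (E1 `&` E2).
Proof. exact: (@measurableI _ (g_sigma_algebraType F)). Qed.

Lemma pastT : <<s F >> [set: T].
Proof. exact: (@measurableT _ (g_sigma_algebraType F)). Qed.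

Hypothesis ma : measurable_fun setT a.
Hypothesis FT : forall E, <<s F >> E -> measurable E.
Hypothesis aF : forall B E, measurable B -> <<s F >> E ->
  P (a @^-1` B `&` E) = (P (a @^-1` B) * P E)%E.

Lemma past_measurable Y : past_meas Y -> measurable_fun setT Y.
Proof. by move=> mY _ B mB; rewrite setTI; apply: FT; rewrite -[X in <<s F >> X]setTI; exact: mY. Qed.

Let A : {mfun T >-> R} := HB.pack_for {mfun T >-> R} a (isMeasurableFun.Build _ _ _ _ _ ma).

Let mid : measurable_fun [set: T] (idfun : T -> g_sigma_algebraType F).
Proof. by move=> _ B mB; rewrite setTI; exact: FT. Qed.

Let I : {mfun T >-> g_sigma_algebraType F} :=
  HB.pack_for {mfun T >-> g_sigma_algebraType F} (idfun : T -> g_sigma_algebraType F)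
    (isMeasurableFun.Build _ _ _ _ _ mid).

(** Freezing the past: [aF] says that [a] is independent of the identity map into the sample space
    equipped with the past, so Tonelli for an independent pair applies. This takes the place of
    conditional expectations. *)
Lemma ge0_integral_innov_past (f : R * T -> \bar R) :
  measurable_fun [set: R * g_sigma_algebraType F] (f : R * g_sigma_algebraType F -> \bar R) ->
  (forall x, 0 <= f x)%E ->
  (\int[P]_w f (a w, w) = \int[P]_w \int[P]_v f (a v, w))%E.
Proof.
move=> mf f0.
have AI : forall X Y, measurable X -> measurable Y ->
    P (A @^-1` X `&` I @^-1` Y) = (P (A @^-1` X) * P (I @^-1` Y))%E.
  by move=> B E mB mE; exact: aF.
rewrite (ge0_integral_joint AI mf f0)/=.
apply: eq_integral => w _; rewrite (ge0_integral_distribution A)//.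
exact: (measurableT_comp mf (pair2_measurable (w : g_sigma_algebraType F))).
Qed.

(** Given the past, [W] is a constant shift, and the bound [K] on small balls is uniform in the
    shift; integrating over the past event [E] gives the factor [P E]. *)
Lemma innov_ball K W E eta :
  (forall c, P [set w | (`|a w + c| <= eta)%R] <= K%:E)%E -> past_meas W -> <<s F >> E ->
  (P ([set w | (`|a w + W w| <= eta)%R] `&` E) <= K%:E * P E)%E.
Proof.
move=> ball mW mE.
have K0 : (0 <= K)%R by rewrite -lee_fin; exact: le_trans (ball 0).
pose f (x : R * T) : \bar R := (\1_[set x : R * T | (`|x.1 + W x.2| <= eta)%R] x * \1_E x.2)%:E.
have mE' := FT mE.
have mC : measurable [set x : R * g_sigma_algebraType F | (`|x.1 + W x.2| <= eta)%R].
  have m : measurable_fun [set: R * g_sigma_algebraType F]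
      (fun x : R * g_sigma_algebraType F => `|x.1 + W x.2|).
    apply: measurableT_comp => //; apply: measurable_funD => //.
    exact: (measurableT_comp (f := W : g_sigma_algebraType F -> R) mW).
  exact: (measurable_le _ m).
have := @ge0_integral_innov_past f.
have -> : (\int[P]_w f (a w, w) = P ([set w | (`|a w + W w| <= eta)%R] `&` E))%E.
  rewrite -(setIT (_ `&` E)) -integral_indic//; last first.
    apply: measurableI => //.
    have m : measurable_fun setT (fun w => `|a w + W w|).
      apply: measurableT_comp => //; apply: measurable_funD => //.
      exact: past_measurable.
    exact: (measurable_le _ m).
  by apply: eq_integral => w _; rewrite indicI.
have mf : measurable_fun [set: R * g_sigma_algebraType F] (f : R * g_sigma_algebraType F -> \bar R).
  apply/measurable_EFinP; apply: measurable_funM.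
    exact: (@measurable_indic _ (R * g_sigma_algebraType F)%type R setT _ mC).
  exact: (measurableT_comp (@measurable_indic _ (g_sigma_algebraType F) R setT _ mE)).
have f0 x : (0 <= f x)%E by rewrite lee_fin.
move=> ->//.
rewrite -[X in (_ * P X)%E]setIT -integral_indic// -ge0_integralZl//; last first.
  by apply/measurable_EFinP; exact: measurable_indic.
apply: ge0_le_integral => //.
- by move=> w _; apply: integral_ge0 => u _; rewrite lee_fin.
- have m : measurable_fun [set: g_sigma_algebraType F]
      (@fubini_G _ _ R (g_sigma_algebraType F) R (distribution P A) f).
    by apply: measurable_fun_fubini_tonelli_G.
  rewrite (_ : (fun w => _) = (@fubini_G _ _ R (g_sigma_algebraType F) R (distribution P A) f \o idfun)).
    exact: (measurableT_comp m mid).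
  apply/funext => w /=.
  rewrite /fubini_G (ge0_integral_distribution A)//.
  exact: (measurableT_comp mf (pair2_measurable (w : g_sigma_algebraType F))).
- by apply: measurable_funeM; apply/measurable_EFinP; exact: measurable_indic.
move=> w _; rewrite /f/=.
have -> : (\int[P]_v (\1_[set x : R * T | (`|x.1 + W x.2| <= eta)%R] (a v, w) * \1_E w)%:E =
    \int[P]_v ((\1_E w)%:E * (\1_[set v | (`|a v + W w| <= eta)%R] v)%:E))%E.
  by apply: eq_integral => v _; rewrite !indicE EFinM muleC; congr (_ * (_)%:R%:E)%E;
     rewrite !asboolb ?in_setE.
have mV : measurable [set v | (`|a v + W w| <= eta)%R].
  have m : measurable_fun setT (fun v => `|a v + W w|).
    by apply: measurableT_comp => //; apply: measurable_funD.
  exact: (measurable_le _ m).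
rewrite ge0_integralZl//; last by apply/measurable_EFinP; exact: measurable_indic.
rewrite muleC; apply: lee_wpmul2r; first by rewrite lee_fin.
rewrite integral_indic// setIT; exact: ball.
Qed.

Lemma innov_prod (g : R -> R) Y : measurable_fun setT g -> mom P (g \o a) ->
  past_meas Y -> mom P Y ->
  Ex P (fun w => g (a w) * Y w) = Ex P (g \o a) * Ex P Y.
Proof.
have pos (h : R -> R) Z : measurable_fun setT h -> mom P (h \o a) ->
    past_meas Z -> mom P Z -> (forall u, 0 <= h u) -> (forall w, 0 <= Z w) ->
    Ex P (fun w => h (a w) * Z w) = Ex P (h \o a) * Ex P Z.
  move=> mh mha pZ mZ h0 Z0; apply: EFin_inj.
  rewrite EFinM !Ex_fin//; [|exact: mom_int|exact: mom_int|by apply: mom_int; exact: momM].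
  have := @ge0_integral_innov_past (fun x => (h x.1 * Z x.2)%:E); rewrite /= => ->.
  - have hZ w : (0 <= (Z w)%:E)%E by rewrite lee_fin.
    have hh u : (0 <= (h u)%:E)%E by rewrite lee_fin.
    have mhE : measurable_fun setT (fun w => (h (a w))%:E).
      exact/measurable_EFinP/(mom_meas mha).
    have mZE : measurable_fun setT (fun w => (Z w)%:E).
      exact/measurable_EFinP/(mom_meas mZ).
    rewrite -ge0_integralZl//; last by apply: integral_ge0 => u _; exact: hh.
    apply: eq_integral => w _; rewrite muleC -ge0_integralZl//.
    by apply: eq_integral => u _; rewrite /= EFinM muleC.
  - apply/measurable_EFinP; apply: measurable_funM; first exact: measurableT_comp.
    exact: (measurableT_comp (f := Z : g_sigma_algebraType F -> R) pZ).
  - by move=> x; rewrite lee_fin mulr_ge0.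
(* Signed case: [g] is the difference of the nonnegative functions [|g|] and [|g| - g], and likewise
   [Y]; the product expands into four nonnegative cases. *)
move=> mg mga pY mY.
have mg' : measurable_fun setT (fun u => `|g u| - g u).
  by apply: measurable_funB => //; exact: measurableT_comp.
have mgn : measurable_fun setT (fun u => `|g u|) by exact: measurableT_comp.
have pos' (x : R) : 0 <= `|x| - x by rewrite subr_ge0 ler_norm.
have m1 : mom P ((fun u => `|g u|) \o a) by exact: mom_norm.
have m2 : mom P ((fun u => `|g u| - g u) \o a) by apply: momB => //; exact: mom_norm.
have m3 : mom P (fun w => `|Y w|) by exact: mom_norm.
have m4 : mom P (fun w => `|Y w| - Y w) by exact: momB.
have p3 := past_norm pY.
have p4 : past_meas (fun w => `|Y w| - Y w) by exact: pastB.
have e1 := pos _ _ mgn m1 p3 m3 (fun u => normr_ge0 _) (fun u => normr_ge0 _).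
have e2 := pos _ _ mg' m2 p3 m3 (fun u => pos' _) (fun u => normr_ge0 _).
have e3 := pos _ _ mgn m1 p4 m4 (fun u => normr_ge0 _) (fun u => pos' _).
have e4 := pos _ _ mg' m2 p4 m4 (fun u => pos' _) (fun u => pos' _).
have E1 : Ex P ((fun u => `|g u| - g u) \o a) = Ex P ((fun u => `|g u|) \o a) - Ex P (g \o a).
  by rewrite -ExB//; exact: mom_int.
have E2 : Ex P (fun w => `|Y w| - Y w) = Ex P (fun w => `|Y w|) - Ex P Y.
  by rewrite -ExB//; exact: mom_int.
rewrite (@eq_Ex _ _ _ _ _ (fun w => `|g (a w)| * `|Y w| - (`|g (a w)| - g (a w)) * `|Y w|
   - `|g (a w)| * (`|Y w| - Y w) + (`|g (a w)| - g (a w)) * (`|Y w| - Y w))); last by move=> w; ring.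
rewrite ExD ?ExB ?e1 ?e2 ?e3 ?e4 ?E1 ?E2; first by ring.
all: apply: mom_int; do ?[apply: momB|apply: momM] => //.
Qed.

End Innovation.

(** * Moments of the process *)

Section Lyapunov.
Context (R : realType) (f1 f2 : R).
Hypotheses (h1 : `|f2| < 1) (h2 : f1 + f2 < 1) (h3 : f2 - f1 < 1).

Let f2lt : -1 < f2 < 1. Proof. by move: h1; rewrite ltr_norml. Qed.

(** The expression factors into the three linear forms whose positivity defines the admissible
    triangle. It is the determinant of the Yule-Walker system for the autocovariances of lag 0 and
    1, and is the denominator wherever that system is solved. *)
Lemma ar2_det_gt0 : 0 < (1 - f2) * (1 - f1 ^+ 2 - f2 ^+ 2) - 2 * f1 ^+ 2 * f2.
Proof.
rewrite (_ : _ - _ = (1 + f2) * ((1 - f2 - f1) * (1 - f2 + f1))); last by ring.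
have /andP[? ?] := f2lt; move: (h2) (h3) => ? ?.
by apply: mulr_gt0; [lra|apply: mulr_gt0; lra].
Qed.

(* V (u, w) = w^2 / 2 + sum_k (first coordinate of A^k (u, w))^2, where A is the
   companion matrix: this makes V (A v) = V v - |v|^2 / 2. *)
Lemma ar2_lyapunov : exists (V : R -> R -> R) (rho C : R),
  [/\ 0 < rho < 1, 0 < C,
      forall u w, (u ^+ 2 + w ^+ 2) / 2 <= V u w,
      forall u w, V u w <= C * (u ^+ 2 + w ^+ 2) &
      forall u w h, V (f1 * u + f2 * w + h) u <= rho * V u w + C * h ^+ 2] /\
  exists c0 c1 c2, forall u w, V u w = c0 * u ^+ 2 + c1 * (u * w) + c2 * w ^+ 2.
Proof.
have D0 := ar2_det_gt0.
set D := _ - _ in D0.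
have /andP[f2l f2r] := f2lt.
have e0 : 0 < 1 - f2 by lra.
have e1 : 1 - f2 != 0 by rewrite gt_eqF.
have D1 : D != 0 by rewrite gt_eqF.
pose p := (1 - f2) / D.
have p0 : 0 < p by rewrite divr_gt0.
pose k := f1 * f2 / (1 - f2).
pose c := p * f2 ^+ 2 * (1 - (f1 / (1 - f2)) ^+ 2) + 1 / 2.
have c12 : 1 / 2 <= c.
  have g : 0 <= 1 - (f1 / (1 - f2)) ^+ 2.
    rewrite subr_ge0 expr_div_n ler_pdivrMr ?exprn_gt0// mul1r -subr_ge0 subr_sqr.
    by move: (h2) (h3) => ? ?; apply: mulr_ge0; lra.
  by rewrite lerDr; apply: mulr_ge0 => //; apply: mulr_ge0; [exact: ltW|exact: sqr_ge0].
(* Completed square of the solution of the equation [VA]. Its leading coefficient [p] is the sum of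
   the squared impulse responses, that is the variance of the process with unit innovation
   variance. *)
pose V u w := p * (u + k * w) ^+ 2 + c * w ^+ 2.
have V0 u w : 0 <= V u w.
  apply: addr_ge0; apply: mulr_ge0; rewrite ?sqr_ge0 ?(ltW p0)//; lra.
have VA u w : V (f1 * u + f2 * w) u = V u w - (u ^+ 2 + w ^+ 2) / 2.
  rewrite /V /c /k /p /D; move: D1; rewrite /D => D1; field.
  by rewrite e1 D1.
have Vlow u w : (u ^+ 2 + w ^+ 2) / 2 <= V u w.
  by have := V0 (f1 * u + f2 * w) u; rewrite VA subr_ge0.
pose C := 2 * p + 2 * p * k ^+ 2 + c + 1.
have C1 : 1 <= C.
  have := mulr_ge0 (ltW p0) (sqr_ge0 k); rewrite /C; lra.
have Vup u w : V u w <= C * (u ^+ 2 + w ^+ 2).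
  have pu : 0 <= p * (u - k * w) ^+ 2 by rewrite mulr_ge0 ?sqr_ge0// ltW.
  have q1 := mulr_ge0 (ltW p0) (sqr_ge0 w).
  have q2 := mulr_ge0 (ltW p0) (sqr_ge0 (k * u)).
  have q3 : 0 <= c * u ^+ 2 by rewrite mulr_ge0 ?sqr_ge0//; lra.
  have q4 := sqr_ge0 u. have q5 := sqr_ge0 w.
  rewrite /V /C; nra.
(* By [Vup] the loss (u^2 + w^2) / 2 is at least [de * V], a contraction by 1 - de. Half of [de] is
   then given up to absorb the cross term with h: (1 + de/2) (1 - de) <= 1 - de/2. *)
pose de := 1 / (2 * C).
have de0 : 0 < de by rewrite divr_gt0//; lra.
have de1 : de <= 1 / 2 by rewrite ler_pdivrMr; nra.
have Vdec u w : V u w - (u ^+ 2 + w ^+ 2) / 2 <= (1 - de) * V u w.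
  rewrite mulrBl mul1r lerD2l lerN2 /de mulrC mulrA mulr1 ler_pdivrMr; last by lra.
  by have := Vup u w; lra.
have Vquad u w h e : 0 < e -> V (u + h) w <= (1 + e) * V u w + (1 + e^-1) * (p * h ^+ 2).
  move=> e_gt0.
  have H : 0 <= e^-1 * (p * (e * (u + k * w) - h) ^+ 2 + c * (e * w) ^+ 2).
    apply: mulr_ge0; first by rewrite invr_ge0 ltW.
    apply: addr_ge0; apply: mulr_ge0; rewrite ?sqr_ge0 ?(ltW p0)//; lra.
  rewrite -subr_ge0; apply: le_trans H _.
  rewrite le_eqVlt; apply/orP; left; apply/eqP; rewrite /V; field.
  by rewrite gt_eqF.
exists V, (1 - de / 2), (C + (1 + (de / 2)^-1) * p); split.
  have q0 : 0 <= (1 + (de / 2)^-1) * p by rewrite mulr_ge0 ?(ltW p0)// addr_ge0// invr_ge0; lra.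
  split => //.
  - by apply/andP; split; lra.
  - by lra.
  - move=> u w; apply: le_trans (Vup u w) _.
    by rewrite ler_wpM2r ?addr_ge0 ?sqr_ge0//; lra.
  move=> u w h; apply: le_trans (Vquad _ _ _ (de / 2) _) _; first by lra.
  rewrite VA mulrA; move: (Vdec u w) (V0 u w) (sqr_ge0 h).
  move: ((1 + (de / 2)^-1) * p) q0 => q q0.
  set v := _ - _ / 2; set v' := V u w => vd v0 hh.
  have a1 : (1 + de / 2) * v <= (1 + de / 2) * ((1 - de) * v') by rewrite ler_wpM2l//; lra.
  have a2 := mulr_ge0 (sqr_ge0 de) v0.
  have a3 : 0 <= C * h ^+ 2 by rewrite mulr_ge0//; lra.
  nra.
exists p, (2 * p * k), (p * k ^+ 2 + c) => u w; rewrite /V; ring.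
Qed.

End Lyapunov.

Section Laws.
Context (d : measure_display) (T : measurableType d) (R : realType).
Variable P : probability T R.

Lemma markov_gt (X : T -> R) (c : R) : int1 P X -> (forall w, (0 <= X w)%R) -> (0 < c)%R ->
  (P [set w | (c < X w)%R] <= (Ex P X / c)%:E)%E.
Proof.
move=> iX X0 c0; have mX := int1_meas iX.
have mE : measurable [set w | (c < X w)%R].
  exact: (measurable_gt _ mX).
rewrite mulrC EFinM Ex_fin//.
rewrite -ge0_integralZl//; last 3 first.
- exact/measurable_EFinP.
- by move=> w _; rewrite lee_fin.
- by rewrite lee_fin invr_ge0 ltW.
rewrite -[X in (P X <= _)%E]setIT -integral_indic//.
apply: ge0_le_integral => //.
- by apply/measurable_EFinP; exact: measurable_indic.
- by apply: measurable_funeM; exact/measurable_EFinP.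
move=> w _; rewrite -EFinM lee_fin indicE.
have [wE|wE] := boolP (w \in _); last by rewrite mulr_ge0// invr_ge0 ltW.
by rewrite mulrC ler_pdivlMr// mul1r ltW//; move: wE; rewrite inE.
Qed.

Lemma same_law_Ex (a b : T -> R) (g : R -> R) :
  measurable_fun setT a -> measurable_fun setT b ->
  (forall B, measurable B -> P (a @^-1` B) = P (b @^-1` B)) ->
  measurable_fun setT g -> int1 P (g \o a) -> int1 P (g \o b) -> Ex P (g \o a) = Ex P (g \o b).
Proof.
move=> ma mb ab mg ia ib; apply: EFin_inj; rewrite !Ex_fin//.
pose A : {mfun T >-> R} := HB.pack_for {mfun T >-> R} a (isMeasurableFun.Build _ _ _ _ _ ma).
pose B : {mfun T >-> R} := HB.pack_for {mfun T >-> R} b (isMeasurableFun.Build _ _ _ _ _ mb).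
have mgE : measurable_fun setT (EFin \o g) by exact/measurable_EFinP.
rewrite -(@integral_distribution _ _ _ _ _ P A (EFin \o g))//.
rewrite -(@integral_distribution _ _ _ _ _ P B (EFin \o g))//.
by apply: eq_measure_integral => X mX _; exact: ab.
Qed.

(** Discards a transient: the initial value of the autoregression, and, with [B = 0], it shows that
    an event has probability zero. *)
Lemma limit_le_geometric (p A B rho : R) : 0 <= rho < 1 ->
  (forall m, p <= A * rho ^+ m + B) -> p <= B.
Proof.
move=> /andP[r0 r1] H.
have c : (fun m => A * rho ^+ m + B) @ \oo --> 0 + B.
  apply: cvgD; last exact: cvg_cst.
  by apply: cvg_geometric; rewrite ger0_norm.
rewrite -[B]add0r -(cvg_lim _ c)//; apply: limr_ge.
  by apply/cvg_ex; exists (0 + B).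
exact: nearW.
Qed.

End Laws.

Section AR2.
Context (d : measure_display) (T : measurableType d) (R : realType).
Variable P : probability T R.
Variables (x : int -> T -> R) (F : int -> set (set T)) (f1 f2 K : R).

(** The innovation is defined as the residual, so that the recursion holds at every outcome; it
    agrees with the given noise only almost surely. *)
Definition innov (t : int) (w : T) : R := x t w - (f1 * x (t - 1) w + f2 * x (t - 2) w).

(* An AR(1) process is the case f2 = 0. The field ar_ball replaces a bound K / 2
   on the density of the innovations. *)
Record AR2 : Prop := {
  ar_adm : [/\ `|f2| < 1, f1 + f2 < 1 & f2 - f1 < 1];
  ar_meas : forall t, measurable_fun setT (x t);
  ar_sub : forall t E, <<s F t >> E -> measurable E;
  ar_past : forall s t, s < t -> past_meas (F t) (x s);
  ar_indep : forall t B E, measurable B -> <<s F t >> E ->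
    P (innov t @^-1` B `&` E) = (P (innov t @^-1` B) * P E)%E;
  ar_law : forall s t B, measurable B -> P (innov s @^-1` B) = P (innov t @^-1` B);
  ar_ball : forall t c eta, 0 <= eta ->
    (P [set w | (`|innov t w + c| <= eta)%R] <= (K * eta)%:E)%E;
  ar_amom : forall t, mom P (innov t);
  ar_L2 : forall t, int1 P (fun w => x t w ^+ 2);
  ar_mean : forall t, Ex P (x t) = 0;
  ar_cov : forall s t h, Ex P (fun w => x (s + h) w * x (t + h) w) = Ex P (fun w => x s w * x t w) }.

Hypothesis H : AR2.

Let Y (C rho : R) := fix Y (m : nat) (t : int) (w : T) : R :=
  if m is m'.+1 then rho * Y m' (t - 1) w + C * innov t w ^+ 2 else 0.

(* Only second moments of x are known a priori. Iterating the Lyapunov inequality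
   m times bounds V by rho^m V_(t-m) plus a series in the past innovations; Markov's
   inequality on the first term and m -> oo leave the tail of the series. *)
Lemma ar2_moments q : exists2 B : R, 0 <= B & forall t, int1 P (fun w => `|x t w| ^+ (2 * q)) /\
   Ex P (fun w => `|x t w| ^+ (2 * q)) <= B.
Proof.
have [h1 h2 h3] := ar_adm H.
have [V [rho [C [[/andP[r0 r1] C0 Vlow Vup VA] [c0 [c1 [c2 VE]]]]]]] := ar2_lyapunov h1 h2 h3.
pose v t w := V (x t w) (x (t - 1) w).
have v0 t w : 0 <= v t w.
  by apply: le_trans (Vlow _ _); rewrite mulr_ge0// addr_ge0 ?sqr_ge0.
have vrec t w : v t w <= rho * v (t - 1) w + C * innov t w ^+ 2.
  rewrite /v (_ : x t w = f1 * x (t - 1) w + f2 * x (t - 1 - 1) w + innov t w); first exact: VA.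
  by rewrite /innov (_ : t - 1 - 1 = t - 2)//; ring.
have mv t : measurable_fun setT (v t).
  rewrite (_ : v t = fun w => c0 * x t w ^+ 2 + c1 * (x t w * x (t - 1) w) + c2 * x (t - 1) w ^+ 2).
    have m1 := ar_meas H t; have m2 := ar_meas H (t - 1).
    by do ![apply: measurable_funD|apply: measurable_funM|apply: measurable_funX].
  by apply/funext => w; rewrite /v VE.
pose g2 := Ex P (fun w => x 0 w ^+ 2).
have Ex2 t : Ex P (fun w => x t w ^+ 2) = g2.
  by have := ar_cov H 0 0 t; rewrite add0r.
have iv t : int1 P (v t).
  apply: (@int1_le _ _ _ _ _ (fun w => C * (x t w ^+ 2 + x (t - 1) w ^+ 2))) => //.
    by apply: int1Z; apply: int1D; exact: ar_L2.
  by move=> w; rewrite ger0_norm//; exact: Vup.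
have Ev t : Ex P (v t) <= C * (g2 + g2).
  rewrite -{1}(Ex2 t) -(Ex2 (t - 1)) -ExD; [|exact: ar_L2|exact: ar_L2].
  rewrite -ExZ; last by apply: int1D; exact: ar_L2.
  apply: Ex_le => //; last by move=> w; exact: Vup.
  by apply: int1Z; apply: int1D; exact: ar_L2.
have Y0 m t w : 0 <= Y C rho m t w.
  elim: m t => [//|m IH] t /=; apply: addr_ge0; apply: mulr_ge0; rewrite ?sqr_ge0 ?IH ?ltW//.
have vY m t w : v t w <= rho ^+ m * v (t - m%:Z) w + Y C rho m t w.
  elim: m t => [|m IH] t; first by rewrite expr0 mul1r subr0 addr0.
  apply: le_trans (vrec t w) _; rewrite /= addrA lerD2r.
  apply: (@le_trans _ _ (rho * (rho ^+ m * v (t - 1 - m%:Z) w + Y C rho m (t - 1) w))).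
    by rewrite ler_wpM2l// ltW.
  rewrite mulrDr mulrA -exprS (_ : t - 1 - m%:Z = t - m.+1%:Z)//; lia.
have mY m t : mom P (Y C rho m t).
  elim: m t => [|m IH] t; first exact: mom_cst.
  by apply: momD; apply: momM; rewrite //; [exact: mom_cst|exact: mom_cst|exact/momX/ar_amom].
(* With this normalization the recursion of [Y] is the convex combination [rho * Y + (1 - rho) * b],
   so by Jensen a moment bound for [b] passes to [Y] uniformly in m. The order [q.+1] is one more
   than the moment wanted, as [dyadic_moment] requires. *)
pose b t w := C / (1 - rho) * innov t w ^+ 2.
have mb t : mom P (b t) by apply: momM; [exact: mom_cst|exact/momX/ar_amom].
pose be := Ex P (fun w => b 0 w ^+ q.+1).
have r1' : 0 < 1 - rho by rewrite subr_gt0.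
have b0 t w : 0 <= b t w.
  by rewrite /b mulr_ge0 ?sqr_ge0// divr_ge0// ltW.
have Eb t : Ex P (fun w => b t w ^+ q.+1) = be.
  have mg : measurable_fun setT (fun u : R => (C / (1 - rho) * u ^+ 2) ^+ q.+1).
    by apply: measurable_funX; apply: measurable_funM => //; exact: measurable_funX.
  apply: (same_law_Ex (mom_meas (ar_amom H t)) (mom_meas (ar_amom H 0)) _ mg).
  - by move=> B mB; exact: ar_law.
  - by apply: mom_int; apply: momX; exact: mb.
  - by apply: mom_int; apply: momX; exact: mb.
have be0 : 0 <= be by apply: Ex_ge0 => w; rewrite exprn_ge0.
have EY m t : Ex P (fun w => Y C rho m t w ^+ q.+1) <= be.
  elim: m t => [|m IH] t.
    by rewrite (@eq_Ex _ _ _ _ _ (fun=> 0)) ?Ex_cst// => w; rewrite /= expr0n.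
  apply: (@le_trans _ _ (rho * Ex P (fun w => Y C rho m (t - 1) w ^+ q.+1) + (1 - rho) * be)).
    have mY1 : mom P (fun w => Y C rho m (t - 1) w ^+ q.+1) by exact: momX.
    have mb1 : mom P (fun w => b t w ^+ q.+1) by exact: momX.
    rewrite -(Eb t) -!ExZ; [|exact: mom_int|exact: mom_int].
    rewrite -ExD; [|by apply: int1Z; exact: mom_int|by apply: int1Z; exact: mom_int].
    apply: Ex_le.
    - by apply: mom_int; apply: momX.
    - by apply: int1D; apply: int1Z; exact: mom_int.
    move=> w /=; apply: le_trans (expr_convex _ _ (Y0 _ _ _) (b0 _ _)); last first.
      by rewrite !ltW.
    by rewrite (_ : (1 - rho) * b t w = C * innov t w ^+ 2)// /b; field; rewrite gt_eqF.
  have := ler_wpM2l (ltW r0) (IH (t - 1)); lra.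
pose c := 2 ^+ q.+1 * be.
have c_ge0 : 0 <= c by rewrite mulr_ge0// exprn_ge0.
have tail t k : (P [set w | (16 ^+ k < v t w)%R] <= (c * 16^-1 ^+ (q.+1 * k))%:E)%E.
  have fin : P [set w | (16 ^+ k < v t w)%R] \is a fin_num by exact: fin_num_measure (measurable_gt _ _).
  rewrite -(fineK fin) lee_fin.
  apply: (@limit_le_geometric _ _ (2 * C * (g2 + g2) / 16 ^+ k) _ rho); first by rewrite r1 ltW.
  move=> m; rewrite -lee_fin (fineK fin).
  have k0 : 0 < 16 ^+ k :> R by rewrite exprn_gt0.
  apply: (@le_trans _ _ (P ([set w | (16 ^+ k / 2 < rho ^+ m * v (t - m%:Z)%R w)%R] `|`
       [set w | ((16 ^+ k / 2) ^+ q.+1 < Y C rho m t w ^+ q.+1)%R]))%E).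
    apply: le_measure; rewrite ?inE; first exact: measurable_gt.
      apply: measurableU; apply: measurable_gt; first by apply: measurable_funM.
      by apply: measurable_funX; exact: mom_meas.
    move=> w /= kv; have [?|h] := ltP (16 ^+ k / 2) (rho ^+ m * v (t - m%:Z) w); [by left|right].
    rewrite ltrXn2r ?nnegrE ?divr_ge0 ?(ltW k0)//.
    have := vY m t w; lra.
  apply: (le_trans (measureU2 _ _ _)).
  - by apply: measurable_gt; apply: measurable_funM.
  - by apply: measurable_gt; apply: measurable_funX; exact: mom_meas.
  rewrite EFinD; apply: leeD.
    apply: le_trans (markov_gt _ _ _) _.
    + by apply: int1Z.
    + by move=> w; rewrite mulr_ge0// exprn_ge0// ltW.
    + by rewrite divr_gt0.
    rewrite lee_fin ExZ// ler_pdivrMr ?divr_gt0//.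
    apply: le_trans (ler_wpM2l _ (Ev _)) _; first by rewrite exprn_ge0// ltW.
    rewrite le_eqVlt; apply/orP; left; apply/eqP.
    by move: (16 ^+ k) (rho ^+ m) k0 => y z y0; field; rewrite gt_eqF.
  apply: le_trans (markov_gt _ _ _) _.
  + by apply: mom_int; momt.
  + by move=> w; rewrite exprn_ge0.
  + by rewrite exprn_gt0// divr_gt0.
  rewrite lee_fin mulnC exprM /c; apply: le_trans (ler_wpM2r _ (EY m t)) _.
    by rewrite invr_ge0 exprn_ge0// divr_ge0// ltW.
  have -> : 16^-1 ^+ k = (16 ^+ k)^-1 :> R by rewrite exprVn.
  move: (16 ^+ k) => y.
  by rewrite -[((y / 2) ^+ _)^-1]exprVn invf_div exprMn mulrCA mulrA.
exists (2 ^+ q * (1 + 2 * 16 ^+ q * c)).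
  by rewrite mulr_ge0 ?exprn_ge0// addr_ge0// mulr_ge0// mulr_ge0// exprn_ge0.
move=> t; have [iq Eq] := dyadic_moment (mv t) (v0 t) c_ge0 (tail t).
have le w : `|x t w| ^+ (2 * q) <= 2 ^+ q * v t w ^+ q.
  rewrite exprM -exprMn; apply: lerXn2r; rewrite ?nnegrE ?sqr_ge0 ?mulr_ge0//.
  rewrite -normrX ger0_norm ?sqr_ge0//.
  move: (Vlow (x t w) (x (t - 1) w)) (sqr_ge0 (x (t - 1) w)); rewrite -/(v t w) => l1 l2; lra.
have ii : int1 P (fun w => `|x t w| ^+ (2 * q)).
  apply: (int1_le _ (int1Z (2 ^+ q) iq)); last by move=> w; rewrite normrX normr_id.
  by apply: measurable_funX; apply: measurableT_comp => //; exact: ar_meas.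
split => //; apply: (@le_trans _ _ (2 ^+ q * Ex P (fun w => v t w ^+ q))).
  by rewrite -ExZ//; apply: Ex_le => //; exact: int1Z.
by rewrite ler_wpM2l// exprn_ge0.
Qed.

Lemma ar2_mom t : mom P (x t).
Proof.
apply: mom_of; first exact: ar_meas.
move=> q; have [B _ /(_ t)[iq _]] := ar2_moments q.
apply: (int1_le _ (int1D (int1_cst P 1) iq)).
  by apply: measurable_funX; apply: measurableT_comp => //; exact: ar_meas.
move=> w; rewrite normrX normr_id mulnC exprM.
have : 0 <= `|x t w| ^+ q by rewrite exprn_ge0.
move: (`|x t w| ^+ q) => y y0; have := sqr_ge0 (y - 1); nra.
Qed.

End AR2.

(** * Martingale increments *)

Section Martingale.
Context (d : measure_display) (T : measurableType d) (R : realType).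
Variable P : probability T R.
Variables (x : int -> T -> R) (F : int -> set (set T)) (f1 f2 K : R).
Hypothesis H : AR2 P x F f1 f2 K.
Local Notation a := (innov x f1 f2).
Local Notation E := (Ex P).

Definition acov (k : nat) : R := Ex P (fun w => x k%:Z w * x 0 w).
Definition innov_var : R := Ex P (fun w => innov x f1 f2 0 w ^+ 2).
Local Notation v := innov_var.

Let mx t : mom P (x t) := ar2_mom H t.
Let ma t : mom P (a t) := ar_amom H t.

Lemma Ex_xx (s t : int) k : s - t = k%:Z -> E (fun w => x s w * x t w) = acov k.
Proof.
by move=> st; have := ar_cov H k%:Z 0 t; rewrite /acov -st add0r subrK.
Qed.

Lemma innov_past t Y (g : R -> R) : measurable_fun setT g -> mom P (g \o a t) ->
  past_meas (F t) Y -> mom P Y ->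
  E (fun w => g (a t w) * Y w) = E (g \o a t) * E Y.
Proof.
move=> mg mga pY mY; apply: (@innov_prod _ _ _ P (a t) (F t)) => //.
- exact: mom_meas (ma t).
- by move=> D; exact: (ar_sub H).
- by move=> B D; exact: (ar_indep H).
Qed.

Lemma Ex_innov t : E (a t) = 0.
Proof.
rewrite /innov ExB ?ExD ?ExZ ?(ar_mean H); first by rewrite !mulr0 addr0 subr0.
all: by apply: mom_int; momt.
Qed.

Lemma Ex_innov_law (g : R -> R) t : measurable_fun setT g -> (forall s, mom P (g \o a s)) ->
  E (g \o a t) = E (g \o a 0).
Proof.
move=> mg ms; apply: same_law_Ex => //.
- exact: mom_meas (ma t).
- exact: mom_meas (ma 0).
- by move=> B; exact: (ar_law H).
- exact: mom_int.
- exact: mom_int.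
Qed.

Lemma Ex_innov2 t : E (fun w => a t w ^+ 2) = v.
Proof.
apply: (@Ex_innov_law (fun u => u ^+ 2)); first exact: measurable_funX.
by move=> s; exact: momX.
Qed.

Section Increments.
Variables c0 c1 c2 c3 : R.

(** These martingale differences (centred squares of innovations, innovations times one of the two
    preceding values, innovations alone) span the linear parts of all sample autocovariances of lag
    at most 2 and of the sample mean. *)
Definition incr (t : int) (w : T) : R := c0 * (innov x f1 f2 t w ^+ 2 - innov_var) +
  innov x f1 f2 t w * (c1 * x (t - 1) w + c2 * x (t - 2) w + c3).

Definition mart (n : nat) (w : T) : R := \sum_(1 <= t < n.+1) incr t%:Z w.

Let L t w := c1 * x (t - 1) w + c2 * x (t - 2) w + c3.

Let mL t : mom P (L t). Proof. by rewrite /L; momt. Qed.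

Let pL t : past_meas (F t) (L t).
Proof.
apply: pastD; last exact: past_cst.
by apply: pastD; apply: pastM; (exact: past_cst || (apply: (ar_past H); lia)).
Qed.

Lemma mom_incr t : mom P (incr t).
Proof. by rewrite /incr; have := ma t; have := mL t; rewrite /L => m1 m2; momt. Qed.

Lemma mom_mart n : mom P (mart n).
Proof. by apply: mom_sum => i _; exact: mom_incr. Qed.

Lemma past_x s t : s < t -> past_meas (F t) (x s).
Proof. exact: (ar_past H). Qed.

Lemma past_incr s t : s < t -> past_meas (F t) (incr s).
Proof.
move=> st.
have pa : past_meas (F t) (a s).
  by apply: pastB; [|apply: pastD; apply: pastM]; (exact: past_cst || (apply: past_x; lia)).
apply: pastD; apply: pastM; first exact: past_cst.
- by apply: pastB; [exact: pastX|exact: past_cst].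
- exact: pa.
apply: pastD; last exact: past_cst.
by apply: pastD; apply: pastM; (exact: past_cst || (apply: past_x; lia)).
Qed.

Lemma past_mart n (t : int) : n%:Z < t -> past_meas (F t) (mart n).
Proof.
(* [past_sum] wants every term of the family to be measurable for the past, so the terms are cut off
   at n. *)
move=> nt; rewrite (_ : mart n = fun w => \sum_(i <- iota 1 n) (if (i <= n)%N then incr i%:Z w else 0)).
  apply: past_sum => i; case: (leqP i n) => [im|_]; last exact: past_cst.
  by apply: past_incr; lia.
apply/funext => w; rewrite /mart /index_iota subn1/=.
by apply: eq_big_seq => i; rewrite mem_iota => /andP[_ ?]; rewrite ifT//; lia.
Qed.

(** Both [a t ^+ 2 - v] and [a t] are centred and independent of the past, hence orthogonal to any
    past factor, [L t] included. *)
Lemma incr_orth t Y : past_meas (F t) Y -> mom P Y -> E (fun w => incr t w * Y w) = 0.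
Proof.
move=> pY mY.
have mg : measurable_fun setT (fun u : R => u ^+ 2 - v).
  by apply: measurable_funB => //; exact: measurable_funX.
have mg2 : mom P ((fun u : R => u ^+ 2 - v) \o a t).
  by apply: momB; [exact: momX|exact: mom_cst].
have e1 : Ex P (fun w => (a t w ^+ 2 - v) * Y w) = _ := innov_past mg mg2 pY mY.
have e2 : Ex P (fun w => a t w * (L t w * Y w)) = _ := @innov_past t (fun w => L t w * Y w) id (@measurable_id _ _ _) (ma t)
  (pastM (@pL t) pY) (momM (@mL t) mY).
rewrite (@eq_Ex _ _ _ _ _ (fun w => c0 * ((a t w ^+ 2 - v) * Y w) + a t w * (L t w * Y w))); last first.
  by move=> w; rewrite /incr /L; ring.
have m2 : mom P (fun w => (a t w ^+ 2 - v) * Y w) by apply: momM.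
have m3 : mom P (fun w => a t w * (L t w * Y w)) by apply: momM => //; exact: momM.
rewrite ExD ?ExZ; try by apply: mom_int; momt.
rewrite e1 e2.
rewrite [E (id \o a t)]Ex_innov mul0r addr0.
suff -> : E ((fun u : R => u ^+ 2 - v) \o a t) = 0 by rewrite mul0r mulr0.
rewrite /comp ExB; [|by apply: mom_int; exact: momX|exact: int1_cst].
by rewrite Ex_innov2 Ex_cst subrr.
Qed.

Lemma Ex_incr t : E (incr t) = 0.
Proof.
have := @incr_orth t (fun=> 1) (past_cst 1) (mom_cst P 1).
by under eq_Ex do rewrite mulr1.
Qed.

(** Written out to make visible that it does not depend on t; the variance of [mart n] is then
    exactly linear in n. *)
Definition incr_var : R :=
  c0 ^+ 2 * Ex P (fun w => (innov x f1 f2 0 w ^+ 2 - innov_var) ^+ 2) +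
  2 * c0 * Ex P (fun w => (innov x f1 f2 0 w ^+ 2 - innov_var) * innov x f1 f2 0 w) * c3 +
  innov_var * ((c1 ^+ 2 + c2 ^+ 2) * acov 0 + 2 * c1 * c2 * acov 1 + c3 ^+ 2).

Lemma Ex_incr2 t : E (fun w => incr t w ^+ 2) = incr_var.
Proof.
have mg0 : measurable_fun setT (fun u : R => u ^+ 2 - v).
  by apply: measurable_funB => //; exact: measurable_funX.
have mg1 : measurable_fun setT (fun u : R => (u ^+ 2 - v) * u) by exact: measurable_funM.
have mg2 : measurable_fun setT (fun u : R => (u ^+ 2 - v) ^+ 2) by exact: measurable_funX.
have mg3 : measurable_fun setT (fun u : R => u ^+ 2) by exact: measurable_funX.
have n0 s : mom P (fun w => a s w ^+ 2 - v) by apply: momB; [exact: momX|exact: mom_cst].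
have n1 s : mom P ((fun u : R => (u ^+ 2 - v) * u) \o a s) by apply: momM => //.
have n2 s : mom P ((fun u : R => (u ^+ 2 - v) ^+ 2) \o a s) by exact: momX.
have n3 s : mom P ((fun u : R => u ^+ 2) \o a s) by exact: momX.
have e1 : Ex P (fun w => (a t w ^+ 2 - v) * a t w * L t w) = _ := innov_past mg1 (n1 t) (@pL t) (@mL t).
have e2 : Ex P (fun w => a t w ^+ 2 * L t w ^+ 2) = _ := innov_past mg3 (n3 t) (pastX 2 (@pL t)) (momX 2 (@mL t)).
rewrite (@eq_Ex _ _ _ _ _ (fun w => c0 ^+ 2 * (a t w ^+ 2 - v) ^+ 2 +
   2 * c0 * (((a t w ^+ 2 - v) * a t w) * L t w) + a t w ^+ 2 * L t w ^+ 2)); last first.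
  by move=> w; rewrite /incr /L; ring.
have k1 : mom P (fun w => (a t w ^+ 2 - v) ^+ 2) by exact: n2.
have k2 : mom P (fun w => (a t w ^+ 2 - v) * a t w * L t w) by apply: momM => //; exact: n1.
have k3 : mom P (fun w => a t w ^+ 2 * L t w ^+ 2) by apply: momM; exact: momX.
rewrite ExD ?ExD ?ExZ; try by apply: mom_int; momt.
have e3 : Ex P (fun w => (a t w ^+ 2 - v) ^+ 2) = _ := Ex_innov_law t mg2 n2.
rewrite e1 e2 e3.
rewrite (Ex_innov_law t mg1 n1).
rewrite [E ((fun u : R => u ^+ 2) \o a t)]Ex_innov2.
have EL : E (L t) = c3.
  rewrite /L ExD ?ExD ?ExZ ?(ar_mean H) ?Ex_cst; try by apply: mom_int; momt.
  by rewrite !mulr0 !add0r.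
have EL2 : E (fun w => L t w ^+ 2) =
    (c1 ^+ 2 + c2 ^+ 2) * acov 0 + 2 * c1 * c2 * acov 1 + c3 ^+ 2.
  rewrite (@eq_Ex _ _ _ _ _ (fun w => c1 ^+ 2 * (x (t - 1) w * x (t - 1) w) +
     c2 ^+ 2 * (x (t - 2) w * x (t - 2) w) + 2 * c1 * c2 * (x (t - 1) w * x (t - 2) w) +
     (2 * c3) * (L t w - c3) + c3 ^+ 2)); last first.
    by move=> w; rewrite /L; ring.
  have m1 s s' : mom P (fun w => x s w * x s' w) by apply: momM.
  have m2 : mom P (fun w => L t w - c3) by apply: momB => //; exact: mom_cst.
  rewrite !ExD ?ExZ; try by apply: mom_int; momt.
  rewrite ExB; [|exact: mom_int|exact: int1_cst].
  rewrite [Ex P (L t)]EL !Ex_cst.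
  rewrite (@Ex_xx (t - 1) (t - 1) 0) ?(@Ex_xx (t - 2) (t - 2) 0) ?(@Ex_xx (t - 1) (t - 2) 1); try lia.
  by ring.
have EL2' : Ex P (fun w => L t w ^+ 2) = _ := EL2.
by rewrite EL EL2' mulrA.
Qed.

Lemma martS n w : mart n.+1 w = mart n w + incr n.+1%:Z w.
Proof. by rewrite /mart big_nat_recr. Qed.

Lemma Ex_mart n : E (mart n) = 0.
Proof.
rewrite /mart Ex_sum; last by move=> i; exact: mom_incr.
by rewrite big1// => i _; exact: Ex_incr.
Qed.

Lemma Ex_mart2 n : E (fun w => mart n w ^+ 2) = n%:R * incr_var.
Proof.
elim: n => [|n IH].
  rewrite mul0r -(Ex_cst P 0); apply: eq_Ex => w.
  by rewrite /mart big_geq// expr0n.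
have mM := mom_mart n; have mD := mom_incr n.+1.
rewrite (@eq_Ex _ _ _ _ _ (fun w => mart n w ^+ 2 + incr n.+1%:Z w ^+ 2 + 2 * (incr n.+1%:Z w * mart n w))); last first.
  by move=> w; rewrite martS; ring.
rewrite !ExD ?ExZ; try by apply: mom_int; momt.
have e1 : Ex P (fun w => incr n.+1%:Z w * mart n w) = 0.
  by apply: incr_orth => //; apply: past_mart; lia.
have e2 : Ex P (fun w => incr n.+1%:Z w ^+ 2) = _ := Ex_incr2 n.+1%:Z.
have e3 : Ex P (fun w => mart n w ^+ 2) = _ := IH.
rewrite e1 e2 e3.
by rewrite mulr0 addr0 -natr1 mulrDl mul1r.
Qed.

Lemma Ex_incr4 : exists2 c : R, 0 <= c & forall t, E (fun w => incr t w ^+ 4) <= c.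
Proof.
have [B B0 HB] := ar2_moments H 2.
have p4 (y : R) : 0 <= y ^+ 4 by rewrite exprn_even_ge0.
have mg2 : measurable_fun setT (fun u : R => (u ^+ 2 - v) ^+ 4).
  by apply: measurable_funX; apply: measurable_funB => //; exact: measurable_funX.
have mg3 : measurable_fun setT (fun u : R => u ^+ 4) by exact: measurable_funX.
have n2 s : mom P ((fun u : R => (u ^+ 2 - v) ^+ 4) \o a s).
  by apply: momX; apply: momB; [exact: momX|exact: mom_cst].
have n3 s : mom P ((fun u : R => u ^+ 4) \o a s) by exact: momX.
pose e4 := E ((fun u : R => (u ^+ 2 - v) ^+ 4) \o a 0).
pose k4 := E ((fun u : R => u ^+ 4) \o a 0).
have e40 : 0 <= e4 by apply: Ex_ge0 => w; rewrite /= exprn_even_ge0.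
have k40 : 0 <= k4 by apply: Ex_ge0 => w; rewrite /= exprn_even_ge0.
pose l4 := 64 * (c1 ^+ 4 * B + c2 ^+ 4 * B + c3 ^+ 4).
have l40 : 0 <= l4.
  by apply: mulr_ge0 => //; apply: addr_ge0 => //; apply: addr_ge0; exact: mulr_ge0.
have sum4 (y z : R) : (y + z) ^+ 4 <= 8 * (y ^+ 4 + z ^+ 4).
  have := sqr_ge0 (y ^+ 2 - z ^+ 2); have := sqr_ge0 (y - z); have := sqr_ge0 (y + z).
  have := sqr_ge0 ((y - z) * (y + z)); have := sqr_ge0 ((y - z) * (y - z)).
  nra.
have EL t : E (fun w => L t w ^+ 4) <= l4.
  have b s : E (fun w => x s w ^+ 4) <= B.
    have [_] := HB s; apply: le_trans.
    by rewrite le_eqVlt; apply/orP; left; apply/eqP; apply: eq_Ex => w; rewrite -normrX ger0_norm// exprn_even_ge0.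
  apply: (@le_trans _ _ (E (fun w => 64 * (c1 ^+ 4 * x (t - 1) w ^+ 4 + c2 ^+ 4 * x (t - 2) w ^+ 4 + c3 ^+ 4)))).
    apply: Ex_le; try by apply: mom_int; momt.
    move=> w; apply: le_trans (sum4 _ _) _.
    have := sum4 (c1 * x (t - 1) w) (c2 * x (t - 2) w); rewrite !exprMn.
    have : 0 <= c3 ^+ 4 by rewrite exprn_even_ge0.
    lra.
  rewrite ExZ ?ExD ?ExZ ?Ex_cst; try by apply: mom_int; momt.
  by rewrite /l4 ler_wpM2l// lerD2r; apply: lerD; apply: ler_wpM2l.
exists (8 * (c0 ^+ 4 * e4 + k4 * l4)).
  by apply: mulr_ge0 => //; apply: addr_ge0; exact: mulr_ge0.
move=> t; apply: (@le_trans _ _ (E (fun w => 8 * (c0 ^+ 4 * (a t w ^+ 2 - v) ^+ 4 + a t w ^+ 4 * L t w ^+ 4)))).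
  apply: Ex_le; first by apply: mom_int; apply: momX; exact: mom_incr.
    by apply: mom_int; momt.
  move=> w; apply: le_trans (sum4 _ _) _.
  by rewrite !exprMn.
have k1 : mom P (fun w => (a t w ^+ 2 - v) ^+ 4) by exact: n2.
have k3 : mom P (fun w => a t w ^+ 4 * L t w ^+ 4) by apply: momM; exact: momX.
rewrite ExZ ?ExD ?ExZ; try by apply: mom_int; momt.
have q1 : Ex P (fun w => (a t w ^+ 2 - v) ^+ 4) = e4 := Ex_innov_law t mg2 n2.
have q2 : Ex P (fun w => a t w ^+ 4 * L t w ^+ 4) = _ :=
  innov_past mg3 (n3 t) (pastX 4 (@pL t)) (momX 4 (@mL t)).
rewrite q1 q2 (Ex_innov_law t mg3 n3) -/k4.
by rewrite ler_wpM2l// lerD2l ler_wpM2l.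
Qed.

(** Induction on n: in (M + D)^4 the term M^3 D vanishes by orthogonality and the other mixed terms
    are absorbed by weighted squares. Only fourth moments of the increments enter. *)
Lemma Ex_mart4 : exists2 c : R, 0 <= c & forall n, E (fun w => mart n w ^+ 4) <= c * n%:R ^+ 2.
Proof.
have [c c_ge0 Hc] := Ex_incr4.
exists (16 * c); first by rewrite mulr_ge0.
elim=> [|n IH].
  rewrite (_ : E _ = 0); first by rewrite mulr_ge0// ?exprn_ge0// mulr_ge0.
  rewrite -(Ex_cst P 0); apply: eq_Ex => w.
  by rewrite /mart big_geq// expr0n.
have mM := mom_mart n; have mD := mom_incr n.+1.
have c4 := Hc n.+1%:Z.
have [n0|n0] := posnP n.
  rewrite n0 in IH c4 *; rewrite expr1n mulr1; apply: le_trans (_ : c <= _); last by lra.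
  apply: le_trans c4; rewrite le_eqVlt; apply/orP; left; apply/eqP; apply: eq_Ex => w.
  by rewrite /mart big_nat1.
(* This weight multiplies E M^4 by 1 + 1/n and E D^4 by 16 n + 3. From 16 c n^2 one gets 16 c n^2 +
   32 c n + 3 c, which is at most 16 c (n + 1)^2; hence the constant 16. *)
pose la : R := (4 * n%:R)^-1.
have nn : 0 < n%:R :> R by rewrite ltr0n.
have la0 : 0 < la by rewrite invr_gt0 mulr_gt0.
set M := mart n in mM IH; set D := incr n.+1%:Z in mD c4.
have orth : E (fun w => D w * M w ^+ 3) = 0.
  by apply: incr_orth; [apply: pastX; apply: past_mart; lia|exact: momX].
apply: (@le_trans _ _ (E (fun w => (1 + 4 * la) * M w ^+ 4 + 4 * (D w * M w ^+ 3) + (4 * la^-1 + 3) * D w ^+ 4))).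
  apply: Ex_le.
  - by apply: mom_int; apply: momX; exact: mom_mart.
  - by apply: mom_int; momt.
  - move=> w; rewrite martS -/(M w) -/(D w).
    have s1 := sqr_ge0 (M w * D w - D w ^+ 2).
    have s2 : 0 <= la^-1 * (la * M w ^+ 2 - D w ^+ 2) ^+ 2.
      by rewrite mulr_ge0 ?sqr_ge0// invr_ge0 ltW.
    have e : la^-1 * (la * M w ^+ 2 - D w ^+ 2) ^+ 2 =
       la * M w ^+ 4 - 2 * (M w ^+ 2 * D w ^+ 2) + la^-1 * D w ^+ 4.
      by field; rewrite gt_eqF.
    rewrite e in s2; nra.
rewrite !ExD ?ExZ; try by apply: mom_int; momt.
have orth' : Ex P (fun w => D w * M w ^+ 3) = 0 := orth.
rewrite orth' mulr0 addr0.
have h1 : (1 + 4 * la) * Ex P (fun w => M w ^+ 4) <= (1 + 4 * la) * (16 * c * n%:R ^+ 2).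
  by rewrite ler_wpM2l//; lra.
have h2 : (4 * la^-1 + 3) * Ex P (fun w => D w ^+ 4) <= (4 * la^-1 + 3) * c.
  by rewrite ler_wpM2l// addr_ge0// mulr_ge0// invr_ge0 ltW.
have e1 : la * (16 * c * n%:R ^+ 2) = 4 * c * n%:R.
  by rewrite /la; field; rewrite gt_eqF.
have e2 : la^-1 = 4 * n%:R by rewrite /la invrK.
rewrite -natr1; rewrite e2 in h2; nra.
Qed.

End Increments.
End Martingale.

(** * Second-order expansions *)

Section Jets.
Context (d : measure_display) (T : measurableType d) (R : realType).
Variables (P : probability T R) (N0 : nat) (Z : nat -> T -> R).
Hypothesis Z0 : forall n w, 0 <= Z n w.
Implicit Types X Y U V W : nat -> T -> R.

(* Z n is the size of the fluctuations, of order n^(-1/2); ev Q says that Q holds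
   once these are below some threshold. *)
Definition ev (Q : nat -> T -> Prop) := exists2 C : R, 0 < C &
  forall n w, (N0 <= n)%N -> C * Z n w <= 1 -> Q n w.

(** The bound is required only where [Z] is small, because that is where the averages are near their
    limits and can be inverted. *)
Definition bigOZ k X := exists2 C : R, 0 <= C & ev (fun n w => `|X n w| <= C * Z n w ^+ k).

Lemma ev_imp (Q Q' : nat -> T -> Prop) : (forall n w, Q n w -> Q' n w) -> ev Q -> ev Q'.
Proof. by move=> QQ' [C C0 H]; exists C => // n w n0 CZ; exact/QQ'/H. Qed.

Lemma ev_and (Q Q' : nat -> T -> Prop) : ev Q -> ev Q' -> ev (fun n w => Q n w /\ Q' n w).
Proof.
move=> [C C0 H] [C' C'0 H']; exists (C + C'); first exact: addr_gt0.
move=> n w n0; rewrite mulrDl => CZ.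
have := mulr_ge0 (ltW C0) (Z0 n w); have := mulr_ge0 (ltW C'0) (Z0 n w) => h h'.
by split; [apply: H|apply: H'] => //; lra.
Qed.

Lemma ev_small c : 0 < c -> ev (fun n w => Z n w <= c).
Proof.
move=> c0; exists c^-1; first by rewrite invr_gt0.
by move=> n w _; rewrite mulrC ler_pdivrMr// mul1r.
Qed.

Lemma bigOZ_ext k X Y : ev (fun n w => X n w = Y n w) -> bigOZ k X -> bigOZ k Y.
Proof.
move=> XY [C C0 HX]; exists C => //.
by apply: ev_imp (ev_and XY HX) => n w [<-].
Qed.

Lemma eq_bigOZ k X Y : (forall n w, X n w = Y n w) -> bigOZ k X -> bigOZ k Y.
Proof. by move=> XY; apply: bigOZ_ext; exists 1. Qed.

Lemma bigOZD k X Y : bigOZ k X -> bigOZ k Y -> bigOZ k (fun n w => X n w + Y n w).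
Proof.
move=> [C C0 HX] [C' C'0 HY]; exists (C + C'); first exact: addr_ge0.
apply: ev_imp (ev_and HX HY) => n w [h h']; rewrite mulrDl.
exact: le_trans (ler_normD _ _) (lerD h h').
Qed.

Lemma bigOZN k X : bigOZ k X -> bigOZ k (fun n w => - X n w).
Proof. by move=> [C C0 HX]; exists C => //; apply: ev_imp HX => n w; rewrite normrN. Qed.

Lemma bigOZB k X Y : bigOZ k X -> bigOZ k Y -> bigOZ k (fun n w => X n w - Y n w).
Proof. by move=> HX HY; exact: bigOZD HX (bigOZN HY). Qed.

Lemma bigOZM k l X Y : bigOZ k X -> bigOZ l Y -> bigOZ (k + l) (fun n w => X n w * Y n w).
Proof.
move=> [C C0 HX] [C' C'0 HY]; exists (C * C'); first exact: mulr_ge0.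
apply: ev_imp (ev_and HX HY) => n w [h h']; rewrite normrM exprD mulrACA.
by rewrite ler_pM.
Qed.

Lemma bigOZ_cst c : bigOZ 0 (fun _ _ => c).
Proof. by exists `|c| => //; exists 1 => // n w _ _; rewrite expr0 mulr1. Qed.

Lemma bigOZZ k c X : bigOZ k X -> bigOZ k (fun n w => c * X n w).
Proof. by move=> HX; exact: (bigOZM (bigOZ_cst c) HX). Qed.

Lemma bigOZ_weak k l X : (k <= l)%N -> bigOZ l X -> bigOZ k X.
Proof.
move=> kl [C C0 HX]; exists C => //.
apply: ev_imp (ev_and HX (ev_small ltr01)) => n w [h z1].
apply: le_trans h _; rewrite ler_wpM2l//.
by rewrite ler_wiXn2l.
Qed.

(** Unlike [bigOZ], this bound holds at every outcome: the quadratic part is integrated over the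
    whole space, including the event where the expansion fails. *)
Definition globO2 W := exists C : R, forall n w, (N0 <= n)%N -> `|W n w| <= C * Z n w ^+ 2.

Lemma globO2_bigOZ W : globO2 W -> bigOZ 2 W.
Proof.
move=> [C H]; exists `|C| => //; exists 1 => // n w n0 _.
apply: le_trans (H n w n0) _; rewrite ler_wpM2r ?exprn_ge0//; exact: ler_norm.
Qed.

Lemma globO2D W W' : globO2 W -> globO2 W' -> globO2 (fun n w => W n w + W' n w).
Proof.
move=> [C H] [C' H']; exists (C + C') => n w n0; rewrite mulrDl.
by apply: le_trans (ler_normD _ _) (lerD _ _); [exact: H|exact: H'].
Qed.

Lemma globO2Z c W : globO2 W -> globO2 (fun n w => c * W n w).
Proof.
move=> [C H]; exists (`|c| * C) => n w n0.
by rewrite normrM -mulrA ler_wpM2l// H.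
Qed.

(** The admissible linear parts, kept abstract; [inL_cov] says that their covariances are of exact
    order 1/n, which is what makes products of two of them contribute to the bias. *)
Variable inL : (nat -> T -> R) -> Prop.
Hypothesis inL0 : inL (fun _ _ => 0).
Hypothesis inLZ : forall c U, inL U -> inL (fun n w => c * U n w).
Hypothesis inLD : forall U V, inL U -> inL V -> inL (fun n w => U n w + V n w).
Hypothesis inL_le : forall U, inL U -> exists C, forall n w, (N0 <= n)%N -> `|U n w| <= C * Z n w.
Hypothesis inL_mom : forall U n, inL U -> mom P (U n).
Hypothesis inL_mean : forall U n, inL U -> Ex P (U n) = 0.
Hypothesis inL_cov : forall U V, inL U -> inL V -> exists l : R,
  n%:R * Ex P (fun w => U n w * V n w) @[n --> \oo] --> l.

Lemma inL_bigOZ U : inL U -> bigOZ 1 U.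
Proof.
move=> /inL_le[C H]; exists `|C| => //; exists 1 => // n w n0 _; rewrite expr1.
by apply: le_trans (H n w n0) _; rewrite ler_wpM2r//; exact: ler_norm.
Qed.

Lemma inL_mulO2 U V : inL U -> inL V -> globO2 (fun n w => U n w * V n w).
Proof.
move=> /inL_le[C H] /inL_le[C' H']; exists (C * C') => n w n0.
by rewrite normrM expr2 mulrACA ler_pM// ?H ?H'.
Qed.

(* X = c + U + W + O(Z^3) with U linear (and centred) and W quadratic in the
   fluctuations, so that n E(X - c) tends to lim n E(W) = l. *)
Definition jet X (c : R) U (l : R) := exists W, [/\ forall n, mom P (W n), globO2 W,
  n%:R * Ex P (W n) @[n --> \oo] --> l & bigOZ 3 (fun n w => X n w - c - U n w - W n w)].

Lemma jet_ext X Y c U l : ev (fun n w => X n w = Y n w) -> jet X c U l -> jet Y c U l.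
Proof.
move=> XY [W [mW gW lW oW]]; exists W; split => //.
by apply: bigOZ_ext oW; apply: ev_imp XY => n w ->.
Qed.

Lemma jet_O2 X c U l : jet X c U l -> bigOZ 2 (fun n w => X n w - c - U n w).
Proof.
move=> [W [_ gW _ oW]].
apply: eq_bigOZ (bigOZD (bigOZ_weak (ltnW (leqnn 3)) oW) (globO2_bigOZ gW)).
by move=> n w; rewrite subrK.
Qed.

Lemma jet_O1 X c U l : inL U -> jet X c U l -> bigOZ 1 (fun n w => X n w - c).
Proof.
move=> LU /jet_O2 h; apply: eq_bigOZ (bigOZD (bigOZ_weak (ltnW (leqnn 2)) h) (inL_bigOZ LU)).
by move=> n w; rewrite subrK.
Qed.

Lemma jet_cst c : jet (fun _ _ => c) c (fun _ _ => 0) 0.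
Proof.
exists (fun _ _ => 0); split.
- by move=> n; exact: mom_cst.
- by exists 0 => n w _; rewrite normr0 mul0r.
- rewrite (_ : (fun _ => _) = fun=> 0); first exact: cvg_cst.
  by apply/funext => n; rewrite Ex_cst mulr0.
- exists 0 => //; exists 1 => // n w _ _.
  by rewrite !subr0 subrr normr0 mul0r.
Qed.

Lemma jetD X Y c c' U U' l l' : jet X c U l -> jet Y c' U' l' ->
  jet (fun n w => X n w + Y n w) (c + c') (fun n w => U n w + U' n w) (l + l').
Proof.
move=> [W [mW gW lW oW]] [W' [mW' gW' lW' oW']].
exists (fun n w => W n w + W' n w); split.
- by move=> n; exact: momD.
- exact: globO2D.
- rewrite (_ : (fun _ => _) = (fun n => n%:R * Ex P (W n) + n%:R * Ex P (W' n))).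
    exact: cvgD.
  by apply/funext => n; rewrite ExD ?mulrDr//; exact: mom_int.
- apply: eq_bigOZ (bigOZD oW oW') => n w; ring.
Qed.

(** The product of the two linear parts is a new quadratic term, and it contributes the limit
    [L]. *)
Lemma jetM X Y c c' U U' l l' L : inL U -> inL U' ->
  n%:R * Ex P (fun w => U n w * U' n w) @[n --> \oo] --> L ->
  jet X c U l -> jet Y c' U' l' ->
  jet (fun n w => X n w * Y n w) (c * c') (fun n w => c * U' n w + c' * U n w)
    (c * l' + c' * l + L).
Proof.
move=> LU LU' cL jX jY.
have o1 := jet_O1 LU jX; have o1' := jet_O1 LU' jY.
have o2 := jet_O2 jX; have o2' := jet_O2 jY.
move: jX jY => [W [mW gW lW oW]] [W' [mW' gW' lW' oW']].
exists (fun n w => c * W' n w + c' * W n w + U n w * U' n w); split.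
- by move=> n; apply: momD; [apply: momD; exact: momZ|apply: momM; exact: inL_mom].
- by apply: globO2D; [apply: globO2D; exact: globO2Z|exact: inL_mulO2].
- rewrite (_ : (fun _ => _) = (fun n => c * (n%:R * Ex P (W' n)) + c' * (n%:R * Ex P (W n))
     + n%:R * Ex P (fun w => U n w * U' n w))).
    apply: cvgD => //; apply: cvgD; exact: cvgMl_tmp.
  apply/funext => n; have m1 : mom P (fun w => U n w * U' n w) by apply: momM; exact: inL_mom.
  rewrite !ExD ?ExZ; [by ring|..]; try by apply: mom_int; exact: momZ.
  - exact: mom_int.
  - exact: mom_int.
  - by apply: int1D; apply: int1Z; exact: mom_int.
  - exact: mom_int.
- apply: eq_bigOZ (bigOZD (bigOZD (bigOZZ c oW') (bigOZZ c' oW))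
    (bigOZD (bigOZM (inL_bigOZ LU) o2') (bigOZM o2 o1'))).
  by move=> n w; ring.
Qed.

Lemma bigOZ_inv X c : c != 0 -> bigOZ 1 (fun n w => X n w - c) ->
  ev (fun n w => X n w != 0) /\ bigOZ 0 (fun n w => (X n w)^-1).
Proof.
move=> c0 [C C0 HX].
have c2 : 0 < `|c| / 2 by rewrite divr_gt0// normr_gt0.
have e : ev (fun n w => `|c| / 2 <= `|X n w|).
  have C1 : 0 < C + 1 by lra.
  have s0 : 0 < `|c| / 2 / (C + 1) by rewrite divr_gt0.
  apply: ev_imp (ev_and HX (ev_small s0)) => n w [h z].
  have : C * Z n w <= `|c| / 2.
    apply: le_trans (_ : (C + 1) * Z n w <= _).
      by rewrite mulrDl mul1r lerDl.
    by rewrite mulrC -ler_pdivlMr.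
  rewrite expr1 in h; have := ler_normD (X n w) (c - X n w).
  rewrite [X n w + _]addrC subrK (distrC c); lra.
split; first by apply: ev_imp e => n w h; rewrite -normr_gt0; exact: lt_le_trans h.
exists (`|c| / 2)^-1; first by rewrite invr_ge0 ltW.
apply: ev_imp e => n w h; rewrite expr0 mulr1 normfV lef_pV2// posrE//.
exact: lt_le_trans h.
Qed.

Lemma jetV X c U l L : c != 0 -> inL U ->
  n%:R * Ex P (fun w => U n w * U n w) @[n --> \oo] --> L ->
  jet X c U l ->
  jet (fun n w => (X n w)^-1) c^-1 (fun n w => - c ^- 2 * U n w) (- c ^- 2 * l + c ^- 3 * L).
Proof.
move=> c0 LU cL jX.
have o1 := jet_O1 LU jX; have o2 := jet_O2 jX.
have [X0 oV] := bigOZ_inv c0 o1.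
move: jX => [W [mW gW lW oW]].
exists (fun n w => - c ^- 2 * W n w + c ^- 3 * (U n w * U n w)); split.
- by move=> n; apply: momD; apply: momZ => //; apply: momM; exact: inL_mom.
- by apply: globO2D; apply: globO2Z => //; exact: inL_mulO2.
- rewrite (_ : (fun _ => _) = (fun n => - c ^- 2 * (n%:R * Ex P (W n))
     + c ^- 3 * (n%:R * Ex P (fun w => U n w * U n w)))).
    apply: cvgD; exact: cvgMl_tmp.
  apply/funext => n; have m1 : mom P (fun w => U n w * U n w) by apply: momM; exact: inL_mom.
  by rewrite ExD ?ExZ; [ring|..]; try exact: mom_int; apply: int1Z; exact: mom_int.
(* With D = X - c the identity 1/X = 1/c - D/c^2 + D^2/c^3 - D^3/(c^3 X) is exact. D^2 is replaced
   by U^2 at the cost of (D - U) (D + U), which is of third order. *)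
- have o := bigOZD (bigOZZ (- c ^- 2) oW) (bigOZB
    (bigOZZ (c ^- 3) (bigOZM o2 (bigOZD o1 (inL_bigOZ LU))))
    (bigOZZ (c ^- 3) (bigOZM (bigOZM o1 (bigOZM o1 o1)) oV))).
  apply: bigOZ_ext o; apply: ev_imp X0 => n w x0; field.
  by rewrite x0 c0.
Qed.

(* The quadratic parts of X and Y may differ: the limit for a product or an inverse
   depends only on the constants, the linear parts and the limits l. *)
Definition samejet c X Y := exists U l, [/\ inL U, jet X c U l & jet Y c U l].

Lemma samejet_cst c : samejet c (fun _ _ => c) (fun _ _ => c).
Proof. by exists (fun _ _ => 0), 0; split; rewrite //; exact: jet_cst. Qed.

Lemma samejet_ext c X X' Y Y' : ev (fun n w => X n w = X' n w) -> ev (fun n w => Y n w = Y' n w) ->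
  samejet c X Y -> samejet c X' Y'.
Proof. by move=> eX eY [U [l [LU jX jY]]]; exists U, l; split => //; [exact: jet_ext jX|exact: jet_ext jY]. Qed.

Lemma samejetD c c' X X' Y Y' : samejet c X Y -> samejet c' X' Y' ->
  samejet (c + c') (fun n w => X n w + X' n w) (fun n w => Y n w + Y' n w).
Proof.
move=> [U [l [LU jX jY]]] [U' [l' [LU' jX' jY']]].
by exists (fun n w => U n w + U' n w), (l + l'); split; [exact: inLD|exact: jetD|exact: jetD].
Qed.

Lemma samejetM c c' X X' Y Y' : samejet c X Y -> samejet c' X' Y' ->
  samejet (c * c') (fun n w => X n w * X' n w) (fun n w => Y n w * Y' n w).
Proof.
move=> [U [l [LU jX jY]]] [U' [l' [LU' jX' jY']]]; have [L cL] := inL_cov LU LU'.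
exists (fun n w => c * U' n w + c' * U n w), (c * l' + c' * l + L).
by split; [apply: inLD; exact: inLZ|exact: jetM cL _ _|exact: jetM cL _ _].
Qed.

Lemma samejetV c X Y : c != 0 -> samejet c X Y ->
  samejet c^-1 (fun n w => (X n w)^-1) (fun n w => (Y n w)^-1).
Proof.
move=> c0 [U [l [LU jX jY]]]; have [L cL] := inL_cov LU LU.
exists (fun n w => - c ^- 2 * U n w), (- c ^- 2 * l + c ^- 3 * L).
by split; [exact: inLZ|exact: jetV cL _|exact: jetV cL _].
Qed.

Lemma samejetZ k c X Y : samejet c X Y ->
  samejet (k * c) (fun n w => k * X n w) (fun n w => k * Y n w).
Proof. by move=> h; exact: samejetM (samejet_cst k) h. Qed.

Lemma samejetB c c' X X' Y Y' : samejet c X Y -> samejet c' X' Y' ->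
  samejet (c - c') (fun n w => X n w - X' n w) (fun n w => Y n w - Y' n w).
Proof.
move=> h h'; have := samejetD h (samejetZ (-1) h'); rewrite mulN1r.
by apply: samejet_ext; exists 1 => // n w _ _; rewrite mulN1r.
Qed.

Lemma samejet_near c X Y : samejet c X Y -> c != 0 -> ev (fun n w => X n w != 0).
Proof. by move=> [U [l [LU jX _]]] c0; case: (bigOZ_inv c0 (jet_O1 LU jX)). Qed.

End Jets.

Ltac ge0 := repeat first [ assumption | by [] | by apply: ltW | exact: normr_ge0 | exact: sqr_ge0 | apply: addr_ge0 | apply: exprn_ge0 | apply: mulr_ge0 | rewrite invr_ge0 ].

(** * From a second-order expansion to the bias *)

Section BiasOfJet.
Context (d : measure_display) (T : measurableType d) (R : realType).
Variables (P : probability T R) (N0 : nat) (Z : nat -> T -> R).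
Hypothesis N0_gt0 : (0 < N0)%N.
Hypothesis Z0 : forall n w, 0 <= Z n w.
Hypothesis mZ : forall n, mom P (Z n).
Hypothesis Z4 : exists2 C : R, 0 <= C & forall n, (N0 <= n)%N ->
  Ex P (fun w => Z n w ^+ 4) <= C / n%:R ^+ 2.

Lemma Ex_le_ae (X Y : T -> R) : int1 P X -> int1 P Y -> (forall w, 0 <= X w) ->
  (forall w, 0 <= Y w) -> {ae P, forall w, X w <= Y w} -> Ex P X <= Ex P Y.
Proof.
move=> iX iY X0 Y0 XY; rewrite -lee_fin !Ex_fin//; apply: ae_ge0_le_integral => //.
- by move=> w _; rewrite lee_fin.
- exact/measurable_EFinP/(int1_meas iX).
- by move=> w _; rewrite lee_fin.
- exact/measurable_EFinP/(int1_meas iY).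
- by apply: filterS XY => w h _; rewrite lee_fin.
Qed.

Lemma cvg0_of_bound (u : nat -> R) (A : R) : 0 <= A ->
  (forall e, 0 < e -> e <= 1 -> exists B : R, forall n, (N0 <= n)%N -> `|u n| <= A * e + B / n%:R) ->
  u @ \oo --> (0 : R).
Proof.
move=> A0 H; apply/cvgrPdist_le => e e0.
pose e' := Num.min 1 (e / (2 * (A + 1))).
have A1 : 0 < 2 * (A + 1) by lra.
have e'0 : 0 < e' by rewrite lt_min ltr01 divr_gt0.
have e'1 : e' <= 1 by rewrite ge_min lexx.
have Ae : A * e' <= e / 2.
  have : e' <= e / (2 * (A + 1)) by rewrite ge_min lexx orbT.
  rewrite ler_pdivlMr// => h; nra.
have [B HB] := H e' e'0 e'1.
near=> n.
rewrite sub0r normrN; apply: le_trans (HB n _) _; first by near: n; exact: nbhs_infty_ge.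
rewrite [leRHS](splitr e) lerD//.
have n0 : 0 < n%:R :> R by rewrite ltr0n; near: n; exact: nbhs_infty_gt.
rewrite ler_pdivrMr// mulrC -ler_pdivrMr ?divr_gt0//.
near: n; exact: nbhs_infty_ger.
Unshelve. all: by end_near. Qed.

Variable inL : (nat -> T -> R) -> Prop.
Hypothesis inL_le : forall U, inL U -> exists C, forall n w, (N0 <= n)%N -> `|U n w| <= C * Z n w.
Hypothesis inL_mom : forall U n, inL U -> mom P (U n).
Hypothesis inL_mean : forall U n, inL U -> Ex P (U n) = 0.

(* The event K Z > 1 has probability O(n^-2). On it |f| is at most e n, up to
   |f|^6 / (e n)^5, so it contributes O(e) + O(1 / (e^5 n)) to n E(f - c). *)
Lemma jet_bias X c U l (f : nat -> T -> R) (K C6 : R) : inL U -> jet P N0 Z X c U l ->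
  (forall n, measurable_fun setT (f n)) -> 0 < K ->
  (forall n, (N0 <= n)%N -> {ae P, forall w, K * Z n w <= 1 -> f n w = X n w}) ->
  0 <= C6 ->
  (forall n, (N0 <= n)%N -> int1 P (fun w => `|f n w| ^+ 6) /\
     Ex P (fun w => `|f n w| ^+ 6) <= C6 * n%:R ^+ 3) ->
  (forall n, (N0 <= n)%N -> int1 P (f n)) /\
  n%:R * Ex P (fun w => f n w - c) @[n --> \oo] --> l.
Proof.
move=> LU [W [mW [CW gW] lW [CO CO0 [C C0 oW]]]] mf K0 fX C60 f6.
have [CU gU] := inL_le LU.
have [CZ CZ0 HZ] := Z4.
have ifn n : (N0 <= n)%N -> int1 P (f n).
  move=> n0; have [i6 _] := f6 n n0.
  apply: (int1_le (mf n) (int1D (int1_cst P 1) i6)) => w.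
  have [h|/ltW h] := leP `|f n w| 1.
    by apply: le_trans h _; rewrite lerDl exprn_ge0.
  by apply: (@le_trans _ _ (`|f n w| ^+ 6)); [exact: ler_eXnr|rewrite lerDr].
split => //.
pose r n w := f n w - c - U n w - W n w.
have ir n : (N0 <= n)%N -> int1 P (r n).
  move=> n0; apply: int1B; last exact: mom_int.
  apply: int1B; last exact/mom_int/inL_mom.
  by apply: int1B; [exact: ifn|exact: int1_cst].
suff r0 : n%:R * Ex P (r n) @[n --> \oo] --> (0 : R).
  have : n%:R * Ex P (r n) + n%:R * Ex P (W n) @[n --> \oo] --> 0 + l by exact: cvgD.
  rewrite add0r; apply: cvg_trans; apply: near_eq_cvg.
  near=> n.
  have n0 : (N0 <= n)%N by near: n; exact: nbhs_infty_ge.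
  rewrite -mulrDr; congr (_ * _).
  rewrite -[RHS](_ : Ex P (fun w => r n w + W n w + U n w) = _); last first.
    by apply: eq_Ex => w; rewrite /r; ring.
  rewrite ExD; [|by apply: int1D; [exact: ir|exact: mom_int]|exact/mom_int/inL_mom].
  by rewrite ExD; [rewrite (inL_mean n LU) addr0|exact: ir|exact: mom_int].
(* Where [D * Z <= 1], both the expansion of [X] and the equality of [f] with [X] are available.
   Elsewhere 1, Z and Z^2 are all at most a constant times Z^4, whose mean is O(n^-2). *)
pose D : R := C + K.
have D0 : 0 < D by rewrite addr_gt0.
pose A1 : R := `|CO| + D ^+ 4 + `|c| * D ^+ 4 + `|CU| * D ^+ 3 + `|CW| * D ^+ 2.
have A10 : 0 <= A1.
  by rewrite /A1; ge0.
apply: (@cvg0_of_bound _ (A1 * CZ)); first exact: mulr_ge0.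
move=> e e0 e1.
exists ((A1 / e + A1) * CZ + A1 / e + C6 / e ^+ 5) => n n0.
have nn : 0 < n%:R :> R by rewrite ltr0n; exact: leq_trans N0_gt0 n0.
have nz : n%:R != 0 :> R by rewrite gt_eqF.
have [i6 E6] := f6 n n0.
pose b w := (A1 * e * n%:R + A1 / e + A1) * Z n w ^+ 4 + A1 / e / n%:R ^+ 2 + (e * n%:R) ^- 5 * `|f n w| ^+ 6.
have ib : int1 P b.
  apply: int1D; last exact: int1Z.
  by apply: int1D; [apply/int1Z/mom_int/momX|exact: int1_cst].
have en0 : 0 < e * n%:R by rewrite mulr_gt0.
have b0 w : 0 <= b w.
  by rewrite /b; have := Z0 n w => z0; ge0.
have rb : {ae P, forall w, `|r n w| <= b w}.
  apply: filterS (fX n n0) => w fXw.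
  have z0 := Z0 n w.
  have z3 : 0 <= Z n w ^+ 3 by rewrite exprn_ge0.
  have z4 : 0 <= Z n w ^+ 4 by rewrite exprn_ge0.
  have t3 : 0 <= (e * n%:R) ^- 5 * `|f n w| ^+ 6.
    by ge0.
  (* Two uses of 2 p q <= p^2 + q^2, first between n Z^4 and Z^2 / n with weight e, then between Z^4
     and n^-2. They reduce the third-order error to the only known moment, that of Z^4, and after
     multiplication by n leave O(e) + O(1/n). *)
  have z34 : Z n w ^+ 3 <= (e * n%:R + e^-1) * Z n w ^+ 4 + e^-1 / n%:R ^+ 2.
    have en1 : 0 <= (e * n%:R)^-1 by rewrite invr_ge0 ltW.
    have q1 := mulr_ge0 en1 (sqr_ge0 (e * n%:R * Z n w ^+ 2 - Z n w)).
    have q2 : 0 <= n%:R^-1 * (n%:R * Z n w ^+ 2 - 1) ^+ 2.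
      by rewrite mulr_ge0 ?sqr_ge0// invr_ge0 ltW.
    have q3 := mulr_ge0 en1 q2.
    have q4 : 0 <= (e * n%:R)^-1 * Z n w ^+ 2 by rewrite mulr_ge0// sqr_ge0.
    have E1 : (e * n%:R)^-1 * (e * n%:R * Z n w ^+ 2 - Z n w) ^+ 2 =
      e * n%:R * Z n w ^+ 4 - 2 * Z n w ^+ 3 + (e * n%:R)^-1 * Z n w ^+ 2.
      by field; rewrite nz gt_eqF.
    have E2 : (e * n%:R)^-1 * (n%:R^-1 * (n%:R * Z n w ^+ 2 - 1) ^+ 2) =
      e^-1 * Z n w ^+ 4 - 2 * ((e * n%:R)^-1 * Z n w ^+ 2) + e^-1 / n%:R ^+ 2.
      by field; rewrite nz gt_eqF.
    rewrite E1 in q1; rewrite E2 in q3; rewrite mulrDl; lra.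
  have [DZ|DZ] := leP (D * Z n w) 1.
    have h1 : C * Z n w <= 1 by move: DZ; rewrite /D mulrDl; have := mulr_ge0 (ltW K0) z0; lra.
    have h2 : K * Z n w <= 1 by move: DZ; rewrite /D mulrDl; have := mulr_ge0 (ltW C0) z0; lra.
    have := oW n w n0 h1; rewrite -(fXw h2) -/(r n w) => h.
    apply: le_trans h _; apply: le_trans (_ : A1 * Z n w ^+ 3 <= _).
      by rewrite ler_wpM2r// /A1 (ger0_norm CO0) -!addrA lerDl; ge0.
    apply: le_trans (ler_wpM2l A10 z34) _.
    rewrite /b; have := mulr_ge0 A10 z4; nra.
  have d1 : 1 <= D * Z n w by exact: ltW.
  have d2 : 1 <= (D * Z n w) ^+ 2 by exact: exprn_ege1.
  have d3 : 1 <= (D * Z n w) ^+ 3 by exact: exprn_ege1.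
  have d4 : 1 <= (D * Z n w) ^+ 4 by exact: exprn_ege1.
  have fb : `|f n w| <= e * n%:R * (D ^+ 4 * Z n w ^+ 4) + (e * n%:R) ^- 5 * `|f n w| ^+ 6.
    rewrite -exprMn; have [h|/ltW h] := leP `|f n w| (e * n%:R).
      by apply: le_trans h _; rewrite -[leLHS]addr0 lerD// ler_peMr// ltW.
    rewrite -[leLHS]add0r lerD//; first by rewrite mulr_ge0 ?(ltW en0)// (le_trans _ d4).
    have e5 : 0 < (e * n%:R) ^+ 5 by rewrite exprn_gt0.
    rewrite [`|f n w| ^+ 6]exprS mulrCA ler_peMr// mulrC ler_pdivlMr// mul1r.
    by apply: lerXn2r; rewrite ?nnegrE// ltW.
  have cb : `|c| <= `|c| * D ^+ 4 * Z n w ^+ 4.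
    by rewrite -mulrA -exprMn ler_peMr.
  have Ub : `|U n w| <= `|CU| * D ^+ 3 * Z n w ^+ 4.
    apply: le_trans (gU n w n0) _; apply: le_trans (_ : `|CU| * Z n w <= _).
      by rewrite ler_wpM2r// ler_norm.
    rewrite (_ : `|CU| * D ^+ 3 * Z n w ^+ 4 = `|CU| * Z n w * (D * Z n w) ^+ 3); last by ring.
    by rewrite ler_peMr// mulr_ge0.
  have Wb : `|W n w| <= `|CW| * D ^+ 2 * Z n w ^+ 4.
    apply: le_trans (gW n w n0) _; apply: le_trans (_ : `|CW| * Z n w ^+ 2 <= _).
      by rewrite ler_wpM2r ?exprn_ge0// ler_norm.
    rewrite (_ : `|CW| * D ^+ 2 * Z n w ^+ 4 = `|CW| * Z n w ^+ 2 * (D * Z n w) ^+ 2); last by ring.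
    by rewrite ler_peMr// mulr_ge0// exprn_ge0.
  have rle : `|r n w| <= `|f n w| + `|c| + `|U n w| + `|W n w|.
    by rewrite /r; do 3!(apply: le_trans (ler_normB _ _) _; rewrite lerD2r).
  have g1 : e * n%:R * (D ^+ 4 * Z n w ^+ 4) <= A1 * e * n%:R * Z n w ^+ 4.
    rewrite (_ : A1 * e * n%:R * Z n w ^+ 4 = e * n%:R * (A1 * Z n w ^+ 4)); last by ring.
    rewrite ler_wpM2l ?(ltW en0)// ler_wpM2r// /A1 -!addrA [`|CO| + _]addrC -!addrA lerDl.
    by ge0.
  have g2 : (`|c| * D ^+ 4 + `|CU| * D ^+ 3 + `|CW| * D ^+ 2) * Z n w ^+ 4 <= A1 * Z n w ^+ 4.
    rewrite ler_wpM2r// -subr_ge0 (_ : _ - _ = `|CO| + D ^+ 4); first by ge0.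
    by rewrite /A1; ring.
  have g3 : 0 <= A1 / e * Z n w ^+ 4 by ge0.
  have g4 : 0 <= A1 / e / n%:R ^+ 2 by ge0.
  clearbody A1; rewrite /b; lra.
have Er : `|Ex P (r n)| <= Ex P b.
  apply: le_trans (Ex_norm (ir n n0)) _; apply: Ex_le_ae => //.
  exact: int1_norm (ir n n0).
rewrite normrM ger0_norm; last exact: ltW.
apply: le_trans (ler_wpM2l (ltW nn) Er) _.
have -> : Ex P b = (A1 * e * n%:R + A1 / e + A1) * Ex P (fun w => Z n w ^+ 4) + A1 / e / n%:R ^+ 2 +
   (e * n%:R) ^- 5 * Ex P (fun w => `|f n w| ^+ 6).
  rewrite /b ExD; last exact: int1Z.
    by rewrite ExD ?Ex_cst ?ExZ//; [exact/mom_int/momX|apply/int1Z/mom_int/momX|exact: int1_cst].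
  by apply: int1D; [apply/int1Z/mom_int/momX|exact: int1_cst].
have b1 : 0 <= A1 * e * n%:R + A1 / e + A1.
  by ge0.
have h1 := ler_wpM2l b1 (HZ n n0).
have b2 : 0 <= (e * n%:R) ^- 5 by ge0.
have h2 := ler_wpM2l b2 E6.
apply: le_trans (_ : n%:R * ((A1 * e * n%:R + A1 / e + A1) * (CZ / n%:R ^+ 2) + A1 / e / n%:R ^+ 2 +
   (e * n%:R) ^- 5 * (C6 * n%:R ^+ 3)) <= _).
  by rewrite ler_wpM2l ?(ltW nn)//; lra.
rewrite le_eqVlt; apply/orP; left; apply/eqP; field.
by rewrite nz gt_eqF.
Unshelve. all: by end_near. Qed.

End BiasOfJet.

(** * Sample autocovariances *)

Section Sums.
Context (d : measure_display) (T : measurableType d) (R : realType).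
Variable P : probability T R.
Variables (x : int -> T -> R) (F : int -> set (set T)) (f1 f2 K : R).
Hypothesis H : AR2 P x F f1 f2 K.
Local Notation a := (innov x f1 f2).
Local Notation E := (Ex P).
Local Notation v := (innov_var P x f1 f2).
Local Notation g := (acov P x).
Local Notation M := (mart P x f1 f2).

Let mx t : mom P (x t) := ar2_mom H t.
Let ma t : mom P (a t) := ar_amom H t.

Lemma innov_orth t Y : past_meas (F t) Y -> mom P Y -> E (fun w => a t w * Y w) = 0.
Proof.
move=> pY mY; have := incr_orth H 0 0 0 1 pY mY.
by under eq_Ex do rewrite /incr !mul0r !add0r mulr1.
Qed.

Lemma innovE t w : x t w = f1 * x (t - 1) w + f2 * x (t - 2) w + a t w.
Proof. by rewrite /innov; ring. Qed.

(** A variable whose law charges the ball of radius eta by at most K eta <= 1/2 cannot be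
    concentrated at 0: Chebyshev's inequality then bounds the variance below by eta^2 / 2. *)
Lemma innov_var_gt0 : 0 < v.
Proof.
pose eta : R := (2 * (`|K| + 1))^-1.
have K1 : 0 < 2 * (`|K| + 1) by rewrite mulr_gt0// ltr_wpDl.
have eta0 : 0 < eta by rewrite invr_gt0.
have Keta : K * eta <= 1 / 2.
  rewrite ler_pdivrMr//; have := ler_norm K; have := normr_ge0 K; lra.
have m2 : mom P (fun w => a 0 w ^+ 2) by exact: momX.
have mab : measurable_fun setT (fun w => `|a 0 w + 0|).
  by apply: measurableT_comp => //; apply: measurable_funD => //; exact: mom_meas.
have : (1 <= (K * eta)%:E + (v / eta ^+ 2)%:E)%E.
  rewrite -(probability_setT P).
  apply: le_trans (_ : (_ <= P ([set w | (`|a 0 w + 0| <= eta)%R] `|` [set w | (eta ^+ 2 < a 0 w ^+ 2)%R]))%E) _.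
    apply: le_measure; rewrite ?inE//.
      by apply: measurableU; [exact: measurable_le|apply: measurable_gt; exact: (mom_meas m2)].
    move=> w _ /=; have [h|h] := leP `|a 0 w| eta; [left|right].
      by rewrite addr0.
    by rewrite -[a 0 w ^+ 2]ger0_norm ?sqr_ge0// normrX ltrXn2r ?nnegrE// ltW.
  apply: le_trans (measureU2 _ _ _) _; [exact: measurable_le|by apply: measurable_gt; exact: (mom_meas m2)|].
  apply: leeD; first by apply: (ar_ball H); exact: ltW.
  apply: markov_gt; [exact: mom_int|by move=> w; exact: sqr_ge0|by rewrite exprn_gt0].
rewrite -EFinD lee_fin => h.
have : 1 / 2 <= v / eta ^+ 2 by lra.
by rewrite ler_pdivlMr ?exprn_gt0//; apply: lt_le_trans; rewrite mulr_gt0// exprn_gt0.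
Qed.

Lemma yule_walker1 : g 1 = f1 * g 0 + f2 * g 1.
Proof.
rewrite -[LHS](Ex_xx H (s := 0) (t := 0 - 1))//.
rewrite (@eq_Ex _ _ _ _ _ (fun w => f1 * (x (0 - 1) w * x (0 - 1) w) + f2 * (x (0 - 1) w * x (0 - 2) w)
  + a 0 w * x (0 - 1) w)); last by move=> w; rewrite [x 0 w]innovE; ring.
have mxx s t : mom P (fun w => x s w * x t w) by exact: momM.
have max t : mom P (fun w => a 0 w * x t w) by exact: momM.
rewrite !ExD ?ExZ; try by apply: mom_int; momt.
rewrite innov_orth ?addr0//; last by apply: (past_x H); lia.
rewrite (Ex_xx H (s := 0 - 1) (t := 0 - 1) (k := 0))// (Ex_xx H (s := 0 - 1) (t := 0 - 2) (k := 1))//.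
Qed.

Lemma yule_walker2 : g 2 = f1 * g 1 + f2 * g 0.
Proof.
rewrite -[LHS](Ex_xx H (s := 0) (t := 0 - 2))//.
rewrite (@eq_Ex _ _ _ _ _ (fun w => f1 * (x (0 - 1) w * x (0 - 2) w) + f2 * (x (0 - 2) w * x (0 - 2) w)
  + a 0 w * x (0 - 2) w)); last by move=> w; rewrite [x 0 w]innovE; ring.
have mxx s t : mom P (fun w => x s w * x t w) by exact: momM.
have max t : mom P (fun w => a 0 w * x t w) by exact: momM.
rewrite !ExD ?ExZ; try by apply: mom_int; momt.
rewrite innov_orth ?addr0//; last by apply: (past_x H); lia.
rewrite (Ex_xx H (s := 0 - 2) (t := 0 - 2) (k := 0))// (Ex_xx H (s := 0 - 1) (t := 0 - 2) (k := 1))//.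
Qed.

Lemma yule_walker0 : g 0 = f1 ^+ 2 * g 0 + f2 ^+ 2 * g 0 + 2 * f1 * f2 * g 1 + v.
Proof.
rewrite -[LHS](Ex_xx H (s := 0) (t := 0))//.
rewrite (@eq_Ex _ _ _ _ _ (fun w => f1 ^+ 2 * (x (0 - 1) w * x (0 - 1) w) +
  f2 ^+ 2 * (x (0 - 2) w * x (0 - 2) w) + 2 * f1 * f2 * (x (0 - 1) w * x (0 - 2) w)
  + 2 * f1 * (a 0 w * x (0 - 1) w) + 2 * f2 * (a 0 w * x (0 - 2) w) + a 0 w ^+ 2)); last first.
  by move=> w; rewrite [x 0 w]innovE; ring.
have mxx s t : mom P (fun w => x s w * x t w) by exact: momM.
have max t : mom P (fun w => a 0 w * x t w) by exact: momM.
rewrite !ExD ?ExZ; try by apply: mom_int; momt.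
have e1 : E (fun w => a 0 w * x (0 - 1) w) = 0 by apply: innov_orth => //; apply: (past_x H); lia.
have e2 : E (fun w => a 0 w * x (0 - 2) w) = 0 by apply: innov_orth => //; apply: (past_x H); lia.
rewrite e1 e2 !mulr0 !addr0 (Ex_innov2 H).
rewrite (Ex_xx H (s := 0 - 2) (t := 0 - 2) (k := 0))// (Ex_xx H (s := 0 - 1) (t := 0 - 1) (k := 0))// (Ex_xx H (s := 0 - 1) (t := 0 - 2) (k := 1))//.
Qed.

(** The Yule-Walker equations give g 1 = f1 / (1 - f2) g 0 and D g 0 = (1 - f2) v, with D the
    determinant of [ar2_det_gt0]; admissibility makes the ratio f1 / (1 - f2) less than 1 in
    absolute value. *)
Lemma acov0_gt0 : 0 < g 0 /\ 0 < g 0 ^+ 2 - g 1 ^+ 2.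
Proof.
have [h1 h2 h3] := ar_adm H.
have D0 := ar2_det_gt0 h1 h2 h3.
have v0 := innov_var_gt0; have y0 := yule_walker0; have y1 := yule_walker1.
have e0 : 0 < 1 - f2 by move: h1; rewrite ltr_norml => /andP[_ ?]; lra.
have E1 : g 1 = f1 / (1 - f2) * g 0.
  by apply: (mulfI (lt0r_neq0 e0)); rewrite mulrA mulrCA divff ?gt_eqF// mulr1; lra.
have E0 : ((1 - f2) * (1 - f1 ^+ 2 - f2 ^+ 2) - 2 * f1 ^+ 2 * f2) * g 0 = (1 - f2) * v.
  have : (1 - f2) * (g 0 - (f1 ^+ 2 * g 0 + f2 ^+ 2 * g 0 + 2 * f1 * f2 * g 1 + v)) = 0.
    by rewrite -y0 subrr mulr0.
  rewrite E1 => e; have : 1 - f2 != 0 by rewrite gt_eqF.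
  move=> e1; apply/eqP; rewrite -subr_eq0 -e; apply/eqP; field; exact: e1.
have g0 : 0 < g 0 by rewrite -(pmulr_rgt0 _ D0) E0 mulr_gt0.
split => //; rewrite E1 exprMn expr_div_n.
rewrite -[X in X - _]mul1r -mulrBl mulr_gt0 ?exprn_gt0// subr_gt0.
by rewrite ltr_pdivrMr ?exprn_gt0// mul1r -subr_gt0 subr_sqr mulr_gt0//; lra.
Qed.

Lemma mart_lin c0 c1 c2 c3 n w : M c0 c1 c2 c3 n w =
  c0 * M 1 0 0 0 n w + c1 * M 0 1 0 0 n w + c2 * M 0 0 1 0 n w + c3 * M 0 0 0 1 n w.
Proof.
rewrite /mart !mulr_sumr -!big_split/=; apply: eq_bigr => t _.
by rewrite /incr; ring.
Qed.

Lemma sum_shift (f : int -> R) n :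
  \sum_(1 <= t < n.+1) f (t%:Z - 1) = \sum_(1 <= t < n.+1) f t%:Z - f n%:Z + f 0.
Proof.
elim: n => [|n IH]; first by rewrite !big_geq// sub0r addNr.
rewrite big_nat_recr// [in RHS]big_nat_recr// IH (_ : n.+1%:Z - 1 = n%:Z); last by lia.
by rewrite /=; ring.
Qed.

(** Every lag is summed over all 1 <= t <= n, at the price of the values at times 0 and -1, which
    exist because the process is indexed by the integers. All ranges used by the estimators are
    compared with this one. *)
Definition xsum k n w := \sum_(1 <= t < n.+1) x t%:Z w * x (t%:Z - k%:Z) w.

(** Dominates every boundary value, at times -2, ..., 3 and n - 5, ..., n. The summand 1 lets
    constants and single values be bounded by [edge ^+ 2] as well. *)
Definition edge n w := 1 + \sum_(i < 6) (`|x (i%:Z - 2) w| + `|x (n%:Z - i%:Z) w|).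

Lemma edge_ge1 n w : 1 <= edge n w.
Proof. by rewrite lerDl sumr_ge0// => i _; rewrite addr_ge0. Qed.

Lemma edge_start n w (t : int) : -2 <= t -> t <= 3 -> `|x t w| <= edge n w.
Proof.
move=> t0 t1; have hi : (absz (t + 2)%R < 6)%N by lia.
rewrite /edge (bigD1 (Ordinal hi))//=.
rewrite (_ : (absz (t + 2)%R)%:Z - 2 = t); last by lia.
set S := \sum_(_ | _) _; have S0 : 0 <= S by apply: sumr_ge0 => i _; exact: addr_ge0.
set y := `|x (n%:Z - _) w|; have y0 : 0 <= y by exact: normr_ge0.
lra.
Qed.

Lemma edge_end n w (t : int) : n%:Z - 5 <= t -> t <= n%:Z -> `|x t w| <= edge n w.
Proof.
move=> t0 t1; have hi : (absz (n%:Z - t)%R < 6)%N by lia.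
rewrite /edge (bigD1 (Ordinal hi))//=.
rewrite (_ : n%:Z - (absz (n%:Z - t)%R)%:Z = t); last by lia.
set S := \sum_(_ | _) _; have S0 : 0 <= S by apply: sumr_ge0 => i _; exact: addr_ge0.
set y := `|x (_ - 2) w|; have y0 : 0 <= y by exact: normr_ge0.
lra.
Qed.

Definition edgeO (u : nat -> T -> R) := exists C : R, forall n w, `|u n w| <= C * edge n w ^+ 2.

Lemma edgeOD u u' : edgeO u -> edgeO u' -> edgeO (fun n w => u n w + u' n w).
Proof.
move=> [C HC] [C' HC']; exists (C + C') => n w; rewrite mulrDl.
exact: le_trans (ler_normD _ _) (lerD (HC n w) (HC' n w)).
Qed.

Lemma edgeOZ c u : edgeO u -> edgeO (fun n w => c * u n w).
Proof.
by move=> [C HC]; exists (`|c| * C) => n w; rewrite normrM -mulrA ler_wpM2l.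
Qed.

Lemma edgeOB u u' : edgeO u -> edgeO u' -> edgeO (fun n w => u n w - u' n w).
Proof.
move=> hu /(edgeOZ (-1)) hu'; have [C HC] := edgeOD hu hu'.
by exists C => n w; rewrite -[u' n w]mul1r -mulNr.
Qed.

Lemma eq_edgeO u u' : (forall n w, u n w = u' n w) -> edgeO u -> edgeO u'.
Proof. by move=> uu' [C HC]; exists C => n w; rewrite -uu'. Qed.

Lemma edgeO_cst c : edgeO (fun _ _ => c).
Proof.
exists `|c| => n w; rewrite ler_peMr// -[leLHS](expr1n _ 2).
by apply: lerXn2r; rewrite ?nnegrE// ?(le_trans ler01)//; exact: edge_ge1.
Qed.

Definition is_edge (p : nat -> int) := forall n w, `|x (p n) w| <= edge n w.

Lemma edgeO_xx p q : is_edge p -> is_edge q -> edgeO (fun n w => x (p n) w * x (q n) w).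
Proof.
by move=> hp hq; exists 1 => n w; rewrite mul1r normrM expr2 ler_pM.
Qed.

Lemma edgeO_xsq p : is_edge p -> edgeO (fun n w => x (p n) w ^+ 2).
Proof. by move=> hp; apply: eq_edgeO (edgeO_xx hp hp) => n w; rewrite expr2. Qed.

Lemma is_edge_start (t : int) : -2 <= t -> t <= 3 -> is_edge (fun=> t).
Proof. by move=> ? ? n w; exact: edge_start. Qed.

Lemma is_edge_end (k : nat) : (k <= 5)%N -> is_edge (fun n => n%:Z - k%:Z).
Proof. by move=> ? n w; apply: edge_end; lia. Qed.

Lemma is_edge_last : is_edge (fun n => n%:Z).
Proof. by move=> n w; apply: edge_end; lia. Qed.

(** Multiplying the recursion by x (t-1), by x (t-2) and by itself and summing over t gives the
    Yule-Walker equations for [xsum], with martingales and boundary terms [r0], [r1], [r2] added.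
    The system has determinant [D * n]-free coefficients, so it is solved as for the true
    autocovariances, and [b0], ..., [d2] are the resulting coefficients of the martingales. *)
Lemma xsum_lin k : (k <= 2)%N -> exists c0 c1 c2 : R,
  edgeO (fun n w => xsum k n w - n%:R * g k - M c0 c1 c2 0 n w).
Proof.
have [h1 h2 h3] := ar_adm H.
have D0 := ar2_det_gt0 h1 h2 h3.
set D := _ - _ in D0.
have Dn : D != 0 by rewrite gt_eqF.
have e0 : 1 - f2 != 0 by rewrite gt_eqF//; move: h1; rewrite ltr_norml => /andP[_ ?]; lra.
pose b0 := (1 - f2) / D.
pose b1 := ((1 - f2) * 2 * f1 + 2 * f1 * f2) / D.
pose b2 := (1 - f2) * 2 * f2 / D.
pose d0 := f1 * b0 / (1 - f2). pose d1 := (f1 * b1 + 1) / (1 - f2). pose d2 := f1 * b2 / (1 - f2).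
pose r1 n w := f1 * (x 0 w ^+ 2 - x n%:Z w ^+ 2) + f2 * (x 0 w * x (-1) w - x n%:Z w * x (n%:Z - 1) w).
pose r0 n w := f1 ^+ 2 * (x 0 w ^+ 2 - x n%:Z w ^+ 2)
  + f2 ^+ 2 * (x 0 w ^+ 2 + x (-1) w ^+ 2 - x n%:Z w ^+ 2 - x (n%:Z - 1) w ^+ 2)
  + 2 * f1 * f2 * (x 0 w * x (-1) w - x n%:Z w * x (n%:Z - 1) w).
pose r2 n w := f1 * (x 0 w * x (-1) w - x n%:Z w * x (n%:Z - 1) w)
  + f2 * (x 0 w ^+ 2 + x (-1) w ^+ 2 - x n%:Z w ^+ 2 - x (n%:Z - 1) w ^+ 2).
have s11 n w : \sum_(1 <= t < n.+1) x (t%:Z - 1) w ^+ 2 = xsum 0 n w - x n%:Z w ^+ 2 + x 0 w ^+ 2.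
  rewrite (sum_shift (fun t => x t w ^+ 2)); congr (_ - _ + _).
  by apply: eq_bigr => t _; rewrite subr0 expr2.
have s22 n w : \sum_(1 <= t < n.+1) x (t%:Z - 2) w ^+ 2 =
    xsum 0 n w - x n%:Z w ^+ 2 + x 0 w ^+ 2 - x (n%:Z - 1) w ^+ 2 + x (-1) w ^+ 2.
  rewrite -s11 -[x (-1) w]/(x (0 - 1) w) -(sum_shift (fun t => x (t - 1) w ^+ 2)).
  by apply: eq_bigr => t _; congr (x _ w ^+ 2); lia.
have s12 n w : \sum_(1 <= t < n.+1) x (t%:Z - 1) w * x (t%:Z - 2) w =
    xsum 1 n w - x n%:Z w * x (n%:Z - 1) w + x 0 w * x (-1) w.
  rewrite -[x (-1) w]/(x (0 - 1) w) -(sum_shift (fun t => x t w * x (t - 1) w)).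
  by apply: eq_bigr => t _; congr (_ * x _ w); lia.
have M1E n w : M 0 1 0 0 n w = \sum_(1 <= t < n.+1) a t%:Z w * x (t%:Z - 1) w.
  by apply: eq_bigr => t _; rewrite /incr; ring.
have M2E n w : M 0 0 1 0 n w = \sum_(1 <= t < n.+1) a t%:Z w * x (t%:Z - 2) w.
  by apply: eq_bigr => t _; rewrite /incr; ring.
have M0E n w : M 1 0 0 0 n w = \sum_(1 <= t < n.+1) a t%:Z w ^+ 2 - n%:R * v.
  elim: n => [|n IH]; first by rewrite /mart !big_geq// mul0r subr0.
  by rewrite martS IH [in RHS]big_nat_recr// -[n.+1%:R]natr1 /incr /=; ring.
have S1 n w : (1 - f2) * xsum 1 n w = f1 * xsum 0 n w + M 0 1 0 0 n w + r1 n w.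
  have : xsum 1 n w = f1 * \sum_(1 <= t < n.+1) x (t%:Z - 1) w ^+ 2 +
      f2 * \sum_(1 <= t < n.+1) x (t%:Z - 1) w * x (t%:Z - 2) w + M 0 1 0 0 n w.
    rewrite M1E !mulr_sumr -!big_split/=; apply: eq_bigr => t _.
    by rewrite [X in X * _]innovE; ring.
  by rewrite s11 s12 /r1 => e; lra.
have S2 n w : xsum 2 n w = f1 * xsum 1 n w + f2 * xsum 0 n w + M 0 0 1 0 n w + r2 n w.
  have : xsum 2 n w = f1 * \sum_(1 <= t < n.+1) x (t%:Z - 1) w * x (t%:Z - 2) w +
      f2 * \sum_(1 <= t < n.+1) x (t%:Z - 2) w ^+ 2 + M 0 0 1 0 n w.
    rewrite M2E !mulr_sumr -!big_split/=; apply: eq_bigr => t _.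
    by rewrite [X in X * _]innovE; ring.
  by rewrite s22 s12 /r2 => e; lra.
have S0 n w : xsum 0 n w = (f1 ^+ 2 + f2 ^+ 2) * xsum 0 n w + 2 * f1 * f2 * xsum 1 n w +
    2 * f1 * M 0 1 0 0 n w + 2 * f2 * M 0 0 1 0 n w + M 1 0 0 0 n w + n%:R * v + r0 n w.
  have : xsum 0 n w = f1 ^+ 2 * \sum_(1 <= t < n.+1) x (t%:Z - 1) w ^+ 2 +
      f2 ^+ 2 * \sum_(1 <= t < n.+1) x (t%:Z - 2) w ^+ 2 +
      2 * f1 * f2 * \sum_(1 <= t < n.+1) x (t%:Z - 1) w * x (t%:Z - 2) w +
      2 * f1 * M 0 1 0 0 n w + 2 * f2 * M 0 0 1 0 n w + \sum_(1 <= t < n.+1) a t%:Z w ^+ 2.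
    rewrite M1E M2E !mulr_sumr -!big_split/=; apply: eq_bigr => t _.
    by rewrite subr0 [x t%:Z w]innovE; ring.
  by rewrite M0E s11 s22 s12 /r0 => e; lra.
have y0 := yule_walker0; have y1 := yule_walker1; have y2 := yule_walker2.
have sE0 n w : xsum 0 n w = ((1 - f2) * (2 * f1 * M 0 1 0 0 n w + 2 * f2 * M 0 0 1 0 n w +
    M 1 0 0 0 n w + n%:R * v + r0 n w) + 2 * f1 * f2 * (M 0 1 0 0 n w + r1 n w)) / D.
  apply: (canRL (mulfK Dn)); have := S0 n w; have := S1 n w; rewrite /D => q1 q0.
  have : (1 - f2) * (xsum 0 n w - ((f1 ^+ 2 + f2 ^+ 2) * xsum 0 n w + 2 * f1 * f2 * xsum 1 n w +
    2 * f1 * M 0 1 0 0 n w + 2 * f2 * M 0 0 1 0 n w + M 1 0 0 0 n w + n%:R * v + r0 n w)) = 0.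
    by rewrite -q0 subrr mulr0.
  have : 2 * f1 * f2 * ((1 - f2) * xsum 1 n w - (f1 * xsum 0 n w + M 0 1 0 0 n w + r1 n w)) = 0.
    by rewrite -q1 subrr mulr0.
  move: (xsum 0 n w) (xsum 1 n w) (M 0 1 0 0 n w) (M 0 0 1 0 n w) (M 1 0 0 0 n w) (r0 n w) (r1 n w).
  by move=> ? ? ? ? ? ? ? ? ?; lra.
have sE1 n w : xsum 1 n w = (f1 * xsum 0 n w + M 0 1 0 0 n w + r1 n w) / (1 - f2).
  by apply: (canRL (mulfK e0)); rewrite mulrC S1.
have gE1 : g 1 = f1 * g 0 / (1 - f2).
  by apply: (canRL (mulfK e0)); lra.
have gE0 : g 0 = (1 - f2) * v / D.
  apply: (canRL (mulfK Dn)); rewrite /D.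
  have : (1 - f2) * (g 0 - (f1 ^+ 2 * g 0 + f2 ^+ 2 * g 0 + 2 * f1 * f2 * g 1 + v)) = 0.
    by rewrite -y0 subrr mulr0.
  have : 2 * f1 * f2 * (g 1 - (f1 * g 0 + f2 * g 1)) = 0 by rewrite -y1 subrr mulr0.
  lra.
have o x1 x2 y1' y2' : is_edge x1 -> is_edge x2 -> is_edge y1' -> is_edge y2' ->
    edgeO (fun n w => x (x1 n) w * x (x2 n) w - x (y1' n) w * x (y2' n) w).
  by move=> *; apply: edgeOB; exact: edgeO_xx.
have i0 := @is_edge_start 0 isT isT. have i1 := @is_edge_start (-1) isT isT.
have in0 := is_edge_last. have in1 := @is_edge_end 1 isT.
have or1 : edgeO r1.
  by apply: edgeOD; apply: edgeOZ; [apply: edgeOB; exact: edgeO_xsq|exact: o].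
have or0 : edgeO r0.
  apply: edgeOD; [apply: edgeOD|]; apply: edgeOZ; [| |exact: o].
    by apply: edgeOB; exact: edgeO_xsq.
  by do 2![apply: edgeOB; last exact: edgeO_xsq]; apply: edgeOD; exact: edgeO_xsq.
have or2 : edgeO r2.
  apply: edgeOD; apply: edgeOZ; first exact: o.
  by do 2![apply: edgeOB; last exact: edgeO_xsq]; apply: edgeOD; exact: edgeO_xsq.
have oT0 : edgeO (fun n w => xsum 0 n w - n%:R * g 0 - M b0 b1 b2 0 n w).
  apply: eq_edgeO (edgeOD (edgeOZ ((1 - f2) / D) or0) (edgeOZ (2 * f1 * f2 / D) or1)) => n w.
  rewrite sE0 gE0 (mart_lin b0) /b0 /b1 /b2 -/D; clearbody D; field; exact: Dn.
have oT1 : edgeO (fun n w => xsum 1 n w - n%:R * g 1 - M d0 d1 d2 0 n w).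
  apply: eq_edgeO (edgeOD (edgeOZ (f1 / (1 - f2)) oT0) (edgeOZ (1 - f2)^-1 or1)) => n w.
  rewrite sE1 gE1 (mart_lin b0) (mart_lin d0) /d0 /d1 /d2.
  by clearbody b0 b1 b2; field.
case: k => [|[|[|//]]] _.
- by exists b0, b1, b2.
- by exists d0, d1, d2.
exists (f1 * d0 + f2 * b0), (f1 * d1 + f2 * b1), (f1 * d2 + f2 * b2 + 1).
apply: eq_edgeO (edgeOD (edgeOD (edgeOZ f1 oT1) (edgeOZ f2 oT0)) or2) => n w.
rewrite S2 y2 (mart_lin b0) (mart_lin d0) (mart_lin (f1 * d0 + f2 * b0)).
ring.
Qed.

End Sums.

(** * The scale of the fluctuations *)

Section Scale.
Context (d : measure_display) (T : measurableType d) (R : realType).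
Variable P : probability T R.
Variables (x : int -> T -> R) (F : int -> set (set T)) (f1 f2 K : R).
Hypothesis H : AR2 P x F f1 f2 K.
Local Notation a := (innov x f1 f2).
Local Notation E := (Ex P).
Local Notation v := (innov_var P x f1 f2).
Local Notation g := (acov P x).
Local Notation M := (mart P x f1 f2).
Local Notation edge := (edge x).

Let mx t : mom P (x t) := ar2_mom H t.

(** A single variable for all errors: it dominates every martingale average, and its square
    dominates [edge ^+ 2 / n], while its fourth moment is still O(n^-2). *)
Definition zscale (n : nat) (w : T) : R :=
  n%:R^-1 * (`|M 1 0 0 0 n w| + `|M 0 1 0 0 n w| + `|M 0 0 1 0 n w| + `|M 0 0 0 1 n w|)
  + edge n w / Num.sqrt n%:R.
Local Notation Z := zscale.

Definition lin_mart (U : nat -> T -> R) := exists c0 c1 c2 c3 : R,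
  forall n w, U n w = n%:R^-1 * M c0 c1 c2 c3 n w.

Lemma zscale_ge0 n w : 0 <= Z n w.
Proof.
have e := edge_ge1 x n w; have e0 : 0 <= edge n w by lra.
have s0 := sqrtr_ge0 (n%:R : R); have n0 : 0 <= n%:R :> R by [].
rewrite /Z; ge0.
Qed.

Lemma mom_edge n : mom P (edge n).
Proof. by apply: momD; [exact: mom_cst|apply: mom_sum => i _; apply: momD; exact: mom_norm]. Qed.

Lemma mom_zscale n : mom P (Z n).
Proof.
apply: momD.
  apply: momZ; do 3?apply: momD; apply: mom_norm; exact: (mom_mart H).
by apply: momM; [exact: mom_edge|exact: mom_cst].
Qed.

Lemma sum4 (y z : R) : (y + z) ^+ 4 <= 8 * (y ^+ 4 + z ^+ 4).
Proof.
have := sqr_ge0 (y ^+ 2 - z ^+ 2); have := sqr_ge0 (y - z); have := sqr_ge0 (y + z).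
have := sqr_ge0 ((y - z) * (y + z)); have := sqr_ge0 ((y - z) * (y - z)).
nra.
Qed.

Lemma Ex4_sum (I : Type) (s : seq I) (u : I -> nat -> T -> R) (C : I -> R) (D : nat -> R) :
  (forall i n, mom P (u i n)) -> (forall i n, E (fun w => u i n w ^+ 4) <= C i * D n) ->
  exists C', forall n, E (fun w => (\sum_(i <- s) u i n w) ^+ 4) <= C' * D n.
Proof.
move=> mu uC; elim: s => [|i s [C' IH]].
  exists 0 => n; rewrite mul0r (@eq_Ex _ _ _ _ _ (fun=> 0)) ?Ex_cst// => w.
  by rewrite big_nil expr0n.
exists (8 * (C i + C')) => n.
have ms : mom P (fun w => \sum_(i <- s) u i n w) by apply: mom_sum => j _; exact: mu.
apply: (@le_trans _ _ (E (fun w => 8 * (u i n w ^+ 4 + (\sum_(i <- s) u i n w) ^+ 4)))).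
  apply: Ex_le.
  - by apply: mom_int; apply: momX; apply: mom_sum => j _; exact: mu.
  - by apply: mom_int; apply: momZ; apply: momD; apply: momX.
  - by move=> w; rewrite big_cons; exact: sum4.
have m1 := mom_int (momX 4 (mu i n)); have m2 := mom_int (momX 4 ms).
rewrite ExZ ?ExD//; last exact: int1D.
by rewrite -mulrA ler_wpM2l// mulrDl lerD.
Qed.

Lemma zscale4 : exists2 C : R, 0 <= C & forall n, (8 <= n)%N -> E (fun w => Z n w ^+ 4) <= C / n%:R ^+ 2.
Proof.
pose cs : seq (R * R * R * R) := [:: (1, 0, 0, 0); (0, 1, 0, 0); (0, 0, 1, 0); (0, 0, 0, 1)].
have mM c n : mom P (fun w => `|M c.1.1.1 c.1.1.2 c.1.2 c.2 n w|).
  by apply: mom_norm; exact: (mom_mart H).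
have [CM HM] : exists C, forall n, E (fun w => (\sum_(c <- cs) `|M c.1.1.1 c.1.1.2 c.1.2 c.2 n w|) ^+ 4) <= C * n%:R ^+ 2.
  pose CC c := projT1 (cid2 (Ex_mart4 H c.1.1.1 c.1.1.2 c.1.2 c.2)).
  apply: (@Ex4_sum _ cs _ CC (fun n => n%:R ^+ 2)) => [c n|c n]; first exact: mM.
  rewrite /CC; case: cid2 => C _ /= /(_ n); apply: le_trans.
  by apply: Ex_le => [||w]; [exact/mom_int/momX|apply: mom_int; apply: momX; exact: (mom_mart H)|rewrite -normrX ger0_norm// exprn_even_ge0].
have [B B0 HB] := ar2_moments H 2.
have [Ce He] : exists C, forall n, E (fun w => edge n w ^+ 4) <= C * 1.
  pose u (i : 'I_6) n w : R := `|x (i%:Z - 2) w| + `|x (n%:Z - i%:Z) w|.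
  have mu i n : mom P (u i n) by apply: momD; exact: mom_norm.
  have B4 t : E (fun w => `|x t w| ^+ 4) <= B by case: (HB t).
  have [i n|C HC] := @Ex4_sum _ (index_enum 'I_6) u (fun _ => 16 * B) (fun=> 1) mu.
    apply: (@le_trans _ _ (E (fun w => 8 * (`|x (i%:Z - 2) w| ^+ 4 + `|x (n%:Z - i%:Z) w| ^+ 4)))).
      apply: Ex_le; [exact/mom_int/momX|by apply: mom_int; momt|by move=> w; exact: sum4].
    rewrite ExZ ?ExD; try by apply: mom_int; momt.
    by have := B4 (i%:Z - 2); have := B4 (n%:Z - i%:Z); rewrite mulr1; lra.
  exists (8 * (1 + C)) => n.
  have ms : mom P (fun w => \sum_(i < 6) u i n w) by apply: mom_sum => i _; exact: mu.
  apply: (@le_trans _ _ (E (fun w => 8 * (1 ^+ 4 + (\sum_(i < 6) u i n w) ^+ 4)))).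
    apply: Ex_le; [by apply: mom_int; apply: momX; exact: mom_edge|by apply: mom_int; momt|].
    by move=> w; exact: sum4.
  rewrite ExZ ?ExD ?Ex_cst; try by apply: mom_int; momt.
  by have := HC n; rewrite expr1n !mulr1; lra.
exists (8 * (`|CM| + `|Ce|)); first by rewrite mulr_ge0// addr_ge0.
move=> n n8.
have n0 : 0 < n%:R :> R by rewrite ltr0n; lia.
have nz : n%:R != 0 :> R by rewrite gt_eqF.
have s4 : Num.sqrt n%:R ^- 4 = n%:R ^- 2 :> R.
  by rewrite (exprM _ 2 2) sqr_sqrtr// ltW.
pose A w := \sum_(c <- cs) `|M c.1.1.1 c.1.1.2 c.1.2 c.2 n w|.
have mA : mom P A by apply: mom_sum => c _; exact: mM.
have me := mom_edge n.
apply: (@le_trans _ _ (E (fun w => 8 * (n%:R ^- 4 * A w ^+ 4 + n%:R ^- 2 * edge n w ^+ 4)))).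
  apply: Ex_le; [by apply: mom_int; apply: momX; exact: mom_zscale|by apply: mom_int; momt|].
  move=> w; apply: le_trans (sum4 _ _) _.
  rewrite exprMn exprVn [(edge _ _ / _) ^+ 4]exprMn exprVn s4 [_ * n%:R ^- 2]mulrC.
  by rewrite /A /cs !big_cons big_nil /= addr0 !addrA.
rewrite ExZ ?ExD ?ExZ; try by apply: mom_int; momt.
rewrite -mulrA ler_wpM2l// mulrDl lerD//.
  apply: le_trans (_ : n%:R ^- 4 * (`|CM| * n%:R ^+ 2) <= _).
    rewrite ler_wpM2l ?invr_ge0 ?exprn_ge0//; apply: le_trans (HM n) _.
    by rewrite ler_wpM2r ?exprn_ge0// ler_norm.
  by rewrite le_eqVlt; apply/orP; left; apply/eqP; field.
rewrite mulrC ler_wpM2r ?invr_ge0 ?exprn_ge0//.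
by apply: le_trans (He n) _; rewrite mulr1 ler_norm.
Qed.

Lemma lin_mart0 : lin_mart (fun _ _ => 0).
Proof. by exists 0, 0, 0, 0 => n w; rewrite (mart_lin P) !mul0r !addr0 mulr0. Qed.

Lemma lin_martZ c U : lin_mart U -> lin_mart (fun n w => c * U n w).
Proof.
move=> [c0 [c1 [c2 [c3 hU]]]]; exists (c * c0), (c * c1), (c * c2), (c * c3) => n w.
by rewrite hU (mart_lin P) [in RHS](mart_lin P); ring.
Qed.

Lemma lin_martD U V : lin_mart U -> lin_mart V -> lin_mart (fun n w => U n w + V n w).
Proof.
move=> [c0 [c1 [c2 [c3 hU]]]] [b0 [b1 [b2 [b3 hV]]]].
exists (c0 + b0), (c1 + b1), (c2 + b2), (c3 + b3) => n w.
by rewrite hU hV (mart_lin P x f1 f2 c0) (mart_lin P x f1 f2 b0) (mart_lin P x f1 f2 (c0 + b0)); ring.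
Qed.

Lemma lin_mart_le U : lin_mart U -> exists C, forall n w, (8 <= n)%N -> `|U n w| <= C * Z n w.
Proof.
move=> [c0 [c1 [c2 [c3 hU]]]]; exists (`|c0| + `|c1| + `|c2| + `|c3|) => n w _.
rewrite hU mart_lin normrM ger0_norm ?invr_ge0// /zscale mulrDr.
apply: le_trans (_ : n%:R^-1 * ((`|c0| + `|c1| + `|c2| + `|c3|) *
   (`|M 1 0 0 0 n w| + `|M 0 1 0 0 n w| + `|M 0 0 1 0 n w| + `|M 0 0 0 1 n w|)) <= _).
  rewrite ler_wpM2l ?invr_ge0//.
  apply: le_trans (_ : `|c0| * `|M 1 0 0 0 n w| + `|c1| * `|M 0 1 0 0 n w| +
     `|c2| * `|M 0 0 1 0 n w| + `|c3| * `|M 0 0 0 1 n w| <= _).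
    rewrite -!normrM; apply: le_trans (ler_normD _ _) _; rewrite lerD2r.
    apply: le_trans (ler_normD _ _) _; rewrite lerD2r; exact: ler_normD.
  move: (normr_ge0 c0) (normr_ge0 c1) (normr_ge0 c2) (normr_ge0 c3).
  move: (normr_ge0 (M 1 0 0 0 n w)) (normr_ge0 (M 0 1 0 0 n w)) (normr_ge0 (M 0 0 1 0 n w)) (normr_ge0 (M 0 0 0 1 n w)).
  move: `|c0| `|c1| `|c2| `|c3| `|M 1 0 0 0 n w| `|M 0 1 0 0 n w| `|M 0 0 1 0 n w| `|M 0 0 0 1 n w|.
  move=> k0 k1 k2 k3 m0 m1 m2 m3 *.
  rewrite -subr_ge0 (_ : _ - _ = k0 * (m1 + m2 + m3) + k1 * (m0 + m2 + m3) + k2 * (m0 + m1 + m3)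
    + k3 * (m0 + m1 + m2)); last by ring.
  by ge0.
rewrite mulrCA lerDl.
have e := edge_ge1 x n w; have e0 : 0 <= edge n w by lra.
have s0 := sqrtr_ge0 (n%:R : R); ge0.
Qed.

Lemma lin_mart_mom U n : lin_mart U -> mom P (U n).
Proof.
move=> [c0 [c1 [c2 [c3 hU]]]]; apply: eq_mom (momZ n%:R^-1 (mom_mart H c0 c1 c2 c3 n)) => w.
by rewrite hU.
Qed.

Lemma lin_mart_mean U n : lin_mart U -> E (U n) = 0.
Proof.
move=> [c0 [c1 [c2 [c3 hU]]]]; rewrite (eq_Ex _ (hU n)) ExZ ?(Ex_mart H) ?mulr0//.
exact/mom_int/(mom_mart H).
Qed.

(** Polarization of [Ex_mart2], which is an exact formula: the sequence is constant for n > 0. *)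
Lemma lin_mart_cov U V : lin_mart U -> lin_mart V -> exists l : R,
  n%:R * E (fun w => U n w * V n w) @[n --> \oo] --> l.
Proof.
move=> [c0 [c1 [c2 [c3 hU]]]] [b0 [b1 [b2 [b3 hV]]]].
pose dd := incr_var P x f1 f2.
exists ((dd (c0 + b0) (c1 + b1) (c2 + b2) (c3 + b3) - dd (c0 - b0) (c1 - b1) (c2 - b2) (c3 - b3)) / 4).
apply: cvg_near_cst; near=> n.
have n0 : n%:R != 0 :> R by rewrite pnatr_eq0 -lt0n; near: n; exact: nbhs_infty_gt.
pose A w := M (c0 + b0) (c1 + b1) (c2 + b2) (c3 + b3) n w ^+ 2.
pose B w := M (c0 - b0) (c1 - b1) (c2 - b2) (c3 - b3) n w ^+ 2.
have iA : int1 P A by apply: mom_int; apply: momX; exact: (mom_mart H).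
have iB : int1 P B by apply: mom_int; apply: momX; exact: (mom_mart H).
rewrite (@eq_Ex _ _ _ _ _ (fun w => (n%:R ^- 2 / 4) * (A w - B w))); last first.
  move=> w; rewrite hU hV /A /B (mart_lin P x f1 f2 c0) (mart_lin P x f1 f2 b0) (mart_lin P x f1 f2 (c0 + b0)) (mart_lin P x f1 f2 (c0 - b0)).
  by field.
rewrite ExZ ?ExB//; last exact: int1B.
have -> : E A = n%:R * dd (c0 + b0) (c1 + b1) (c2 + b2) (c3 + b3) := Ex_mart2 H _ _ _ _ n.
have -> : E B = n%:R * dd (c0 - b0) (c1 - b1) (c2 - b2) (c3 - b3) := Ex_mart2 H _ _ _ _ n.
by field.
Unshelve. all: by end_near. Qed.

Definition globZ k (X : nat -> T -> R) := exists C : R, forall n w, (8 <= n)%N -> `|X n w| <= C * Z n w ^+ k.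

Lemma globZ_ext k X Y : (forall n w, (8 <= n)%N -> X n w = Y n w) -> globZ k X -> globZ k Y.
Proof. by move=> XY [C HC]; exists C => n w n8; rewrite -XY//; exact: HC. Qed.

Lemma globZD k X Y : globZ k X -> globZ k Y -> globZ k (fun n w => X n w + Y n w).
Proof.
move=> [C HC] [C' HC']; exists (C + C') => n w n8; rewrite mulrDl.
by apply: le_trans (ler_normD _ _) (lerD _ _); [exact: HC|exact: HC'].
Qed.

Lemma globZM k l X Y : globZ k X -> globZ l Y -> globZ (k + l) (fun n w => X n w * Y n w).
Proof.
move=> [C HC] [C' HC']; exists (C * C') => n w n8.
by rewrite normrM exprD mulrACA ler_pM// ?HC ?HC'.
Qed.

Lemma globZZ k c X : globZ k X -> globZ k (fun n w => c * X n w).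
Proof. by move=> [C HC]; exists (`|c| * C) => n w n8; rewrite normrM -mulrA ler_wpM2l// HC. Qed.

Lemma edge_zscale n w : (0 < n)%N -> edge n w ^+ 2 / n%:R <= Z n w ^+ 2.
Proof.
move=> n0; have nn : 0 < n%:R :> R by rewrite ltr0n.
rewrite (_ : edge n w ^+ 2 / n%:R = (edge n w / Num.sqrt n%:R) ^+ 2); last first.
  by rewrite exprMn exprVn sqr_sqrtr// ltW.
have e := edge_ge1 x n w; have e0 : 0 <= edge n w by lra.
have s0 := sqrtr_ge0 (n%:R : R); have nn0 := ltW nn.
have z := zscale_ge0 n w.
by apply: lerXn2r; rewrite ?nnegrE//; [ge0|rewrite /zscale lerDr; ge0].
Qed.

Lemma globZ_edge u : edgeO x u -> globZ 2 (fun n w => n%:R^-1 * u n w).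
Proof.
move=> [C HC]; exists `|C| => n w n8; rewrite normrM ger0_norm ?invr_ge0//.
have n0 : (0 < n)%N by lia.
apply: le_trans (_ : n%:R^-1 * (`|C| * edge n w ^+ 2) <= _).
  rewrite ler_wpM2l ?invr_ge0//; apply: le_trans (HC n w) _.
  by rewrite ler_wpM2r ?sqr_ge0// ler_norm.
by rewrite mulrCA ler_wpM2l// mulrC edge_zscale.
Qed.

Lemma globZ_invn2 : globZ 2 (fun n _ => n%:R^-1).
Proof. by apply: globZ_ext (globZ_edge (edgeO_cst x 1)) => n w _; rewrite mulr1. Qed.

Lemma globZ_invn1 : globZ 1 (fun n _ => n%:R^-1).
Proof.
exists 1 => n w n8; rewrite expr1 mul1r ger0_norm ?invr_ge0//.
have n0 : (0 < n)%N by lia.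
have nn : 1 <= n%:R :> R by rewrite ler1n.
rewrite -(@ler_pXn2r _ 2) ?nnegrE ?zscale_ge0 ?invr_ge0//.
apply: le_trans (edge_zscale w n0); rewrite exprVn.
have e := edge_ge1 x n w.
rewrite ler_pdivlMr ?(lt_le_trans ltr01)// expr2 invfM mulfVK ?gt_eqF ?(lt_le_trans ltr01)//.
apply: le_trans (_ : 1 <= _); first by rewrite invf_le1// (lt_le_trans ltr01).
exact: exprn_ege1.
Qed.

Lemma lin_mart_globZ U : lin_mart U -> globZ 1 U.
Proof. by move=> /lin_mart_le[C HC]; exists C => n w n8; rewrite expr1 HC. Qed.

End Scale.

(** * Expansion of the averages over partial ranges *)

Section Averages.
Context (d : measure_display) (T : measurableType d) (R : realType).
Variable P : probability T R.
Variables (x : int -> T -> R) (F : int -> set (set T)) (f1 f2 K : R).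
Hypothesis H : AR2 P x F f1 f2 K.
Variable b : R.
Local Notation a := (innov x f1 f2).
Local Notation E := (Ex P).
Local Notation g := (acov P x).
Local Notation M := (mart P x f1 f2).
Local Notation edge := (edge x).
Local Notation Z := (zscale P x f1 f2).
Local Notation glob := (globZ P x f1 f2).
Local Notation lin := (lin_mart P x f1 f2).

Let mx t : mom P (x t) := ar2_mom H t.

Definition xbar (n : nat) (w : T) : R := n%:R^-1 * \sum_(1 <= t < n.+1) x t%:Z w.

(* b = 0 gives the raw data, b = 1 the demeaned data. *)
Definition ydat (n : nat) (w : T) (t : nat) : R := x t%:Z w - b * xbar n w.

(** The sum starts at time [lo] and omits the last [be] times, so n - (lo + be - 1) terms remain.
    The estimators use ranges with [lo + be <= 3], and [k < lo] keeps the lagged index positive. *)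
Definition avg (lo be k n : nat) (w : T) : R := (n - (lo + be).-1)%:R^-1 *
  \sum_(lo <= t < n.+1 - be) ydat n w t * ydat n w (t - k)%N.

Lemma range_sum (f : nat -> R) n lo be : (0 < lo)%N -> (lo + be <= 3)%N -> (8 <= n)%N ->
  \sum_(1 <= t < n.+1) f t = \sum_(1 <= t < lo) f t + \sum_(lo <= t < n.+1 - be) f t
    + \sum_(n.+1 - be <= t < n.+1) f t.
Proof.
move=> l0 lb n8; rewrite (big_cat_nat (n := lo))//=; last by lia.
by rewrite -addrA; congr (_ + _); rewrite (big_cat_nat (n := (n.+1 - be)%N))//=; lia.
Qed.

Lemma glob_edge (u : nat -> T -> R) :
  (exists C, forall n w, (8 <= n)%N -> `|u n w| <= C * edge n w ^+ 2) ->
  glob 2 (fun n w => n%:R^-1 * u n w).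
Proof.
move=> [C HC].
have : edgeO x (fun n w => if (8 <= n)%N then u n w else 0).
  exists `|C| => n w; case: ifP => [n8|_]; last by rewrite normr0 mulr_ge0// sqr_ge0.
  by apply: le_trans (HC n w n8) _; rewrite ler_wpM2r ?sqr_ge0// ler_norm.
by move=> /(globZ_edge P f1 f2); apply: globZ_ext => n w ->.
Qed.

(** At most two terms are lost, and all of them lie at the ends of the series. *)
Lemma range_edge (f : nat -> T -> nat -> R) lo be : (0 < lo)%N -> (lo + be <= 3)%N ->
  (forall n w t, (1 <= t <= 2)%N -> `|f n w t| <= edge n w ^+ 2) ->
  (forall n w t, (n.-1 <= t <= n)%N -> `|f n w t| <= edge n w ^+ 2) ->
  glob 2 (fun n w => n%:R^-1 * (\sum_(1 <= t < n.+1) f n w t - \sum_(lo <= t < n.+1 - be) f n w t)).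
Proof.
move=> l0 lb h1 h2; apply: glob_edge; exists 6 => n w n8.
rewrite (range_sum _ l0 lb n8).
have e2 : 0 <= edge n w ^+ 2 by exact: sqr_ge0.
have s m1 m2 : (forall t, (m1 <= t < m2)%N -> `|f n w t| <= edge n w ^+ 2) -> (m2 - m1 <= 3)%N ->
    `|\sum_(m1 <= t < m2) f n w t| <= 3 * edge n w ^+ 2.
  move=> hf m3; apply: le_trans (ler_norm_sum _ _ _) _.
  apply: le_trans (_ : \sum_(m1 <= t < m2) edge n w ^+ 2 <= _); first exact: ler_sum_nat.
  by rewrite sumr_const_nat -[leLHS]mulr_natl ler_wpM2r// ler_nat.
have q1 : `|\sum_(1 <= t < lo) f n w t| <= 3 * edge n w ^+ 2.
  by apply: s => [t tl|]; [apply: h1; lia|lia].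
have q2 : `|\sum_(n.+1 - be <= t < n.+1) f n w t| <= 3 * edge n w ^+ 2.
  by apply: s => [t tl|]; [apply: h2; lia|lia].
rewrite (_ : _ - _ = \sum_(1 <= t < lo) f n w t + \sum_(n.+1 - be <= t < n.+1) f n w t); last by ring.
by apply: le_trans (ler_normD _ _) _; lra.
Qed.

Lemma edge_xx n w (s t : int) : -2 <= s <= 3 \/ n%:Z - 5 <= s <= n%:Z ->
  -2 <= t <= 3 \/ n%:Z - 5 <= t <= n%:Z -> `|x s w * x t w| <= edge n w ^+ 2.
Proof.
have e t' : -2 <= t' <= 3 \/ n%:Z - 5 <= t' <= n%:Z -> `|x t' w| <= edge n w.
  by move=> [] /andP[? ?]; [exact: edge_start|exact: edge_end].
by move=> hs ht; rewrite normrM expr2 ler_pM// e.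
Qed.

Lemma edge_x n w (t : int) : -2 <= t <= 3 \/ n%:Z - 5 <= t <= n%:Z -> `|x t w| <= edge n w ^+ 2.
Proof.
move=> ht; apply: (@le_trans _ _ (edge n w)).
  by move: ht => [] /andP[? ?]; [exact: edge_start|exact: edge_end].
by apply: ler_eXnr => //; exact: edge_ge1.
Qed.

Let ka := 1 - f1 - f2.
Let ka0 : 0 < ka.
Proof. by have [_ h _] := ar_adm H; rewrite /ka; lra. Qed.

Definition xbar_lin n w := n%:R^-1 * M 0 0 0 ka^-1 n w.

Lemma lin_xbar : lin xbar_lin.
Proof. by exists 0, 0, 0, ka^-1. Qed.

(** Summing the recursion over t gives [ka] times the sum of x as the sum of the innovations plus
    boundary terms, and [ka] is positive by admissibility. *)
Lemma xbar_rem : exists C, forall n w, `|xbar n w - xbar_lin n w| <= n%:R^-1 * (C * edge n w).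
Proof.
pose r n w := f1 * (x 0 w - x n%:Z w) + f2 * (x 0 w - x n%:Z w + x (-1) w - x (n%:Z - 1) w).
have E0 n w : ka * \sum_(1 <= t < n.+1) x t%:Z w = M 0 0 0 1 n w + r n w.
  have s1 : \sum_(1 <= t < n.+1) x (t%:Z - 1) w = \sum_(1 <= t < n.+1) x t%:Z w - x n%:Z w + x 0 w.
    exact: (sum_shift (fun t => x t w)).
  have s2 : \sum_(1 <= t < n.+1) x (t%:Z - 2) w =
     \sum_(1 <= t < n.+1) x t%:Z w - x n%:Z w + x 0 w - x (n%:Z - 1) w + x (-1) w.
    rewrite -s1 -[x (-1) w]/(x (0 - 1) w) -(sum_shift (fun t => x (t - 1) w)).
    by apply: eq_bigr => t _; congr (x _ w); lia.
  have M3 : M 0 0 0 1 n w = \sum_(1 <= t < n.+1) a t%:Z w.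
    by apply: eq_bigr => t _; rewrite /incr; ring.
  have : \sum_(1 <= t < n.+1) x t%:Z w = f1 * \sum_(1 <= t < n.+1) x (t%:Z - 1) w +
      f2 * \sum_(1 <= t < n.+1) x (t%:Z - 2) w + \sum_(1 <= t < n.+1) a t%:Z w.
    rewrite !mulr_sumr -!big_split/=; apply: eq_bigr => t _; exact: innovE.
  by rewrite s1 s2 M3 /r /ka => e; lra.
exists ((2 * `|f1| + 4 * `|f2|) / ka) => n w.
have -> : xbar n w - xbar_lin n w = n%:R^-1 * (r n w / ka).
  have knz : ka != 0 by rewrite gt_eqF.
  have -> : xbar n w = n%:R^-1 * ((M 0 0 0 1 n w + r n w) / ka).
    by rewrite -E0 [ka * _]mulrC mulfK.
  rewrite /xbar_lin (mart_lin P x f1 f2 0 0 0 ka^-1); clearbody ka; ring.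
rewrite normrM ger0_norm ?invr_ge0// ler_wpM2l ?invr_ge0//.
rewrite normrM [`|ka^-1|]ger0_norm ?invr_ge0 ?(ltW ka0)// mulrAC ler_wpM2r ?invr_ge0 ?(ltW ka0)//.
have x0 : `|x 0 w| <= edge n w by exact: edge_start.
have x1 : `|x (-1) w| <= edge n w by exact: edge_start.
have xn : `|x n%:Z w| <= edge n w by apply: edge_end; lia.
have xn1 : `|x (n%:Z - 1) w| <= edge n w by apply: edge_end; lia.
apply: le_trans (ler_normD _ _) _; rewrite !normrM mulrDl; apply: lerD.
  rewrite [2 * _]mulrC -mulrA ler_wpM2l//; apply: le_trans (ler_normB _ _) _; lra.
rewrite [4 * _]mulrC -mulrA ler_wpM2l//.
apply: le_trans (ler_normB _ _) _.
apply: le_trans (lerD (ler_normD _ _) (lexx _)) _.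
apply: le_trans (lerD (lerD (ler_normB _ _) (lexx _)) (lexx _)) _; lra.
Qed.

Lemma glob_xbar_rem : glob 2 (fun n w => xbar n w - xbar_lin n w).
Proof.
have [C HC] := xbar_rem; have [C' HC'] := globZ_edge P f1 f2 (edgeO_cst x 1).
have h : glob 2 (fun n w => n%:R^-1 * (`|C| * edge n w ^+ 2)).
  apply: glob_edge; exists `|C| => n w _.
  by rewrite ger0_norm// mulr_ge0// sqr_ge0.
case: h => D HD; exists D => n w n8; apply: le_trans (HD n w n8).
apply: le_trans (HC n w) _; apply: le_trans (ler_norm _).
rewrite ler_wpM2l ?invr_ge0//; have e := edge_ge1 x n w.
apply: le_trans (_ : `|C| * edge n w <= _).
  by rewrite ler_wpM2r ?ler_norm// (le_trans _ e).
by rewrite ler_wpM2l// ler_eXnr.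
Qed.

Lemma glob_xbar : glob 1 xbar.
Proof.
have [C HC] := xbar_rem.
have : glob 1 (fun n w => xbar n w - xbar_lin n w).
  exists `|C| => n w n8; apply: le_trans (HC n w) _; rewrite expr1.
  have n1 : 1 <= n%:R :> R by rewrite ler1n; lia.
  have n0 : 0 < n%:R :> R by exact: lt_le_trans n1.
  have e := edge_ge1 x n w; have e0 : 0 <= edge n w by lra.
  apply: le_trans (_ : n%:R^-1 * (`|C| * edge n w) <= _).
    by rewrite ler_wpM2l ?invr_ge0// ler_wpM2r// ler_norm.
  rewrite mulrCA ler_wpM2l// mulrC; apply: le_trans (_ : edge n w / Num.sqrt n%:R <= _).
    have sn : Num.sqrt n%:R <= n%:R :> R.
      rewrite -(@ler_pXn2r _ 2) ?nnegrE ?sqrtr_ge0// sqr_sqrtr//.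
      exact: ler_eXnr.
    rewrite ler_wpM2l// lef_pV2 ?posrE//.
    by rewrite sqrtr_gt0.
  have s0 := sqrtr_ge0 (n%:R : R); have nn0 := ltW n0.
  by rewrite /zscale lerDr; ge0.
move=> h; apply: globZ_ext (globZD h (lin_mart_globZ lin_xbar)) => n w _.
by rewrite subrK.
Qed.

Variables lo be : nat.
Hypotheses (lo0 : (0 < lo)%N) (lobe : (lo + be <= 3)%N).
Local Notation nu n := (n - (lo + be).-1)%N.

(** Relative error of normalizing by n in place of the actual number of terms; it is O(1/n), hence
    of second order in [Z]. *)
Let q (n : nat) : R := n%:R / (nu n)%:R - 1.

Let nu_gt0 n : (8 <= n)%N -> 0 < (nu n)%:R :> R.
Proof. by move=> n8; rewrite ltr0n; lia. Qed.

Let qE n : (8 <= n)%N -> q n = ((lo + be).-1)%:R / (nu n)%:R.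
Proof.
move=> n8; have nn := nu_gt0 n8; rewrite /q -[X in _ - X](@mulfV _ (nu n)%:R) ?gt_eqF//.
rewrite -mulrBl -natrB ?leq_subr//; congr (_%:R / _); lia.
Qed.

Let q_le n : (8 <= n)%N -> `|q n| <= 4 * n%:R^-1.
Proof.
move=> n8; have nn := nu_gt0 n8; rewrite qE// ger0_norm ?divr_ge0//.
have n0 : 0 < n%:R :> R by rewrite ltr0n; lia.
rewrite ler_pdivrMr// mulrAC ler_pdivlMr// -!natrM ler_nat.
have h : ((lo + be).-1 <= 2)%N by lia.
by apply: leq_trans (leq_mul h (leqnn n)) _; lia.
Qed.

Let glob_q2 : glob 2 (fun n _ => q n).
Proof.
have [C HC] := globZZ 4 (globZ_invn2 P x f1 f2).
exists C => n w n8; apply: le_trans (HC n w n8); apply: le_trans (q_le n8) _.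
exact: ler_norm.
Qed.

Let glob_q1 : glob 1 (fun n _ => q n).
Proof.
have [C HC] := globZZ 4 (globZ_invn1 P x f1 f2).
exists C => n w n8; apply: le_trans (HC n w n8); apply: le_trans (q_le n8) _.
exact: ler_norm.
Qed.

Let glob_1q : glob 0 (fun n _ => 1 + q n).
Proof.
exists 5 => n w n8; rewrite expr0 mulr1; apply: le_trans (ler_normD _ _) _; rewrite normr1.
have : n%:R^-1 <= 1 :> R by rewrite invf_le1 ?ltr0n ?ler1n; lia.
by have := q_le n8; lra.
Qed.

Let nuE n (r : R) : (8 <= n)%N -> (nu n)%:R^-1 * r = (1 + q n) * (n%:R^-1 * r).
Proof.
move=> n8; have nn := nu_gt0 n8.
have n0 : n%:R != 0 :> R by rewrite pnatr_eq0; lia.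
rewrite /q; move: (nu n)%:R nn (n%:R : R) n0 => y y0 z z0; field.
by rewrite z0 gt_eqF.
Qed.

Lemma glob_avgx k : (k <= 2)%N ->
  glob 2 (fun n w => (nu n)%:R^-1 * (\sum_(lo <= t < n.+1 - be) x (t%:Z - k%:Z) w) - xbar n w).
Proof.
move=> k2.
have o1 := @range_edge (fun n w t => x (t%:Z - k%:Z) w) lo be lo0 lobe.
have {}o1 : glob 2 (fun n w => n%:R^-1 * (\sum_(1 <= t < n.+1) x (t%:Z - k%:Z) w
    - \sum_(lo <= t < n.+1 - be) x (t%:Z - k%:Z) w)).
  by apply: o1 => n w t ht; apply: edge_x; lia.
have o2 : glob 2 (fun n w => n%:R^-1 * (\sum_(1 <= t < n.+1) x (t%:Z - k%:Z) w -
     \sum_(1 <= t < n.+1) x t%:Z w)).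
  have s1 n w : \sum_(1 <= t < n.+1) x (t%:Z - 1) w = \sum_(1 <= t < n.+1) x t%:Z w - x n%:Z w + x 0 w.
    exact: (sum_shift (fun t => x t w)).
  apply: glob_edge; exists 4 => n w n8; move: k2.
  have e0 := sqr_ge0 (edge n w).
  have x0 : `|x 0 w| <= edge n w ^+ 2 by apply: edge_x; lia.
  have x1 : `|x (-1) w| <= edge n w ^+ 2 by apply: edge_x; lia.
  have xn : `|x n%:Z w| <= edge n w ^+ 2 by apply: edge_x; lia.
  have xn1 : `|x (n%:Z - 1) w| <= edge n w ^+ 2 by apply: edge_x; lia.
  case: k {o1} => [|[|[|//]]] _.
  - rewrite (_ : _ - _ = 0) ?normr0; first by lra.
    by apply/eqP; rewrite subr_eq0; apply/eqP; apply: eq_bigr => t _; rewrite subr0.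
  - rewrite s1 (_ : _ - _ = x 0 w - x n%:Z w); last by ring.
    apply: le_trans (ler_normB _ _) _; lra.
  have s2 : \sum_(1 <= t < n.+1) x (t%:Z - 2) w =
     \sum_(1 <= t < n.+1) x t%:Z w - x n%:Z w + x 0 w - x (n%:Z - 1) w + x (-1) w.
    rewrite -s1 -[x (-1) w]/(x (0 - 1) w) -(sum_shift (fun t => x (t - 1) w)).
    by apply: eq_bigr => t _; congr (x _ w); lia.
  rewrite s2 (_ : _ - _ = (x 0 w - x n%:Z w) + (x (-1) w - x (n%:Z - 1) w)); last by ring.
  apply: le_trans (ler_normD _ _) _.
  apply: le_trans (lerD (ler_normB _ _) (ler_normB _ _)) _; lra.
have h := globZD (globZM glob_q1 glob_xbar) (globZM glob_1q (globZD o2 (globZZ (-1) o1))).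
apply: globZ_ext h => n w n8; rewrite nuE// /xbar; ring.
Qed.

(** The raw average has mean exactly [g k] ([Eraw]), so its quadratic remainder [raw] is centred and
    contributes nothing to the limit. Only demeaning does, by an amount free of [lo], [be] and
    [k]. *)
Lemma jet_avg k (c0 c1 c2 : R) L : (k < lo)%N ->
  edgeO x (fun n w => xsum x k n w - n%:R * g k - M c0 c1 c2 0 n w) ->
  n%:R * E (fun w => xbar_lin n w * xbar_lin n w) @[n --> \oo] --> L ->
  jet P 8 Z (avg lo be k) (g k) (fun n w => n%:R^-1 * M c0 c1 c2 0 n w) ((b ^+ 2 - 2 * b) * L).
Proof.
move=> klo oS cL; have k2 : (k <= 2)%N by lia.
pose U n w := n%:R^-1 * M c0 c1 c2 0 n w.
have LU : lin U by exists c0, c1, c2, 0.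
pose ps n w := \sum_(lo <= t < n.+1 - be) x t%:Z w * x (t%:Z - k%:Z) w.
pose raw n w := (nu n)%:R^-1 * ps n w - g k - U n w.
have mraw n : mom P (raw n).
  apply: momB; last exact: (lin_mart_mom H _ LU).
  apply: momB; last exact: mom_cst.
  by apply: momZ; apply: mom_sum => t _; exact: momM.
have mm n : mom P (fun w => xbar_lin n w * xbar_lin n w).
  by apply: momM; exact: (lin_mart_mom H _ lin_xbar).
have graw : glob 2 raw.
  have o1 := @range_edge (fun n w t => x t%:Z w * x (t%:Z - k%:Z) w) lo be lo0 lobe.
  have {}o1 : glob 2 (fun n w => n%:R^-1 * (xsum x k n w - ps n w)).
    by apply: o1 => n w t ht; apply: edge_xx; lia.
  have h := globZD (globZD (globZZ (g k) glob_q2) (globZM glob_q1 (lin_mart_globZ LU)))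
    (globZM glob_1q (globZD (globZ_edge P f1 f2 oS) (globZZ (-1) o1))).
  apply: globZ_ext h => n w n8; rewrite /raw nuE// /U.
  have n0 : n%:R != 0 :> R by rewrite pnatr_eq0; lia.
  by move: (q n) (xsum x k n w) (ps n w) (M _ _ _ _ _ _) => ? ? ? ?; field.
have Eraw n : (8 <= n)%N -> E (raw n) = 0.
  move=> n8; have nn := nu_gt0 n8.
  rewrite ExB; last first.
  - exact/mom_int/(lin_mart_mom H _ LU).
  - apply: int1B; last exact: int1_cst.
    by apply: int1Z; apply: mom_int; apply: mom_sum => t _; exact: momM.
  rewrite (lin_mart_mean H _ LU) subr0 ExB ?Ex_cst; last exact: int1_cst; last first.
    by apply: int1Z; apply: mom_int; apply: mom_sum => t _; exact: momM.
  rewrite ExZ; last by apply: mom_int; apply: mom_sum => t _; exact: momM.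
  rewrite Ex_sum; last by move=> t; exact: momM.
  under eq_bigr => t _ do rewrite (Ex_xx H (k := k)) ?subKr//.
  rewrite sumr_const_nat -[g k *+ _]mulr_natl (_ : (n.+1 - be - lo)%N = nu n); last by lia.
  by rewrite mulrA mulVf ?mul1r ?subrr// gt_eqF.
(* Expanding (x_t - b m) (x_(t-k) - b m) gives b^2 m^2 minus b m times two partial means of x, each
   equal to m up to second order; so the correction is (b^2 - 2 b) m^2, with m replaced by its
   linear part. *)
pose W n w := if (8 <= n)%N then raw n w + (b ^+ 2 - 2 * b) * (xbar_lin n w * xbar_lin n w) else 0.
exists W; split.
- move=> n; rewrite /W; case: (8 <= n)%N; last exact: mom_cst.
  by apply: momD => //; exact: momZ.
- have h := globZD graw (globZZ (b ^+ 2 - 2 * b) (globZM (lin_mart_globZ lin_xbar) (lin_mart_globZ lin_xbar))).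
  have : glob 2 W by apply: globZ_ext h => n w; rewrite /W => ->.
  by [].
- have : (b ^+ 2 - 2 * b) * (n%:R * E (fun w => xbar_lin n w * xbar_lin n w)) @[n --> \oo] -->
      (b ^+ 2 - 2 * b) * L by exact: cvgMl_tmp.
  apply: cvg_trans; apply: near_eq_cvg; near=> n.
  have n8 : (8 <= n)%N by near: n; exact: nbhs_infty_ge.
  rewrite /W n8 ExD ?ExZ ?(Eraw n n8); [by ring|exact: mom_int|exact: mom_int|].
  by apply: int1Z; exact: mom_int.
- pose A1 n w := (nu n)%:R^-1 * (\sum_(lo <= t < n.+1 - be) x (t%:Z - 0%:Z) w) - xbar n w.
  pose A2 n w := (nu n)%:R^-1 * (\sum_(lo <= t < n.+1 - be) x (t%:Z - k%:Z) w) - xbar n w.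
  have h := globZD (globZZ (- b) (globZM glob_xbar (globZD (@glob_avgx 0 isT) (glob_avgx k2))))
    (globZZ (b ^+ 2 - 2 * b) (globZM glob_xbar_rem (globZD glob_xbar (lin_mart_globZ lin_xbar)))).
  have : glob 3 (fun n w => avg lo be k n w - g k - U n w - W n w).
    apply: globZ_ext h => n w n8; have nn := nu_gt0 n8.
    have -> : avg lo be k n w = (nu n)%:R^-1 * ps n w
       - b * xbar n w * ((nu n)%:R^-1 * (\sum_(lo <= t < n.+1 - be) x (t%:Z - 0%:Z) w)
          + (nu n)%:R^-1 * (\sum_(lo <= t < n.+1 - be) x (t%:Z - k%:Z) w))
       + (b * xbar n w) ^+ 2.
      have -> : (b * xbar n w) ^+ 2 = (nu n)%:R^-1 * \sum_(lo <= t < n.+1 - be) (b * xbar n w) ^+ 2.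
        rewrite sumr_const_nat -[_ ^+ 2 *+ _]mulr_natl (_ : (n.+1 - be - lo)%N = nu n); last by lia.
        by rewrite [RHS]mulrA mulVf ?mul1r// gt_eqF.
      rewrite /avg (_ : \sum_(lo <= t < n.+1 - be) _ = ps n w - b * xbar n w *
         (\sum_(lo <= t < n.+1 - be) x (t%:Z - 0%:Z) w + \sum_(lo <= t < n.+1 - be) x (t%:Z - k%:Z) w)
         + \sum_(lo <= t < n.+1 - be) (b * xbar n w) ^+ 2); first by ring.
      rewrite /ps -big_split/= mulr_sumr -sumrB -big_split/=.
      apply: eq_big_nat => t /andP[lt _].
      rewrite /ydat subr0 (_ : (t - k)%N%:Z = t%:Z - k%:Z); last by lia.
      ring.
    rewrite /W n8 /raw; ring.
  case=> C HC; exists `|C| => //; exists 1 => // n w n8 _; apply: le_trans (HC n w n8) _.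
  by rewrite ler_wpM2r ?ler_norm// exprn_ge0// zscale_ge0.
Unshelve. all: by end_near. Qed.

End Averages.

Section SameJetAvg.
Context (d : measure_display) (T : measurableType d) (R : realType).
Variable P : probability T R.
Variables (x : int -> T -> R) (F : int -> set (set T)) (f1 f2 K : R).
Hypothesis H : AR2 P x F f1 f2 K.

(* The jet does not depend on the range of summation: this is why the two
   estimators have the same bias. *)
Lemma samejet_avg b lo be lo' be' k : (k < lo)%N -> (k < lo')%N -> (lo + be <= 3)%N -> (lo' + be' <= 3)%N ->
  samejet P 8 (zscale P x f1 f2) (lin_mart P x f1 f2) (acov P x k) (avg x b lo be k) (avg x b lo' be' k).
Proof.
move=> kl kl' lb lb'; have k2 : (k <= 2)%N by lia.
have [c0 [c1 [c2 oS]]] := xsum_lin H k2.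
have [L cL] := lin_mart_cov H (lin_xbar P x f1 f2) (lin_xbar P x f1 f2).
exists (fun n w => n%:R^-1 * mart P x f1 f2 c0 c1 c2 0 n w), ((b ^+ 2 - 2 * b) * L); split.
- by exists c0, c1, c2, 0.
- by apply: (jet_avg H) => //; lia.
- by apply: (jet_avg H) => //; lia.
Qed.

End SameJetAvg.

(** * Moments of the least squares estimator *)

Section LeastSquaresBound.
Variable R : realType.
Implicit Types y : nat -> R.

(** Determinant of the matrix with rows (dif (r+4), dif (r+3)) and (dif (r+2), dif (r+1)): the
    regressors of two differenced fitted values. The blocks, taken with step 4, use disjoint
    differences. *)
Definition det4 (dif : nat -> R) (r : nat) : R := dif r.+4 * dif r.+1 - dif r.+3 * dif r.+2.

Definition sq4 (dif : nat -> R) (r : nat) : R :=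
  dif r.+4 ^+ 2 + dif r.+1 ^+ 2 + dif r.+3 ^+ 2 + dif r.+2 ^+ 2.

Definition blockdet (dif : nat -> R) (i : nat) : R := det4 dif (4 * i + 3).

Definition blocksq (dif : nat -> R) (i : nat) : R := sq4 dif (4 * i + 3).

Lemma block_cauchy (a b c e f h : R) :
  (a * b - c * e) ^+ 2 <= (a ^+ 2 + c ^+ 2) * (f ^+ 2 + b ^+ 2 + e ^+ 2 + h ^+ 2).
Proof.
rewrite -subr_ge0 (_ : _ - _ = (a * e + c * b) ^+ 2 + (a ^+ 2 + c ^+ 2) * (f ^+ 2 + h ^+ 2)); last by ring.
by apply: addr_ge0; [exact: sqr_ge0|apply: mulr_ge0; apply: addr_ge0; exact: sqr_ge0].
Qed.

(* The fitted values have squared norm at most 4 sum y^2. Differencing them removes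
   the sample mean, and Cramer's rule on two differenced rows isolates each
   coefficient. *)
Lemma regression_bound y (th1 th2 th : R) (n m : nat) (dif : nat -> R) : (4 * m + 4 <= n)%N ->
  (forall t, dif t.+1 = y t.+1 - y t) ->
  \sum_(1 <= k < n.-1) (th1 * y k.+1 + th2 * y k) ^+ 2 <=
    4 * \sum_(1 <= t < n.+1) y t ^+ 2 ->
  (th == th1) || (th == th2) ->
  th ^+ 2 * \sum_(i < m) blockdet dif i ^+ 2 <=
    8 * (\sum_(i < m) blocksq dif i) * \sum_(1 <= t < n.+1) y t ^+ 2.
Proof.
move=> mn difE hS hth.
set S := \sum_(1 <= t < n.+1) y t ^+ 2 in hS *.
pose u k := th1 * y k.+1 + th2 * y k.
pose w r := u r.+3 - u r.+2.
pose w' r := u r.+1 - u r.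
have wE r : w r = th1 * dif r.+4 + th2 * dif r.+3 by rewrite /w /u !difE; ring.
have w'E r : w' r = th1 * dif r.+2 + th2 * dif r.+1 by rewrite /w' /u !difE; ring.
pose W i := w (4 * i + 3)%N ^+ 2 + w' (4 * i + 3)%N ^+ 2.
(* Each squared difference of two fitted values is at most twice the sum of their squares, and the
   blocks being disjoint no fitted value is counted twice. *)
have sw : forall k, \sum_(i < k) W i <= 2 * \sum_(3 <= s < 4 * k + 3) u s ^+ 2.
  elim=> [|k IH]; first by rewrite big_ord0 mulr_ge0// sumr_ge0// => i _; exact: sqr_ge0.
  rewrite big_ord_recr/= /W.
  have -> : (4 * k.+1 + 3 = (4 * k + 3).+4)%N by lia.
  have r3 : (3 <= 4 * k + 3)%N by lia.
  move: (4 * k + 3)%N r3 IH => r r3 IH.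
  rewrite (big_nat_recr r.+3)/=; last by lia.
  rewrite (big_nat_recr r.+2)/=; last by lia.
  rewrite (big_nat_recr r.+1)/=; last by lia.
  rewrite (big_nat_recr r)/=; last by lia.
  move: IH; rewrite /w /w'; set A := \sum_(i < k) _; set B := \sum_(3 <= s < _) _ => IH.
  move: (u r) (u r.+1) (u r.+2) (u r.+3) => a b c e.
  rewrite -subr_ge0 (_ : _ - _ = (2 * B - A) + (a + b) ^+ 2 + (c + e) ^+ 2); last by ring.
  by apply: addr_ge0; [apply: addr_ge0|]; rewrite ?sqr_ge0// subr_ge0.
have sw2 : \sum_(i < m) W i <= 8 * S.
  apply: le_trans (sw m) _; apply: le_trans (_ : 2 * (4 * S) <= _); last by lra.
  rewrite ler_wpM2l//; apply: le_trans hS.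
  rewrite [leRHS](big_cat_nat (n := 3))//=; last by lia.
  rewrite [X in _ + X](big_cat_nat (n := (4 * m + 3)%N))//=; [|lia|lia].
  rewrite addrCA lerDl addr_ge0// sumr_ge0// => i _; exact: sqr_ge0.
have one i : (th * blockdet dif i) ^+ 2 <= W i * blocksq dif i.
  rewrite /blockdet /blocksq /W /det4 /sq4; move: (4 * i + 3)%N => r.
  case/orP: hth => /eqP ->.
    rewrite (_ : th1 * _ = w r * dif r.+1 - w' r * dif r.+3); last by rewrite wE w'E; ring.
    exact: block_cauchy.
  rewrite (_ : th2 * _ = w' r * dif r.+4 - w r * dif r.+2); last by rewrite wE w'E; ring.
  apply: le_trans (block_cauchy _ _ _ _ (dif r.+1) (dif r.+3)) _.
  by rewrite le_eqVlt; apply/orP; left; apply/eqP; ring.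
have b0 i : 0 <= blocksq dif i by rewrite /blocksq /sq4; do 3?apply: addr_ge0; exact: sqr_ge0.
have W0 i : 0 <= W i by rewrite /W; apply: addr_ge0; exact: sqr_ge0.
set B := \sum_(i < m) blocksq dif i.
have B0 : 0 <= B by apply: sumr_ge0 => i _.
apply: (@le_trans _ _ (B * \sum_(i < m) W i)).
  rewrite mulr_sumr mulr_sumr; apply: ler_sum => i _.
  rewrite -exprMn; apply: le_trans (one i) _; rewrite mulrC ler_wpM2r//.
  by rewrite /B (bigD1 i)//= lerDl sumr_ge0.
rewrite (_ : 8 * B * S = B * (8 * S)); last by ring.
by rewrite ler_wpM2l.
Qed.

End LeastSquaresBound.

(** * Small values of the block determinants *)

Section SmallBall.
Context (d : measure_display) (T : measurableType d) (R : realType).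
Variable P : probability T R.
Variables (x : int -> T -> R) (F : int -> set (set T)) (f1 f2 K : R).
Hypothesis H : AR2 P x F f1 f2 K.
Local Notation a := (innov x f1 f2).
Local Notation E := (Ex P).

Let mx t : mom P (x t) := ar2_mom H t.

Definition xdif (w : T) (t : nat) : R := x t%:Z w - x (t%:Z - 1) w.

Let K0 : 0 <= K.
Proof.
have := ar_ball H 0 0 ler01; rewrite mulr1 => h.
by rewrite -lee_fin; apply: le_trans h; exact: measure_ge0.
Qed.

Let past_dif (t : int) s : s%:Z < t -> past_meas (F t) (xdif ^~ s).
Proof. by move=> st; apply: pastB; apply: (past_x H); lia. Qed.

Let past_det (t : int) i : (4 * i + 7)%N%:Z < t -> past_meas (F t) (fun w => blockdet (xdif w) i).
Proof.
by move=> it; apply: pastB; apply: pastM; apply: past_dif; lia.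
Qed.

Fixpoint small_dets (e : R) (i : nat) : set T := if i is j.+1 then
  small_dets e j `&` [set w | `|blockdet (xdif w) j| <= e ^+ 2] else setT.

Let past_small e i (t : int) : (4 * i + 4)%N%:Z <= t -> <<s F t >> (small_dets e i).
Proof.
elim: i => [|i IH] it; first exact: pastT.
apply: pastI; first by apply: IH; lia.
by apply: past_le; apply: past_norm; apply: past_det; lia.
Qed.

(** Each block costs a factor 2 K e, in two steps. Given the past, |dif (r+1)| <= e has probability
    at most K e. Otherwise the determinant divided by dif (r+1) is the innovation at time r+4 plus a
    function of its past, and it is at most e^2 / e = e in absolute value, again with probability at
    most K e. *)
Lemma small_dets_le e m : 0 < e -> (P (small_dets e m) <= ((2 * K * e) ^+ m)%:E)%E.
Proof.
move=> e0; elim: m => [|i IH].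
  by rewrite /= expr0; exact: probability_le1.
pose r := (4 * i + 3)%N; pose t := r.+4.
have sub (s : int) D : <<s F s >> D -> measurable D by exact: (ar_sub H).
pose D1 := [set w | `|a r.+1%:Z w + (xdif w r.+1 - a r.+1%:Z w)| <= e].
pose Ei := small_dets e i.
pose E' := Ei `&` [set w | e < `|xdif w r.+1|].
pose W2 w := (xdif w t - a t%:Z w) - xdif w r.+3 * xdif w r.+2 * (xdif w r.+1)^-1.
pose D2 := [set w | `|a t%:Z w + W2 w| <= e].
have pW (s : nat) (u : int) : s%:Z <= u -> past_meas (F u) (fun w => xdif w s - a s%:Z w).
  move=> su; rewrite (_ : (fun w => _) = fun w => f1 * x (s%:Z - 1) w + f2 * x (s%:Z - 2) w - x (s%:Z - 1) w); last first.
    by apply/funext => w; rewrite /xdif /innov; ring.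
  by apply: pastB; [apply: pastD; apply: pastM; [exact: past_cst| |exact: past_cst|]|]; apply: (past_x H); lia.
have pEi (u : int) : (4 * i + 4)%N%:Z <= u -> <<s F u >> Ei by exact: past_small.
have pE' : <<s F t%:Z >> E'.
  by apply: pastI; [apply: pEi; lia|apply: past_gt; apply: past_norm; apply: past_dif; lia].
have pW2 : past_meas (F t%:Z) W2.
  apply: pastB; first exact: pW.
  by apply: pastM; [apply: pastM|apply: past_inv]; apply: past_dif; lia.
have ball (s : int) (W : T -> R) D : past_meas (F s) W -> <<s F s >> D ->
    (P ([set w | (`|a s w + W w| <= e)%R] `&` D) <= (K * e)%:E * P D)%E.
  move=> pW' pD; apply: (@innov_ball _ _ _ P (a s) (F s)) => //.
  - exact: mom_meas (ar_amom H s).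
  - by move=> C; exact: (ar_sub H).
  - by move=> C D'; exact: (ar_indep H).
  - by move=> c; apply: (ar_ball H); exact: ltW.
have b1 : (P (D1 `&` Ei) <= (K * e)%:E * P Ei)%E.
  by apply: ball; [apply: pW; lia|apply: pEi; lia].
have b2 : (P (D2 `&` E') <= (K * e)%:E * P E')%E by exact: ball.
have ma s := mom_meas (ar_amom H s).
have mE' : measurable E' by exact: sub pE'.
have mEi : measurable Ei by apply: (sub t%:Z); apply: pEi; lia.
have pm (u : int) (X : T -> R) : past_meas (F u) X -> measurable_fun setT X.
  by move=> pX; apply: (@past_measurable _ _ _ (F u)) pX => D; exact: (ar_sub H).
have mD1 : measurable D1.
  have mW : measurable_fun setT (fun w => xdif w r.+1 - a r.+1%:Z w).
    by apply: (pm r.+1%:Z); apply: pW; lia.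
  by apply: measurable_le; apply: measurableT_comp => //; apply: measurable_funD => //; exact: ma.
have mD2 : measurable D2.
  by apply: measurable_le; apply: measurableT_comp => //; apply: measurable_funD; [exact: ma|exact: pm pW2].
have PE' : (P E' <= P Ei)%E by apply: le_measure; rewrite ?inE// => w [].
have incl : small_dets e i.+1 `<=` (D1 `&` Ei) `|` (D2 `&` E').
  move=> w /= [wEi wd]; have [h|h] := leP `|xdif w r.+1| e; [left|right].
    by split => //; rewrite /D1/= [a _ _ + _]addrC subrK.
  split => //; rewrite /D2/= /W2.
  have v0 : 0 < `|xdif w r.+1| by exact: lt_trans h.
  have vnz : xdif w r.+1 != 0 by rewrite -normr_gt0.
  rewrite (_ : a t%:Z w + _ = blockdet (xdif w) i / xdif w r.+1); last first.
    by rewrite /blockdet /det4 -/r -/t; field.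
  rewrite normrM normfV ler_pdivrMr//; apply: le_trans wd _.
  by rewrite expr2 ler_wpM2l// ltW.
have mS : measurable (small_dets e i.+1).
  by apply: (sub (4 * i.+1 + 4)%N%:Z); apply: past_small.
apply: (@le_trans _ _ (P ((D1 `&` Ei) `|` (D2 `&` E')))).
  by apply: le_measure; rewrite ?inE//; apply: measurableU; exact: measurableI.
apply: (le_trans (measureU2 _ _ _)); [exact: measurableI|exact: measurableI|].
apply: (@le_trans _ _ ((K * e)%:E * P Ei + (K * e)%:E * P Ei)%E).
  apply: leeD => //; apply: le_trans b2 _; apply: lee_wpmul2l => //.
  by rewrite lee_fin mulr_ge0// ltW.
apply: (@le_trans _ _ ((2 * K * e)%:E * ((2 * K * e) ^+ i)%:E)%E); last by rewrite -EFinM -exprS.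
rewrite -ge0_muleDl; [|rewrite lee_fin mulr_ge0// ltW..]; rewrite //.
rewrite -EFinD (_ : K * e + K * e = 2 * K * e); last by ring.
by apply: lee_wpmul2l => //; rewrite lee_fin !mulr_ge0// ltW.
Qed.

(* By ar_ball, given the past each block determinant is at most e^2 with probability
   O(e); with 4 (q + 1) blocks detsum <= e^4 has probability O(e^(4 (q + 1))), enough
   for a negative moment of order q. *)
Variable q : nat.
Let m := (4 * q.+1)%N.

Definition detsum (w : T) : R := \sum_(i < m) blockdet (xdif w) i ^+ 2.

Lemma mom_xdif t : mom P (xdif ^~ t).
Proof. by apply: momB. Qed.

Lemma mom_detsum : mom P detsum.
Proof.
apply: mom_sum => i _; apply: momX; apply: momB; apply: momM; exact: mom_xdif.
Qed.

Lemma detsum_ge0 w : 0 <= detsum w.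
Proof. by apply: sumr_ge0 => i _; exact: sqr_ge0. Qed.

Let e16 : 2^-1 ^+ 4 = 16^-1 :> R.
Proof. by field. Qed.

Let small_sub w k : detsum w <= 16^-1 ^+ k -> small_dets (2^-1 ^+ k) m w.
Proof.
move=> dw; have h i : (i < m)%N -> `|blockdet (xdif w) i| <= (2^-1 ^+ k) ^+ 2.
  move=> im; rewrite -(@ler_pXn2r _ 2) ?nnegrE ?exprn_ge0//.
  rewrite -normrX ger0_norm ?sqr_ge0//; apply: (@le_trans _ _ (detsum w)).
    rewrite /detsum (bigD1 (Ordinal im))//= lerDl sumr_ge0// => j _; exact: sqr_ge0.
  apply: le_trans dw _; rewrite -e16 -!exprM (_ : (4 * k = k * 2 * 2)%N)//; lia.
elim: {1 3}m (leqnn m) => [//|j IH] jm /=; split; first by apply: IH; exact: ltnW.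
exact: h.
Qed.

Let tail k : (P [set w | (detsum w <= 16^-1 ^+ k)%R] <= ((2 * K) ^+ m * 16^-1 ^+ (q.+1 * k))%:E)%E.
Proof.
have e0 : 0 < 2^-1 ^+ k :> R by rewrite exprn_gt0.
have := small_dets_le m e0.
rewrite exprMn (_ : (2^-1 ^+ k) ^+ m = 16^-1 ^+ (q.+1 * k) :> R); last first.
  by rewrite -e16 -!exprM /m; congr (_ ^+ _); rewrite mulnCA [(k * _)%N]mulnC.
apply: le_trans; apply: le_measure; rewrite ?inE.
- exact: (measurable_le _ (mom_meas mom_detsum)).
- by apply: ((ar_sub H) (4 * m + 4)%N%:Z); exact: past_small.
- by move=> w /=; exact: small_sub.
Qed.

Lemma detsum_inv_moment : exists2 C : R, 0 <= C &
  int1 P (fun w => (detsum w)^-1 ^+ q) /\ E (fun w => (detsum w)^-1 ^+ q) <= C.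
Proof.
have c0 : 0 <= (2 * K) ^+ m by rewrite exprn_ge0// mulr_ge0.
have mi : measurable_fun setT (fun w => (detsum w)^-1).
  by apply: measurableT_comp; [exact: measurable_inv|exact: mom_meas mom_detsum].
have [w||i1 i2] := dyadic_moment (P := P) (q := q) mi _ c0.
- by rewrite invr_ge0 detsum_ge0.
- move=> k; apply: le_trans (tail k); apply: le_measure; rewrite ?inE.
  + exact: (measurable_gt _ mi).
  + exact: (measurable_le _ (mom_meas mom_detsum)).
  + move=> w /= kw; have k0 : 0 < 16 ^+ k :> R by rewrite exprn_gt0.
    have d0 : 0 < detsum w by rewrite -invr_gt0; exact: lt_trans kw.
    by rewrite exprVn -[leLHS]invrK lef_pV2 ?posrE ?invr_gt0// ltW.
exists (1 + 2 * 16 ^+ q * (2 * K) ^+ m) => //.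
by rewrite addr_ge0// mulr_ge0// mulr_ge0// exprn_ge0.
Qed.

(** Since the inverse of 0 is 0, the negative moment carries no information on the zeros of
    [detsum]; that they are negligible needs its own argument, the event being contained in all the
    small-value events. *)
Lemma detsum_neq0 : {ae P, forall w, detsum w != 0}.
Proof.
have mD : measurable [set w | (detsum w <= 0)%R].
  exact: (measurable_le _ (mom_meas mom_detsum)).
exists [set w | (detsum w <= 0)%R]; split => //; last first.
  by move=> w /= /negP; rewrite negbK => /eqP ->.
apply/eqP; rewrite eq_le measure_ge0 andbT.
have fin : P [set w | (detsum w <= 0)%R] \is a fin_num by exact: fin_num_measure.
rewrite -(fineK fin) lee_fin.
apply: (@limit_le_geometric _ _ ((2 * K) ^+ m) _ (16^-1 ^+ q.+1)).
  rewrite exprn_ge0 ?invr_ge0//= exprn_ilt1// ?invr_ge0// invf_lt1//; lra.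
move=> k; rewrite addr0 -exprM -lee_fin (fineK fin); apply: le_trans (tail k).
apply: le_measure; rewrite ?inE//.
  exact: (measurable_le _ (mom_meas mom_detsum)).
by move=> w /= dw; apply: le_trans dw _; rewrite exprn_ge0// invr_ge0.
Qed.

Definition blocksum (w : T) : R := \sum_(i < m) blocksq (xdif w) i.

Lemma mom_blocksum : mom P blocksum.
Proof.
by apply: mom_sum => i _; do 3?apply: momD; apply: momX; exact: mom_xdif.
Qed.

End SmallBall.

(** * The estimators *)

Section Estimators.
Variable R : realType.
Implicit Types (y e v : nat -> R) (n : nat).

Lemma normal_equation (s : seq nat) e v :
  (forall h, \sum_(t <- s) e t ^+ 2 <= \sum_(t <- s) (e t - h * v t) ^+ 2) ->
  \sum_(t <- s) e t * v t = 0.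
Proof.
set A := \sum_(t <- s) e t * v t; set B := \sum_(t <- s) v t ^+ 2.
have B0 : 0 <= B by apply: sumr_ge0 => t _; exact: sqr_ge0.
have E h : \sum_(t <- s) (e t - h * v t) ^+ 2 = \sum_(t <- s) e t ^+ 2 - 2 * h * A + h ^+ 2 * B.
  rewrite /A /B !mulr_sumr -sumrB -big_split/=; apply: eq_bigr => t _; ring.
(* The step A / (B + 1) is used in place of the optimal A / B to avoid the case B = 0; it still
   forces A^2 (B + 2) / (B + 1)^2 <= 0. *)
move=> hm; have := hm (A / (B + 1)); rewrite E => h.
have B1 : B + 1 != 0 by rewrite gt_eqF// ltr_wpDl.
have h2 : A ^+ 2 * (B + 2) / (B + 1) ^+ 2 <= 0.
  rewrite (_ : A ^+ 2 * (B + 2) / (B + 1) ^+ 2 = 2 * (A / (B + 1)) * A - (A / (B + 1)) ^+ 2 * B).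
    by lra.
  by field.
move: h2; rewrite pmulr_lle0 ?invr_gt0 ?exprn_gt0 ?ltr_wpDl//.
rewrite pmulr_lle0 ?ltr_wpDl// => h2.
by apply/eqP; rewrite -sqrf_eq0 eq_le h2 sqr_ge0.
Qed.

Lemma rss1E n y (phi : 'I_1 -> R) : residual_sum_squares n y phi =
  \sum_(2 <= t < n.+1) (y t - phi ord0 * y (t - 1)%N) ^+ 2.
Proof. by apply: eq_bigr => t _; rewrite big_ord1. Qed.

Lemma rss2E n y (phi : 'I_2 -> R) : residual_sum_squares n y phi =
  \sum_(3 <= t < n.+1) (y t - (phi ord0 * y (t - 1)%N + phi ord_max * y (t - 2)%N)) ^+ 2.
Proof.
apply: eq_bigr => t _; rewrite big_ord_recr big_ord1/=.
by congr ((_ - (phi _ * _ + _)) ^+ 2); apply: val_inj.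
Qed.

Lemma fitted_bound (s : seq nat) y u :
  \sum_(t <- s) (y t - u t) ^+ 2 <= \sum_(t <- s) y t ^+ 2 ->
  \sum_(t <- s) u t ^+ 2 <= 4 * \sum_(t <- s) y t ^+ 2.
Proof.
move=> h; apply: (@le_trans _ _ (2 * \sum_(t <- s) (y t - u t) ^+ 2 + 2 * \sum_(t <- s) y t ^+ 2)); last by lra.
rewrite !mulr_sumr -big_split/=; apply: ler_sum => t _.
have := sqr_ge0 (2 * y t - u t); nra.
Qed.

Lemma sum_range_le n y lo : (0 < lo)%N -> (lo <= n.+1)%N ->
  \sum_(lo <= t < n.+1) y t ^+ 2 <= \sum_(1 <= t < n.+1) y t ^+ 2.
Proof.
move=> l0 ln; rewrite [leRHS](big_cat_nat (n := lo))//= lerDr sumr_ge0// => t _.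
exact: sqr_ge0.
Qed.

Lemma ls1_normal n y (phi : 'I_1 -> R) : is_least_squares n y phi ->
  phi ord0 * \sum_(2 <= t < n.+1) y (t - 1)%N * y (t - 1)%N = \sum_(2 <= t < n.+1) y t * y (t - 1)%N.
Proof.
move=> ls.
have := @normal_equation (index_iota 2 n.+1) (fun t => y t - phi ord0 * y (t - 1)%N) (fun t => y (t - 1)%N).
have h0 h : \sum_(2 <= t < n.+1) (y t - phi ord0 * y (t - 1)%N) ^+ 2 <=
    \sum_(2 <= t < n.+1) (y t - phi ord0 * y (t - 1)%N - h * y (t - 1)%N) ^+ 2.
  have := ls (fun=> phi ord0 + h); rewrite !rss1E => h1; apply: le_trans h1 _.
  rewrite le_eqVlt; apply/orP; left; apply/eqP; apply: eq_bigr => t _; ring.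
move=> /(_ h0) e; apply/eqP; rewrite eq_sym -subr_eq0 -[X in _ == X]e mulr_sumr -sumrB.
by apply/eqP; apply: eq_bigr => t _; ring.
Qed.

Lemma ls2_normal n y (phi : 'I_2 -> R) : is_least_squares n y phi ->
  phi ord0 * \sum_(3 <= t < n.+1) y (t - 1)%N * y (t - 1)%N +
  phi ord_max * \sum_(3 <= t < n.+1) y (t - 1)%N * y (t - 2)%N = \sum_(3 <= t < n.+1) y t * y (t - 1)%N /\
  phi ord0 * \sum_(3 <= t < n.+1) y (t - 1)%N * y (t - 2)%N +
  phi ord_max * \sum_(3 <= t < n.+1) y (t - 2)%N * y (t - 2)%N = \sum_(3 <= t < n.+1) y t * y (t - 2)%N.
Proof.
move=> ls.
pose e t := y t - (phi ord0 * y (t - 1)%N + phi ord_max * y (t - 2)%N).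
have n0 : (ord_max == ord0 :> 'I_2) = false by [].
split.
- have h0 h : \sum_(3 <= t < n.+1) e t ^+ 2 <= \sum_(3 <= t < n.+1) (e t - h * y (t - 1)%N) ^+ 2.
    have := ls (fun j => phi j + (if j == ord0 then h else 0)); rewrite !rss2E eqxx n0 => h1; apply: le_trans h1 _.
    rewrite le_eqVlt; apply/orP; left; apply/eqP; apply: eq_bigr => t _; rewrite /e; ring.
  have := normal_equation h0 => e0.
  apply/eqP; rewrite eq_sym -subr_eq0 -[X in _ == X]e0 !mulr_sumr -big_split/= -sumrB.
  by apply/eqP; apply: eq_bigr => t _; rewrite /e; ring.
- have h0 h : \sum_(3 <= t < n.+1) e t ^+ 2 <= \sum_(3 <= t < n.+1) (e t - h * y (t - 2)%N) ^+ 2.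
    have := ls (fun j => phi j + (if j == ord0 then 0 else h)); rewrite !rss2E eqxx n0 => h1; apply: le_trans h1 _.
    rewrite le_eqVlt; apply/orP; left; apply/eqP; apply: eq_bigr => t _; rewrite /e; ring.
  have := normal_equation h0 => e0.
  apply/eqP; rewrite eq_sym -subr_eq0 -[X in _ == X]e0 !mulr_sumr -big_split/= -sumrB.
  by apply/eqP; apply: eq_bigr => t _; rewrite /e; ring.
Qed.

(** Comparison with the zero coefficient. The bound is put in the two-coefficient form of
    [regression_bound], with second coefficient 0, so that both orders share the moment estimate. *)
Lemma ls1_fitted n y (phi : 'I_1 -> R) : (3 <= n)%N -> is_least_squares n y phi ->
  \sum_(1 <= k < n.-1) (phi ord0 * y k.+1 + 0 * y k) ^+ 2 <= 4 * \sum_(1 <= t < n.+1) y t ^+ 2.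
Proof.
move=> n3 ls; have := ls (fun=> 0); rewrite !rss1E.
under [leRHS]eq_bigr do rewrite mul0r subr0.
move=> /fitted_bound h.
apply: (@le_trans _ _ (\sum_(2 <= t < n.+1) (phi ord0 * y (t - 1)%N) ^+ 2)).
  rewrite [leRHS]big_add1 /= [leRHS]big_ltn; last by lia.
  rewrite [X in _ <= _ + X](_ : _ = \sum_(1 <= k < n.-1) (phi ord0 * y k.+1 + 0 * y k) ^+ 2).
    by rewrite lerDr sqr_ge0.
  rewrite big_add1; apply: eq_bigr => k _; rewrite subn1/=; ring.
apply: le_trans h _; rewrite ler_wpM2l//; apply: sum_range_le => //; lia.
Qed.

Lemma ls2_fitted n y (phi : 'I_2 -> R) : (3 <= n)%N -> is_least_squares n y phi ->
  \sum_(1 <= k < n.-1) (phi ord0 * y k.+1 + phi ord_max * y k) ^+ 2 <= 4 * \sum_(1 <= t < n.+1) y t ^+ 2.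
Proof.
move=> n3 ls; have := ls (fun=> 0); rewrite !rss2E.
under [leRHS]eq_bigr do rewrite !mul0r addr0 subr0.
move=> /fitted_bound h.
apply: (@le_trans _ _ (\sum_(3 <= t < n.+1) (phi ord0 * y (t - 1)%N + phi ord_max * y (t - 2)%N) ^+ 2)).
  rewrite [leRHS]big_add1 /= [leRHS]big_add1.
  rewrite le_eqVlt; apply/orP; left; apply/eqP; apply: eq_bigr => k _.
  by rewrite subn1 subn2.
apply: le_trans h _; rewrite ler_wpM2l//; apply: sum_range_le => //; lia.
Qed.

Lemma burg1_le1 n y : `|burg1 n y| <= 1.
Proof.
rewrite /burg1; set A := \sum_(2 <= t < n.+1) _; set D := \sum_(2 <= t < n.+1) _.
have D0 : 0 <= D by apply: sumr_ge0 => t _; rewrite addr_ge0// sqr_ge0.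
have AD : `|2 * A| <= D.
  rewrite ler_norml; apply/andP; split.
    rewrite -subr_ge0 opprK /A mulr_sumr -big_split/=; apply: sumr_ge0 => t _.
    have := sqr_ge0 (y t + y t.-1); lra.
  rewrite -subr_ge0 /A mulr_sumr -sumrB/=; apply: sumr_ge0 => t _.
  have := sqr_ge0 (y t - y t.-1); lra.
have [->|Dnz] := eqVneq D 0; first by rewrite invr0 mulr0 normr0.
by rewrite normrM normfV [`|D|]ger0_norm// ler_pdivrMr ?mul1r// lt_neqAle eq_sym Dnz.
Qed.

(** Numerator and denominator are averages of squares: of D (y_t - y_(t-2)), and of the residuals D
    y_t - 2 F y_(t-1) and D y_(t-2) - 2 F y_(t-1). The former is the difference of the two
    residuals, so the quotient lies in [0, 2]; and |2 F / D| <= 1 as for order one. Zero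
    denominators give quotient 0. *)
Lemma burg2_bound n y : `|(burg2 n y).2| <= 1 /\ `|(burg2 n y).1| <= 2.
Proof.
rewrite /burg2 /=.
set D := n.-1%:R^-1 * \sum_(2 <= t < n.+1) (y t ^+ 2 + _).
set F := n.-1%:R^-1 * _.
set C := n.-2%:R^-1 * _. set E := n.-2%:R^-1 * \sum_(3 <= t < n.+1) y t * y t.-2.
set G := n.-2%:R^-1 * _. set H := n.-2%:R^-1 * _.
set num := C * D ^+ 2 - _. set den := C * D ^+ 2 + _ - _.
have i2 : 0 <= n.-2%:R^-1 :> R by rewrite invr_ge0.
have i1 : 0 <= n.-1%:R^-1 :> R by rewrite invr_ge0.
have numE : num = n.-2%:R^-1 * \sum_(3 <= t < n.+1) (D * y t - D * y t.-2) ^+ 2.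
  rewrite /num /C /E (_ : _ - _ = n.-2%:R^-1 * (D ^+ 2 * \sum_(3 <= t < n.+1) (y t ^+ 2 + y t.-2 ^+ 2)
    - 2 * D ^+ 2 * \sum_(3 <= t < n.+1) y t * y t.-2)); last by ring.
  by congr (_ * _); rewrite !mulr_sumr -sumrB; apply: eq_bigr => t _; ring.
have denE : den = n.-2%:R^-1 * \sum_(3 <= t < n.+1)
    ((D * y t - 2 * F * y t.-1) ^+ 2 + (D * y t.-2 - 2 * F * y t.-1) ^+ 2).
  rewrite /den /C /G /H (_ : _ - _ = n.-2%:R^-1 * (D ^+ 2 * \sum_(3 <= t < n.+1) (y t ^+ 2 + y t.-2 ^+ 2)
    + 8 * F ^+ 2 * \sum_(3 <= t < n.+1) y t.-1 ^+ 2
    - 4 * F * D * \sum_(3 <= t < n.+1) (y t * y t.-1 + y t.-2 * y t.-1))); last by ring.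
  by congr (_ * _); rewrite !mulr_sumr -big_split/= -sumrB; apply: eq_bigr => t _; ring.
have num0 : 0 <= num.
  by rewrite numE mulr_ge0// sumr_ge0// => t _; exact: sqr_ge0.
have den0 : 0 <= den.
  by rewrite denE mulr_ge0// sumr_ge0// => t _; rewrite addr_ge0// sqr_ge0.
have nd : num <= 2 * den.
  rewrite numE denE mulrCA ler_wpM2l// mulr_sumr; apply: ler_sum => t _.
  have := sqr_ge0 ((D * y t - 2 * F * y t.-1) + (D * y t.-2 - 2 * F * y t.-1)); nra.
have r0 : 0 <= num / den by rewrite divr_ge0.
have r2 : num / den <= 2.
  have [->|dnz] := eqVneq den 0; first by rewrite invr0 mulr0.
  by rewrite ler_pdivrMr// lt_neqAle eq_sym dnz.
have D0 : 0 <= D.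
  by rewrite mulr_ge0// sumr_ge0// => t _; rewrite addr_ge0// sqr_ge0.
have FD : `|2 * F| <= D.
  rewrite /F mulrCA /D normrM ger0_norm// ler_wpM2l//.
  rewrite ler_norml; apply/andP; split.
    rewrite -subr_ge0 opprK mulr_sumr -big_split/=; apply: sumr_ge0 => t _.
    have := sqr_ge0 (y t + y t.-1); lra.
  rewrite -subr_ge0 mulr_sumr -sumrB/=; apply: sumr_ge0 => t _.
  have := sqr_ge0 (y t - y t.-1); lra.
have FD1 : `|2 * F / D| <= 1.
  have [->|Dnz] := eqVneq D 0; first by rewrite invr0 mulr0 normr0.
  by rewrite normrM normfV [`|D|]ger0_norm// ler_pdivrMr ?mul1r// lt_neqAle eq_sym Dnz.
split; first by rewrite ler_norml; apply/andP; split; lra.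
rewrite opprB addrCA subrr addr0 normrM -[leRHS]mul1r ler_pM//.
by rewrite ger0_norm.
Qed.

End Estimators.

Section JetBias.
Context (d : measure_display) (T : measurableType d) (R : realType).
Variable P : probability T R.
Implicit Types (X Y : nat -> T -> R) (Z : nat -> T -> R).

Lemma ev_mono N0 N1 Z Q : (N0 <= N1)%N -> ev N0 Z Q -> ev N1 Z Q.
Proof. by move=> N01 [C C0 HQ]; exists C => // n w n1; exact/HQ/(leq_trans N01). Qed.

Lemma jet_mono N0 N1 Z X c U l : (N0 <= N1)%N -> jet P N0 Z X c U l -> jet P N1 Z X c U l.
Proof.
move=> N01 [W [mW [CW gW] lW [CO CO0 oW]]]; exists W; split => //.
  by exists CW => n w n1; exact/gW/(leq_trans N01).
by exists CO => //; exact: ev_mono oW.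
Qed.

(** The two expansions of [Y] may have different linear parts [U] and [U']. Their difference is
    absorbed in the quadratic part, by taking W - W1 + W2 for [X]. *)
Lemma samejet_trans N0 Z inL c X Y V : (forall n w, 0 <= Z n w) ->
  samejet P N0 Z inL c X Y -> samejet P N0 Z inL c Y V -> samejet P N0 Z inL c X V.
Proof.
move=> Z0 [U [l [LU jX jY]]] [U' [l' [LU' jY' jV]]]; exists U', l'; split => //.
move: jX jY jY' => [W [mW gW lW oW]] [W1 [mW1 gW1 lW1 oW1]] [W2 [mW2 gW2 lW2 oW2]].
exists (fun n w => W n w + (-1) * W1 n w + W2 n w); split.
- by move=> n; apply: momD => //; apply: momD => //; exact: momZ.
- by apply: globO2D => //; apply: globO2D => //; exact: globO2Z.
- rewrite (_ : (fun _ => _) = (fun n => n%:R * Ex P (W n) + (-1) * (n%:R * Ex P (W1 n)) + n%:R * Ex P (W2 n))).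
    rewrite (_ : l' = l + (-1) * l + l'); last by ring.
    by apply: cvgD => //; apply: cvgD => //; exact: cvgMl_tmp.
  apply/funext => n; rewrite !ExD ?ExZ; [by ring|..]; try exact: mom_int.
    by apply: int1Z; exact: mom_int.
  by apply: int1D; [exact: mom_int|apply: int1Z; exact: mom_int].
- apply: (eq_bigOZ Z0 _ (bigOZD Z0 (bigOZD Z0 oW (bigOZN oW1)) oW2)) => n w; ring.
Qed.

Definition sixth_moment_On3 N0 (f : nat -> T -> R) := exists2 C, 0 <= C & forall n, (N0 <= n)%N ->
  int1 P (fun w => `|f n w| ^+ 6) /\ Ex P (fun w => `|f n w| ^+ 6) <= C * n%:R ^+ 3.

Lemma bounded_sixth_moment N0 (f : nat -> T -> R) B : (0 < N0)%N ->
  (forall n, measurable_fun setT (f n)) -> (forall n w, `|f n w| <= B) -> sixth_moment_On3 N0 f.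
Proof.
move=> N00 mf fB; exists (`|B| ^+ 6) => [|n n0]; first by rewrite exprn_ge0.
have i6 : int1 P (fun w => `|f n w| ^+ 6).
  apply: (int1_le _ (int1_cst P (`|B| ^+ 6))).
    by apply: measurable_funX; exact: measurableT_comp.
  move=> w; rewrite normrX normr_id lerXn2r ?nnegrE//.
  by apply: le_trans (fB n w) _; exact: ler_norm.
split => //; apply: (@le_trans _ _ (`|B| ^+ 6)); last first.
  rewrite ler_peMr ?exprn_ge0// exprn_ege1// ler1n; lia.
rewrite -[leRHS](Ex_cst P); apply: Ex_le => //; first exact: int1_cst.
move=> w; rewrite lerXn2r ?nnegrE//.
by apply: le_trans (fB n w) _; exact: ler_norm.
Qed.

End JetBias.

Section LeastSquaresMoment.
Context (d : measure_display) (T : measurableType d) (R : realType).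
Variable P : probability T R.
Variables (x : int -> T -> R) (F : int -> set (set T)) (f1 f2 K : R).
Hypothesis H : AR2 P x F f1 f2 K.
Local Notation E := (Ex P).

Let mx t : mom P (x t) := ar2_mom H t.

Let amgm3 (s b e : R) : 0 <= s -> 0 <= b -> 0 <= e -> s * b * e <= s ^+ 3 + b ^+ 3 + e ^+ 3.
Proof.
move=> s0 b0 e0; have [s3 b3 e3] : [/\ 0 <= s ^+ 3, 0 <= b ^+ 3 & 0 <= e ^+ 3] by split; rewrite exprn_ge0.
have h : 0 <= (s + b + e) * ((s - b) ^+ 2 + (b - e) ^+ 2 + (s - e) ^+ 2).
  by apply: mulr_ge0; [lra|apply: addr_ge0; [apply: addr_ge0|]; exact: sqr_ge0].
have -> : s * b * e = (s ^+ 3 + b ^+ 3 + e ^+ 3) / 3 -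
  (s + b + e) * ((s - b) ^+ 2 + (b - e) ^+ 2 + (s - e) ^+ 2) / 6 by field.
lra.
Qed.

Lemma sumsq_moment : exists2 B : R, 0 <= B & forall n, (0 < n)%N ->
  E (fun w => (n%:R^-1 * \sum_(1 <= t < n.+1) x t%:Z w ^+ 2) ^+ 9) <= B.
Proof.
have [B B0 HB] := ar2_moments H 9; exists B => // -[//|n] _.
have m9 t : mom P (fun w => (x t w ^+ 2) ^+ 9) by apply: momX; exact: momX.
have h9 t : E (fun w => (x t w ^+ 2) ^+ 9) <= B.
  rewrite (@eq_Ex _ _ _ _ _ (fun w => `|x t w| ^+ (2 * 9))); first by case: (HB t).
  by move=> w; rewrite exprM -normrX ger0_norm// sqr_ge0.
apply: le_trans (_ : E (fun w => n.+1%:R^-1 * \sum_(1 <= t < n.+2) (x t%:Z w ^+ 2) ^+ 9) <= _).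
  apply: Ex_le.
  - apply: mom_int; apply: momX; apply: momZ; apply: mom_sum => t _; exact: momX.
  - apply: mom_int; apply: momZ; exact: mom_sum.
  - move=> w; apply: expr_mean => t; exact: sqr_ge0.
rewrite ExZ; last by apply: mom_int; exact: mom_sum.
rewrite Ex_sum//; apply: (@le_trans _ _ (n.+1%:R^-1 * \sum_(1 <= t < n.+2) B)).
  by rewrite ler_wpM2l ?invr_ge0//; apply: ler_sum => t _; exact: h9.
by rewrite sumr_const_nat subn1/= -[B *+ n.+1]mulr_natl mulKf// pnatr_eq0.
Qed.

(** Write the sum of squares as n s. The cube of f^2 <= 8 n s b / d is at most 8^3 n^3 times (s^9 +
    b^9 + d^-9), and these three moments are bounded uniformly in n; this is where the parameter 9
    of [detsum] comes from. *)
Lemma ls_sixth_moment (f : nat -> T -> R) N0 : (0 < N0)%N ->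
  (forall n, measurable_fun setT (f n)) ->
  (forall n, (N0 <= n)%N -> {ae P, forall w, f n w ^+ 2 * detsum x 9 w <=
     8 * blocksum x 9 w * \sum_(1 <= t < n.+1) x t%:Z w ^+ 2}) ->
  sixth_moment_On3 P N0 f.
Proof.
move=> N00 mf hf.
have [B B0 HB] := sumsq_moment.
have [C C0 [iD ED]] := detsum_inv_moment H 9.
have mb : mom P (fun w => blocksum x 9 w ^+ 9) by apply: momX; exact: mom_blocksum H 9.
have b0 w : 0 <= blocksum x 9 w.
  by apply: sumr_ge0 => i _; do 3?apply: addr_ge0; exact: sqr_ge0.
have Eb0 : 0 <= E (fun w => blocksum x 9 w ^+ 9) by apply: Ex_ge0 => w; rewrite exprn_ge0.
exists (8 ^+ 3 * (B + E (fun w => blocksum x 9 w ^+ 9) + C)) => [|n n0].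
  by rewrite mulr_ge0 ?exprn_ge0 ?addr_ge0.
have np : (0 < n)%N by apply: leq_trans n0.
pose s w := n%:R^-1 * \sum_(1 <= t < n.+1) x t%:Z w ^+ 2.
have s0 w : 0 <= s w by rewrite mulr_ge0 ?invr_ge0// sumr_ge0// => t _; exact: sqr_ge0.
have ms : mom P (fun w => s w ^+ 9).
  by apply: momX; apply: momZ; apply: mom_sum => t _; exact: momX.
pose G w := 8 ^+ 3 * n%:R ^+ 3 * (s w ^+ 9 + blocksum x 9 w ^+ 9 + (detsum x 9 w)^-1 ^+ 9).
have iG : int1 P G by apply: int1Z; apply: int1D iD; apply: int1D; exact: mom_int.
have n30 : 0 <= 8 ^+ 3 * n%:R ^+ 3 :> R by rewrite mulr_ge0 ?exprn_ge0.
have EG : E G <= 8 ^+ 3 * (B + E (fun w => blocksum x 9 w ^+ 9) + C) * n%:R ^+ 3.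
  rewrite ExZ; last by apply: int1D iD; apply: int1D; exact: mom_int.
  rewrite ExD//; last by apply: int1D; exact: mom_int.
  rewrite ExD; [|exact: mom_int..].
  rewrite [leRHS]mulrAC ler_wpM2l//; have := HB n np; rewrite -/s; lra.
have G0 w : 0 <= G w.
  by rewrite mulr_ge0// !addr_ge0// exprn_ge0// invr_ge0 detsum_ge0.
have m6 : measurable_fun setT (fun w => `|f n w| ^+ 6).
  by apply: measurable_funX; exact: measurableT_comp.
suff : (\int[P]_w (`|f n w| ^+ 6)%:E <= (E G)%:E)%E.
  move=> /(int1_of_bound m6)[|? ?]; first by move=> w; rewrite exprn_ge0.
  by split => //; apply: le_trans EG.
rewrite Ex_fin//; apply: ae_ge0_le_integral => //.
- exact/measurable_EFinP.
- by move=> w _; rewrite lee_fin.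
- exact/measurable_EFinP/(int1_meas iG).
apply: filterS2 (hf n n0) (detsum_neq0 H 9) => w h dn _; rewrite lee_fin.
have d0 : 0 < detsum x 9 w by rewrite lt_neqAle eq_sym dn detsum_ge0.
have i0 : 0 <= (detsum x 9 w)^-1 by rewrite invr_ge0 ltW.
have h2 : f n w ^+ 2 <= 8 * n%:R * (s w * blocksum x 9 w * (detsum x 9 w)^-1).
  rewrite !mulrA ler_pdivlMr//; apply: le_trans h _.
  rewrite le_eqVlt; apply/orP; left; apply/eqP; rewrite /s.
  have : n%:R != 0 :> R by rewrite pnatr_eq0 -lt0n.
  by move=> ?; field.
have -> : `|f n w| ^+ 6 = (f n w ^+ 2) ^+ 3.
  by rewrite -[f n w ^+ 2]ger0_norm ?sqr_ge0// normrX -exprM.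
apply: (@le_trans _ _ ((8 * n%:R * (s w * blocksum x 9 w * (detsum x 9 w)^-1)) ^+ 3)).
  rewrite lerXn2r ?nnegrE ?sqr_ge0//.
  by apply: mulr_ge0 => //; apply: mulr_ge0 => //; exact: mulr_ge0.
rewrite exprMn (_ : (8 * n%:R) ^+ 3 = 8 ^+ 3 * n%:R ^+ 3 :> R); last by rewrite exprMn.
have e9 (u : R) : u ^+ 9 = (u ^+ 3) ^+ 3 by rewrite -exprM.
rewrite ler_wpM2l// !e9 [leLHS]exprMn [X in X * _ <= _]exprMn.
by apply: amgm3; apply: exprn_ge0.
Qed.

End LeastSquaresMoment.

(** * Closed formulas and the common expansion *)

Section Formulas.
Variable R : realType.

Definition burg_formula (C D E F G H : R) : R * R :=
  let phi2 := 1 - (C * D ^+ 2 - 2 * E * D ^+ 2) / (C * D ^+ 2 + 8 * F ^+ 2 * G - 4 * F * H * D) in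
  (2 * F / D * (1 - phi2), phi2).

(* Cramer's rule for the normal equations A t1 + C t2 = b1, C t1 + B t2 = b2. *)
Definition cramer_formula (A B C b1 b2 : R) : R * R :=
  ((B * b1 - C * b2) / (A * B - C ^+ 2), (A * b2 - C * b1) / (A * B - C ^+ 2)).

(* When all averages of the same lag agree, both estimators become the
   Yule-Walker estimator. *)
Lemma burg_cramer (r0 r1 r2 : R) : r0 != 0 -> r0 * r0 - r1 ^+ 2 != 0 ->
  burg_formula (r0 + r0) (r0 + r0) r2 r1 r0 (r1 + r1) = cramer_formula r0 r0 r1 r1 r2.
Proof.
move=> h0 h; rewrite /burg_formula /cramer_formula.
have -> : (r0 + r0) * (r0 + r0) ^+ 2 + 8 * r1 ^+ 2 * r0 - 4 * r1 * (r1 + r1) * (r0 + r0) =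
  8 * r0 * (r0 * r0 - r1 ^+ 2) by ring.
have d2 : r0 + r0 != 0 by rewrite -mulr2n mulrn_eq0.
by congr (_, _); field; rewrite ?h0 ?h ?d2.
Qed.

Lemma cramer_solve (A B C b1 b2 t1 t2 : R) : A * B - C ^+ 2 != 0 ->
  t1 * A + t2 * C = b1 -> t1 * C + t2 * B = b2 -> cramer_formula A B C b1 b2 = (t1, t2).
Proof. by move=> h <- <-; rewrite /cramer_formula; congr (_, _); field. Qed.

Lemma burg_denominator (r0 r1 : R) : r0 != 0 -> r0 * r0 - r1 ^+ 2 != 0 ->
  (r0 + r0) * (r0 + r0) ^+ 2 + 8 * r1 ^+ 2 * r0 - 4 * r1 * (r1 + r1) * (r0 + r0) != 0.
Proof.
move=> h0 h; have -> : (r0 + r0) * (r0 + r0) ^+ 2 + 8 * r1 ^+ 2 * r0 - 4 * r1 * (r1 + r1) * (r0 + r0) =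
  8 * r0 * (r0 * r0 - r1 ^+ 2) by ring.
by rewrite !mulf_neq0// pnatr_eq0.
Qed.

End Formulas.

Section Estimators.
Context (d : measure_display) (T : measurableType d) (R : realType).
Variable P : probability T R.
Variables (x : int -> T -> R) (F : int -> set (set T)) (f1 f2 K : R).
Hypothesis H : AR2 P x F f1 f2 K.
Variable b : R.
Local Notation g := (acov P x).
Local Notation Z := (zscale P x f1 f2).
Local Notation L := (lin_mart P x f1 f2).
Local Notation SJ := (samejet P 8 Z L).
Local Notation y := (ydat x b).
Local Notation av := (avg x b).

Let Z0 := @zscale_ge0 _ _ _ P x f1 f2.
Let L0 := lin_mart0 P x f1 f2.
Let LZ := @lin_martZ _ _ _ P x f1 f2.
Let LD := @lin_martD _ _ _ P x f1 f2.
Let Lle := @lin_mart_le _ _ _ P x f1 f2.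
Let Lmom := @lin_mart_mom _ _ _ P x F f1 f2 K H.
Let Lmean := @lin_mart_mean _ _ _ P x F f1 f2 K H.
Let Lcov := @lin_mart_cov _ _ _ P x F f1 f2 K H.

Let sjD c c' X X' Y Y' (h : SJ c X Y) (h' : SJ c' X' Y') :
  SJ (c + c') (fun n w => X n w + X' n w) (fun n w => Y n w + Y' n w).
Proof. by apply: samejetD. Qed.

Let sjM c c' X X' Y Y' (h : SJ c X Y) (h' : SJ c' X' Y') :
  SJ (c * c') (fun n w => X n w * X' n w) (fun n w => Y n w * Y' n w).
Proof. by apply: samejetM. Qed.

Let sjB c c' X X' Y Y' (h : SJ c X Y) (h' : SJ c' X' Y') :
  SJ (c - c') (fun n w => X n w - X' n w) (fun n w => Y n w - Y' n w).
Proof. by apply: samejetB. Qed.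

Let sjZ k c X Y (h : SJ c X Y) : SJ (k * c) (fun n w => k * X n w) (fun n w => k * Y n w).
Proof. by apply: samejetZ. Qed.

Let sjV c X Y (c0 : c != 0) (h : SJ c X Y) : SJ c^-1 (fun n w => (X n w)^-1) (fun n w => (Y n w)^-1).
Proof. by apply: samejetV. Qed.

Let sj1 k : SJ k (fun _ _ => k) (fun _ _ => k).
Proof. by apply: samejet_cst. Qed.

Let sjX c X Y (h : SJ c X Y) : SJ (c ^+ 2) (fun n w => X n w ^+ 2) (fun n w => Y n w ^+ 2).
Proof. exact: (sjM h h). Qed.

Let sj_near c X Y (h : SJ c X Y) : c != 0 -> ev 8 Z (fun n w => X n w != 0).
Proof. exact: (samejet_near Z0 Lle h). Qed.

Let sjT c X Y V (h : SJ c X Y) (h' : SJ c Y V) : SJ c X V.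
Proof. exact: (samejet_trans Z0 h h'). Qed.

Lemma samejet_burg_formula cC cD cE cF cG cH XC XD XE XF XG XH YC YD YE YF YG YH :
  cD != 0 -> cC * cD ^+ 2 + 8 * cF ^+ 2 * cG - 4 * cF * cH * cD != 0 ->
  SJ cC XC YC -> SJ cD XD YD -> SJ cE XE YE -> SJ cF XF YF -> SJ cG XG YG -> SJ cH XH YH ->
  SJ (burg_formula cC cD cE cF cG cH).1
    (fun n w => (burg_formula (XC n w) (XD n w) (XE n w) (XF n w) (XG n w) (XH n w)).1)
    (fun n w => (burg_formula (YC n w) (YD n w) (YE n w) (YF n w) (YG n w) (YH n w)).1) /\
  SJ (burg_formula cC cD cE cF cG cH).2
    (fun n w => (burg_formula (XC n w) (XD n w) (XE n w) (XF n w) (XG n w) (XH n w)).2)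
    (fun n w => (burg_formula (YC n w) (YD n w) (YE n w) (YF n w) (YG n w) (YH n w)).2).
Proof.
move=> D0 den0 hC hD hE hF hG hH.
have hnum := sjB (sjM hC (sjX hD)) (sjM (sjZ 2 hE) (sjX hD)).
have hden := sjB (sjD (sjM hC (sjX hD)) (sjM (sjZ 8 (sjX hF)) hG)) (sjM (sjM (sjZ 4 hF) hH) hD).
have h2 := sjB (sj1 1) (sjM hnum (sjV den0 hden)).
split; last exact: h2.
exact: sjM (sjM (sjZ 2 hF) (sjV D0 hD)) (sjB (sj1 1) h2).
Qed.

Lemma samejet_cramer_formula cA cB cC c1 c2 XA XB XC X1 X2 YA YB YC Y1 Y2 :
  cA * cB - cC ^+ 2 != 0 ->
  SJ cA XA YA -> SJ cB XB YB -> SJ cC XC YC -> SJ c1 X1 Y1 -> SJ c2 X2 Y2 ->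
  SJ (cramer_formula cA cB cC c1 c2).1
    (fun n w => (cramer_formula (XA n w) (XB n w) (XC n w) (X1 n w) (X2 n w)).1)
    (fun n w => (cramer_formula (YA n w) (YB n w) (YC n w) (Y1 n w) (Y2 n w)).1) /\
  SJ (cramer_formula cA cB cC c1 c2).2
    (fun n w => (cramer_formula (XA n w) (XB n w) (XC n w) (X1 n w) (X2 n w)).2)
    (fun n w => (cramer_formula (YA n w) (YB n w) (YC n w) (Y1 n w) (Y2 n w)).2).
Proof.
move=> den0 hA hB hC h1 h2.
have hden := sjV den0 (sjB (sjM hA hB) (sjX hC)).
split; first exact: sjM (sjB (sjM hB h1) (sjM hC h2)) hden.
exact: sjM (sjB (sjM hA h2) (sjM hC h1)) hden.
Qed.

Let g0 : g 0 != 0. Proof. by have [h _] := acov0_gt0 H; rewrite gt_eqF. Qed.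

Let g01 : g 0 * g 0 - g 1 ^+ 2 != 0.
Proof. by have [_ h] := acov0_gt0 H; rewrite -expr2 gt_eqF. Qed.

Lemma cramer_acov : cramer_formula (g 0) (g 0) (g 1) (g 1) (g 2) = (f1, f2).
Proof.
apply: cramer_solve => //; first by rewrite -(yule_walker1 H).
by rewrite -(yule_walker2 H).
Qed.

Let sja lo be lo' be' k : (k < lo)%N -> (k < lo')%N -> (lo + be <= 3)%N -> (lo' + be' <= 3)%N ->
  SJ (g k) (av lo be k) (av lo' be' k).
Proof. exact: (samejet_avg H b). Qed.

Definition burg_avg n w := burg_formula (av 3 0 0 n w + av 1 2 0 n w) (av 2 0 0 n w + av 1 1 0 n w)
  (av 3 0 2 n w) (av 2 0 1 n w) (av 2 1 0 n w) (av 3 0 1 n w + av 2 1 1 n w).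

Definition ls_avg n w := cramer_formula (av 2 1 0 n w) (av 1 2 0 n w) (av 2 1 1 n w)
  (av 3 0 1 n w) (av 3 0 2 n w).

(** Two comparisons through a common middle term. Replacing in each formula the averages of equal
    lag by a single one, r0, r1 or r2, does not change the jet; after the replacement the two
    formulas coincide wherever the denominators are nonzero, that is for small [Z]. *)
Lemma samejet_burg_ls : SJ f1 (fun n w => (burg_avg n w).1) (fun n w => (ls_avg n w).1) /\
  SJ f2 (fun n w => (burg_avg n w).2) (fun n w => (ls_avg n w).2).
Proof.
pose r0 := av 2 1 0; pose r1 := av 3 0 1; pose r2 := av 3 0 2.
have d2 : g 0 + g 0 != 0 by rewrite -mulr2n mulrn_eq0.
have [hb1 hb2] := samejet_burg_formula d2 (burg_denominator g0 g01)
  (sjD (@sja 3 0 2 1 0 isT isT isT isT) (@sja 1 2 2 1 0 isT isT isT isT))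
  (sjD (@sja 2 0 2 1 0 isT isT isT isT) (@sja 1 1 2 1 0 isT isT isT isT))
  (@sja 3 0 3 0 2 isT isT isT isT)
  (@sja 2 0 3 0 1 isT isT isT isT)
  (@sja 2 1 2 1 0 isT isT isT isT)
  (sjD (@sja 3 0 3 0 1 isT isT isT isT) (@sja 2 1 3 0 1 isT isT isT isT)).
have s0 : SJ (g 0) r0 r0 by apply: sja.
have s1 : SJ (g 1) r1 r1 by apply: sja.
have [hc1 hc2] := samejet_cramer_formula g01
  (@sja 2 1 2 1 0 isT isT isT isT)
  (@sja 2 1 1 2 0 isT isT isT isT)
  (@sja 3 0 2 1 1 isT isT isT isT)
  (@sja 3 0 3 0 1 isT isT isT isT)
  (@sja 3 0 3 0 2 isT isT isT isT).
have e := ev_and Z0 (sj_near s0 g0) (sj_near (sjB (sjM s0 s0) (sjX s1)) g01).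
rewrite (burg_cramer _ g0 g01) cramer_acov /= in hb1 hb2.
rewrite cramer_acov /= in hc1 hc2.
have id n w (h : r0 n w != 0 /\ r0 n w * r0 n w - r1 n w ^+ 2 != 0) := burg_cramer (r2 n w) h.1 h.2.
split; [apply: sjT _ hc1|apply: sjT _ hc2].
  apply: (samejet_ext Z0 _ _ hb1); first by exists 1.
  by apply: ev_imp e => n w /id/(congr1 fst).
apply: (samejet_ext Z0 _ _ hb2); first by exists 1.
by apply: ev_imp e => n w /id/(congr1 snd).
Qed.

Lemma samejet_burg1_ls1 : f2 = 0 ->
  SJ f1 (fun n w => 2 * av 2 0 1 n w / (av 2 0 0 n w + av 1 1 0 n w)) (fun n w => av 2 0 1 n w / av 1 1 0 n w).
Proof.
move=> f20; have d2 : g 0 + g 0 != 0 by rewrite -mulr2n mulrn_eq0.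
have s1 : SJ (g 1) (av 2 0 1) (av 2 0 1) by apply: sja.
have s0 : SJ (g 0) (av 1 1 0) (av 1 1 0) by apply: sja.
have s0' : SJ (g 0) (av 2 0 0) (av 1 1 0) by apply: sja.
have h := sjM (sjZ 2 s1) (sjV d2 (sjD s0' s0)).
have e1 : 2 * g 1 * (g 0 + g 0)^-1 = f1.
  by have := yule_walker1 H; rewrite f20 mul0r addr0 => ->; field; rewrite d2.
rewrite e1 in h.
apply: (samejet_ext Z0 _ _ h); first by exists 1.
apply: ev_imp (sj_near s0 g0) => n w h0.
have : av 1 1 0 n w + av 1 1 0 n w != 0 by rewrite -mulr2n mulrn_eq0.
by move=> ?; field; apply/andP.
Qed.

Lemma ls_avg_near : ev 8 Z (fun n w => av 2 1 0 n w * av 1 2 0 n w - av 2 1 1 n w ^+ 2 != 0).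
Proof.
have sa : SJ (g 0) (av 2 1 0) (av 2 1 0) by apply: sja.
have sb : SJ (g 0) (av 1 2 0) (av 1 2 0) by apply: sja.
have sc : SJ (g 1) (av 2 1 1) (av 2 1 1) by apply: sja.
exact: sj_near (sjB (sjM sa sb) (sjX sc)) g01.
Qed.

Lemma ls1_avg_near : ev 8 Z (fun n w => av 1 1 0 n w != 0).
Proof.
have sb : SJ (g 0) (av 1 1 0) (av 1 1 0) by apply: sja.
exact: sj_near sb g0.
Qed.

End Estimators.

(** * Equality of the biases for a centred process *)

Section Bias.
Context (d : measure_display) (T : measurableType d) (R : realType).
Variable P : probability T R.
Variables (x : int -> T -> R) (F : int -> set (set T)) (f1 f2 K : R).
Hypothesis H : AR2 P x F f1 f2 K.
Variable b : R.
Hypothesis b01 : 0 <= b <= 1.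
Local Notation Z := (zscale P x f1 f2).
Local Notation L := (lin_mart P x f1 f2).
Local Notation SJ := (samejet P 8 Z L).
Local Notation y := (ydat x b).
Local Notation av := (avg x b).

Definition same_bias N0 c (f h : nat -> T -> R) :=
  [/\ forall n, (N0 <= n)%N -> int1 P (f n), forall n, (N0 <= n)%N -> int1 P (h n) &
    exists l : R, (n%:R * Ex P (fun w => f n w - c) @[n --> \oo] --> l) /\
      (n%:R * Ex P (fun w => h n w - c) @[n --> \oo] --> l)].

(** The roles of f and h differ: the Burg estimator is given by its formula at every outcome,
    whereas a least squares minimizer is determined only where [Q] holds, that is where the normal
    equations are regular. *)
Lemma samejet_bias N0 c X Y (f h : nat -> T -> R) Q : (8 <= N0)%N -> SJ c X Y ->
  (forall n, measurable_fun setT (f n)) -> (forall n, measurable_fun setT (h n)) ->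
  sixth_moment_On3 P N0 f -> sixth_moment_On3 P N0 h ->
  (forall n w, (N0 <= n)%N -> f n w = X n w) -> ev 8 Z Q ->
  (forall n, (N0 <= n)%N -> {ae P, forall w, Q n w -> h n w = Y n w}) ->
  same_bias N0 c f h.
Proof.
move=> N8 [U [l [LU jX jY]]] mf mh [C C0 f6] [C' C'0 h6] fX [D D0 HQ] hY.
have Z4 : exists2 C : R, 0 <= C & forall n, (N0 <= n)%N ->
    Ex P (fun w => Z n w ^+ 4) <= C / n%:R ^+ 2.
  by have [B B0 HB] := zscale4 H; exists B => // n n0; exact/HB/(leq_trans N8).
have Lle V : L V -> exists C, forall n w, (N0 <= n)%N -> `|V n w| <= C * Z n w.
  by move=> /(@lin_mart_le _ _ _ P)[B HB]; exists B => n w n0; exact/HB/(leq_trans N8).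
have N00 : (0 < N0)%N by apply: leq_trans N8.
have fX' n : (N0 <= n)%N -> {ae P, forall w, 1 * Z n w <= 1 -> f n w = X n w}.
  by move=> n0; apply: aeW => w _; exact: fX.
have [i1 l1] := jet_bias N00 (@zscale_ge0 _ _ _ P x f1 f2) (mom_zscale H) Z4 Lle
  (@lin_mart_mom _ _ _ P x F f1 f2 K H) (@lin_mart_mean _ _ _ P x F f1 f2 K H) LU (jet_mono N8 jX) mf ltr01 fX' C0 f6.
have hY' n : (N0 <= n)%N -> {ae P, forall w, D * Z n w <= 1 -> h n w = Y n w}.
  move=> n0; apply: filterS (hY n n0) => w hw DZ; apply/hw/HQ => //.
  exact: leq_trans n0.
have [i2 l2] := jet_bias N00 (@zscale_ge0 _ _ _ P x f1 f2) (mom_zscale H) Z4 Lle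
  (@lin_mart_mom _ _ _ P x F f1 f2 K H) (@lin_mart_mean _ _ _ P x F f1 f2 K H) LU (jet_mono N8 jY) mh D0 hY' C'0 h6.
by split => //; exists l.
Qed.

Definition ls2_det n w := av 2 1 0 n w * av 1 2 0 n w - av 2 1 1 n w ^+ 2.

(** Reindexing by [be] gives averages of equal [lo + be] the same range and normalization, which is
    the form in which they appear in the estimators. *)
Lemma avg_shift lo be k n w : av lo be k n w = (n - (lo + be).-1)%:R^-1 *
  \sum_(lo + be <= t < n.+1) y n w (t - be) * y n w (t - be - k).
Proof.
by rewrite big_addn; congr (_ * _); apply: eq_bigr => t _; rewrite addnK.
Qed.

Lemma burg2_avg n w : burg2 n (y n w) = burg_avg x b n w.
Proof.
rewrite /burg_avg !avg_shift /= !subn2 !subn1 -[LHS]/(burg_formula _ _ _ _ _ _).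
congr burg_formula; rewrite -?mulrDr -?big_split/=; congr (_ * _); apply: eq_bigr => t _;
  by rewrite !(subn0, subn1, subn2) ?(mulrC (y n w t.-2)).
Qed.

Lemma burg1_avg n w : (2 <= n)%N ->
  burg1 n (y n w) = 2 * av 2 0 1 n w / (av 2 0 0 n w + av 1 1 0 n w).
Proof.
move=> n2; have n0 : n.-1%:R != 0 :> R by rewrite pnatr_eq0 -lt0n; lia.
rewrite !avg_shift /= !subn1 -mulrDr -big_split/= invfM invrK mulrCA mulrA.
rewrite mulrCA mulVKf//; congr (2 * _ / _).
  by apply: eq_bigr => t _; rewrite !(subn0, subn1).
by apply: eq_bigr => t _; rewrite !(subn0, subn1).
Qed.

Lemma ls2_avg n w (phi : 'I_2 -> R) : ls2_det n w != 0 -> is_least_squares n (y n w) phi ->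
  ls_avg x b n w = (phi ord0, phi ord_max).
Proof.
move=> dn /ls2_normal[e1 e2]; apply: cramer_solve => //.
- transitivity (n.-2%:R^-1 * \sum_(3 <= t < n.+1) y n w t * y n w (t - 1)%N).
    rewrite -e1 mulrDr; congr (_ + _); rewrite [RHS]mulrCA; congr (_ * _); rewrite avg_shift/= subn2;
    by congr (_ * _); apply: eq_bigr => t _; rewrite ?subn0 -?subnDA.
  by rewrite avg_shift/= subn2; congr (_ * _); apply: eq_bigr => t _; rewrite subn0.
- transitivity (n.-2%:R^-1 * \sum_(3 <= t < n.+1) y n w t * y n w (t - 2)%N).
    rewrite -e2 mulrDr; congr (_ + _); rewrite [RHS]mulrCA; congr (_ * _); rewrite avg_shift/= subn2;
    by congr (_ * _); apply: eq_bigr => t _; rewrite ?subn0 -?subnDA.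
  by rewrite avg_shift/= subn2; congr (_ * _); apply: eq_bigr => t _; rewrite subn0.
Qed.

Lemma ls1_avg n w (phi : 'I_1 -> R) : av 1 1 0 n w != 0 -> is_least_squares n (y n w) phi ->
  av 2 0 1 n w / av 1 1 0 n w = phi ord0.
Proof.
move=> dn /ls1_normal e1; apply: (canLR (mulfK dn)).
rewrite !avg_shift /= !subn1 mulrCA; congr (_ * _).
rewrite -[LHS](_ : \sum_(2 <= t < n.+1) y n w t * y n w (t - 1)%N = _); last first.
  by apply: eq_bigr => t _; rewrite subn0.
by rewrite -e1; congr (_ * _); apply: eq_bigr => t _; rewrite subn0.
Qed.

Lemma sumsq_ydat n w : (0 < n)%N ->
  \sum_(1 <= t < n.+1) y n w t ^+ 2 <= \sum_(1 <= t < n.+1) x t%:Z w ^+ 2.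
Proof.
move=> n0; set m := xbar x n w.
have sm : \sum_(1 <= t < n.+1) x t%:Z w = n%:R * m by rewrite mulVKf// pnatr_eq0 -lt0n.
rewrite -subr_ge0 -sumrB.
(* Subtracting b times the mean lowers the sum of squares by n m^2 b (2 - b), so the moment bound
   for [x] covers demeaned data too. *)
have -> : \sum_(1 <= t < n.+1) (x t%:Z w ^+ 2 - y n w t ^+ 2) = n%:R * (m ^+ 2 * (b * (2 - b))).
  transitivity (2 * b * m * \sum_(1 <= t < n.+1) x t%:Z w - \sum_(1 <= t < n.+1) (b * m) ^+ 2).
    rewrite mulr_sumr -sumrB; apply: eq_bigr => t _; rewrite /ydat -/m; ring.
  rewrite sm sumr_const_nat subn1/= -[_ *+ n]mulr_natl; ring.
have [b0 b1] := andP b01.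
by apply: mulr_ge0 => //; apply: mulr_ge0; [exact: sqr_ge0|apply: mulr_ge0; lra].
Qed.

(* 164 = 4 m + 4 with the m = 40 blocks of detsum x 9 (regression_bound). *)
Lemma ls_coefficient_bound n w th1 th2 th : (164 <= n)%N ->
  \sum_(1 <= k < n.-1) (th1 * y n w k.+1 + th2 * y n w k) ^+ 2 <=
    4 * \sum_(1 <= t < n.+1) y n w t ^+ 2 ->
  (th == th1) || (th == th2) ->
  th ^+ 2 * detsum x 9 w <= 8 * blocksum x 9 w * \sum_(1 <= t < n.+1) x t%:Z w ^+ 2.
Proof.
move=> n0 hS hth; have n4 : (4 * (4 * 10) + 4 <= n)%N by [].
have difE t : xdif x w t.+1 = y n w t.+1 - y n w t.
  by rewrite /xdif /ydat (_ : t.+1%:Z - 1 = t%:Z); [ring|lia].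
apply: le_trans (regression_bound n4 difE hS hth) _.
rewrite ler_wpM2l ?sumsq_ydat//; last by lia.
apply: mulr_ge0 => //; apply: sumr_ge0 => i _; do 3?apply: addr_ge0; exact: sqr_ge0.
Qed.

Lemma measurable_ydat n t : measurable_fun setT (fun w => y n w t).
Proof.
have mx s := mom_meas (ar2_mom H s).
apply: measurable_funB => //; apply: measurable_funM => //; apply: measurable_funM => //.
exact: measurable_sum.
Qed.

Ltac meas := repeat first [ solve [auto] | exact: measurable_cst
  | apply: measurable_funB | apply: measurable_funD | apply: measurable_funX
  | apply: measurable_funM | apply: measurable_sum => ? | apply: (measurableT_comp (@measurable_inv _)) ].

Lemma measurable_burg1 n : measurable_fun setT (fun w => burg1 n (y n w)).
Proof. by have my := measurable_ydat n; rewrite /burg1; meas. Qed.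

Lemma measurable_avg lo be k n : measurable_fun setT (av lo be k n).
Proof. by have my := measurable_ydat n; rewrite /avg; meas. Qed.

Lemma measurable_burg_formula (C D E F' G I : T -> R) :
  measurable_fun setT C -> measurable_fun setT D -> measurable_fun setT E ->
  measurable_fun setT F' -> measurable_fun setT G -> measurable_fun setT I ->
  measurable_fun setT (fun w => (burg_formula (C w) (D w) (E w) (F' w) (G w) (I w)).1) /\
  measurable_fun setT (fun w => (burg_formula (C w) (D w) (E w) (F' w) (G w) (I w)).2).
Proof.
move=> mC mD mE mF mG mI.
have m2 : measurable_fun setT (fun w => (burg_formula (C w) (D w) (E w) (F' w) (G w) (I w)).2).
  by rewrite /burg_formula /=; meas.
by split => //; apply: measurable_funM; [meas|exact: measurable_funB (measurable_cst _) m2].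
Qed.

Lemma measurable_burg2 n : measurable_fun setT (fun w => (burg2 n (y n w)).1) /\
  measurable_fun setT (fun w => (burg2 n (y n w)).2).
Proof.
under eq_fun do rewrite burg2_avg; under [X in _ /\ measurable_fun _ X]eq_fun do rewrite burg2_avg.
have mavD lo be lo' be' k := measurable_funD (measurable_avg lo be k n) (measurable_avg lo' be' k n).
have mavD1 := measurable_funD (measurable_avg 3 0 1 n) (measurable_avg 2 1 1 n).
exact: (measurable_burg_formula (mavD _ _ _ _ _) (mavD _ _ _ _ _) (measurable_avg _ _ _ _)
  (measurable_avg _ _ _ _) (measurable_avg _ _ _ _) mavD1).
Qed.

Lemma same_bias2 (h : nat -> 'I_2 -> T -> R) : (forall n j, measurable_fun setT (h n j)) ->
  (forall n, (164 <= n)%N -> {ae P, forall w, is_least_squares n (y n w) (fun j => h n j w)}) ->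
  same_bias 164 f1 (fun n w => (burg2 n (y n w)).1) (fun n => h n ord0) /\
  same_bias 164 f2 (fun n w => (burg2 n (y n w)).2) (fun n => h n ord_max).
Proof.
move=> mh hls; have [s1 s2] := samejet_burg_ls H b.
have h6 j : sixth_moment_On3 P 164 (h ^~ j).
  apply: (ls_sixth_moment H) => // n n0; apply: filterS (hls n n0) => w ls.
  have n3 : (3 <= n)%N by apply: leq_trans n0.
  apply: (ls_coefficient_bound n0 (ls2_fitted n3 ls)).
  case: j => -[|[|//]] j2; apply/orP; [left|right]; apply/eqP; congr (h n _ w); exact: val_inj.
have e := ls_avg_near H b.
split.
- apply: (samejet_bias (Q := fun n w => ls2_det n w != 0) _ s1 _ _ _ _ _ e) => //.
  + by move=> n; case: (measurable_burg2 n).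
  + apply: (@bounded_sixth_moment _ _ _ _ _ _ 2) => // [n|n w].
      by case: (measurable_burg2 n).
    by case: (burg2_bound n (y n w)).
  + by move=> n w n0; rewrite burg2_avg.
  + by move=> n n0; apply: filterS (hls n n0) => w ls dn; rewrite (ls2_avg dn ls).
- apply: (samejet_bias (Q := fun n w => ls2_det n w != 0) _ s2 _ _ _ _ _ e) => //.
  + by move=> n; case: (measurable_burg2 n).
  + apply: (@bounded_sixth_moment _ _ _ _ _ _ 1) => // [n|n w].
      by case: (measurable_burg2 n).
    by case: (burg2_bound n (y n w)).
  + by move=> n w n0; rewrite burg2_avg.
  + by move=> n n0; apply: filterS (hls n n0) => w ls dn; rewrite (ls2_avg dn ls).
Qed.

Lemma same_bias1 (h : nat -> 'I_1 -> T -> R) : f2 = 0 -> (forall n j, measurable_fun setT (h n j)) ->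
  (forall n, (164 <= n)%N -> {ae P, forall w, is_least_squares n (y n w) (fun j => h n j w)}) ->
  same_bias 164 f1 (fun n w => burg1 n (y n w)) (fun n => h n ord0).
Proof.
move=> f20 mh hls; have s1 := samejet_burg1_ls1 H b f20.
have h6 : sixth_moment_On3 P 164 (h ^~ ord0).
  apply: (ls_sixth_moment H) => // n n0; apply: filterS (hls n n0) => w ls.
  have n3 : (3 <= n)%N by apply: leq_trans n0.
  by apply: (ls_coefficient_bound n0 (ls1_fitted n3 ls)); rewrite eqxx.
apply: (samejet_bias _ s1 _ _ _ _ _ (ls1_avg_near H b)) => //.
- exact: measurable_burg1.
- apply: (@bounded_sixth_moment _ _ _ _ _ _ 1) => //; first exact: measurable_burg1.
  by move=> n w; exact: burg1_le1.
- by move=> n w n0; rewrite burg1_avg//; apply: leq_trans n0.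
- by move=> n n0; apply: filterS (hls n n0) => w ls dn; rewrite (ls1_avg dn ls).
Qed.

End Bias.

(** * Reduction to a centred AR(2) process *)

Section FromProcess.
Context (d : measure_display) (T : measurableType d) (R : realType).
Variable P : probability T R.

Lemma ae_measure_eq (A B : set T) : measurable A -> measurable B ->
  {ae P, forall w, A w <-> B w} -> P A = P B.
Proof.
move=> mA mB AB; rewrite -[A]setIT -[B]setIT -!integral_indic//.
apply: ae_eq_integral => //; try by apply/measurable_EFinP; exact: measurable_indic.
apply: filterS AB => w AB _; congr (_%:E); rewrite !indicE; congr (nat_of_bool _)%:R.
by apply/idP/idP; rewrite !inE => /AB.
Qed.

Lemma expectation_Ex (X : T -> R) : int1 P X -> 'E_P[X]%E = (Ex P X)%:E.
Proof. by move=> iX; rewrite unlock Ex_fin. Qed.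

Lemma bias_limit_of_Ex N0 (X Y : nat -> T -> R) c l :
  (forall n, (N0 <= n)%N -> X n = Y n) -> (forall n, (N0 <= n)%N -> int1 P (Y n)) ->
  n%:R * Ex P (fun w => Y n w - c) @[n --> \oo] --> l ->
  eventually_integrable P X /\ bias_limit P X c l.
Proof.
move=> XY iY cY; split.
  by exists N0 => // n /= n0; rewrite XY//; exact: iY.
have : (n%:R * Ex P (fun w => Y n w - c))%:E @[n --> \oo] --> l%:E by apply: cvg_EFin => //; exact: nearW.
apply: cvg_trans; apply: near_eq_cvg; exists N0 => // n /= n0.
by rewrite EFinM XY// expectation_Ex//; exact: (int1B (iY n n0) (int1_cst P c)).
Qed.

Variables (z a : int -> {RV P >-> R}) (f1 f2 mu sigma : R).
Hypothesis adm : [/\ `|f2| < 1, f1 + f2 < 1 & f2 - f1 < 1].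
Hypothesis sigma0 : sigma != 0.
Hypothesis noise : gaussian_white_noise sigma a.
Hypothesis stat : stationary_with_mean mu z.
Hypothesis eqn : forall t : int, {ae P, forall w,
  z t w - mu = f1 * (z (t - 1) w - mu) + f2 * (z (t - 2) w - mu) + a t w}.
Hypothesis indep : independent_of_past a z.

Definition past_events (t : int) : set (set T) :=
  [set E | exists (s : int) (B : set R), [/\ s < t, measurable B & E = z s @^-1` B]].

Let x (t : int) (w : T) : R := z t w - mu.
Let e := innov x f1 f2.

Let mx t : measurable_fun setT (x t).
Proof. by apply: measurable_funB. Qed.

Let me t : measurable_fun setT (e t).
Proof.
by apply: measurable_funB => //; apply: measurable_funD; apply: measurable_funM.
Qed.

Let ea t : {ae P, forall w, e t w = a t w}.
Proof. by apply: filterS (eqn t) => w h; rewrite /e /innov /x h; ring. Qed.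

Let mpre (X : T -> R) (B : set R) : measurable_fun setT X -> measurable B -> measurable (X @^-1` B).
Proof. by move=> mX mB; rewrite -[X in measurable X]setTI; exact: mX. Qed.

Let past_sub t E : <<s past_events t >> E -> measurable E.
Proof.
apply: smallest_sub; first exact: sigma_algebra_measurable.
by move=> _ [s [B [_ mB ->]]]; exact: mpre.
Qed.

Let law_e t B : measurable B -> P (e t @^-1` B) = normal_prob 0 sigma B.
Proof.
move=> mB; rewrite -(noise.2 t B mB); apply: ae_measure_eq; [exact: mpre..|].
by apply: filterS (ea t) => w /=; rewrite /preimage/= => ->.
Qed.

Let mom_e t : mom P (e t).
Proof.
apply: mom_of => // q; have [c c0 hc] := normal_prob_tail sigma0 q.
have [|||iq _] := @dyadic_moment _ _ _ P (fun w => e t w ^+ 2) q c _ _ c0.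
- exact: measurable_funX.
- by move=> w; exact: sqr_ge0.
- move=> k; apply: le_trans (hc k); rewrite -(law_e t)//.
  by apply: measurable_gt; exact: measurable_funX.
apply: (int1_le _ (int1D (int1_cst P 1) iq)).
  by apply: measurable_funX; exact: measurableT_comp.
move=> w; rewrite normrX normr_id -exprM mulnC exprM -[e t w ^+ q ^+ 2]ger0_norm ?sqr_ge0// normrX normrX.
have := sqr_ge0 (`|e t w| ^+ q - 1); have : 0 <= `|e t w| ^+ q by rewrite exprn_ge0.
by move: (`|e t w| ^+ q) => u; nra.
Qed.

Let z1 t : int1 P (z t).
Proof.
apply/Lfun1_integrable/(@Lfun_subset12 _ _ _ P); first exact: fin_num_measure.
by case: stat.
Qed.

Let z2 t : int1 P (fun w => z t w ^+ 2).
Proof. by apply: Lfun2_integrable_sqr; case: stat. Qed.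

Let Ez t : Ex P (z t) = mu.
Proof. by apply: EFin_inj; rewrite -expectation_Ex//; case: stat. Qed.

Let x2 t : int1 P (fun w => x t w ^+ 2).
Proof.
have : int1 P (fun w => z t w ^+ 2 + ((-2 * mu) * z t w + mu ^+ 2)).
  by apply: int1D => //; apply: int1D; [exact: int1Z|exact: int1_cst].
by congr int1; apply/funext => w; rewrite /x; ring.
Qed.

Let xx s t : int1 P (fun w => x s w * x t w).
Proof.
apply: (int1_le _ (int1D (x2 s) (x2 t))); first exact: measurable_funM.
move=> w; rewrite normrM -[x s w ^+ 2]ger0_norm ?sqr_ge0// -[x t w ^+ 2]ger0_norm ?sqr_ge0// !normrX.
have := sqr_ge0 (`|x s w| - `|x t w|); have := normr_ge0 (x s w); have := normr_ge0 (x t w); nra.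
Qed.

(** Laws and independence of the noise [a] pass to the residuals, which agree with it almost surely.
    The small-ball constant is twice the maximum of the normal density, and stationarity of the
    covariance becomes that of the product moments once the mean is removed. *)
Lemma AR2_of_stationary : AR2 P x past_events f1 f2 (2 * normal_peak sigma).
Proof.
split => //.
- move=> s t st _ B mB; rewrite setTI.
  have -> : x s @^-1` B = z s @^-1` ((fun u => u - mu) @^-1` B) by [].
  apply: sub_sigma_algebra; exists s, ((fun u => u - mu) @^-1` B); split => //.
  rewrite -[X in measurable X]setTI; apply: measurable_funB => //.
- move=> t B E mB pE; rewrite (law_e t mB) -(noise.2 t B mB) -(indep mB pE).
  apply: ae_measure_eq.
  + by apply: measurableI; [exact: mpre|exact: past_sub pE].
  + by apply: measurableI; [exact: mpre|exact: past_sub pE].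
  by apply: filterS (ea t) => w h; rewrite /setI /preimage /= -/e h.
- by move=> s t B mB; rewrite !law_e.
- move=> t c eta eta0; apply: le_trans (normal_prob_ball sigma0 c eta0); rewrite -(law_e t)//.
  rewrite (_ : [set u | `|u + c| <= eta] = `[- c - eta, - c + eta]%classic)//.
  by apply/seteqP; split => u /=; rewrite in_itv/= ler_norml; move=> /andP[? ?]; apply/andP; split; lra.
- by move=> t; rewrite /x ExB//; [rewrite Ez Ex_cst subrr|exact: int1_cst].
- move=> s t h; case: stat => _ Em /(_ s t h).
  rewrite unlock !Em /= => E; apply: EFin_inj.
  by rewrite -!expectation_Ex//.
Qed.

End FromProcess.

Section Reduction.
Context (d : measure_display) (T : measurableType d) (R : realType).
Variables (P : probability T R) (z a : int -> {RV P >-> R}) (mu sigma : R).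
Hypothesis sigma0 : sigma != 0.
Local Notation x := (fun (t : int) (w : T) => z t w - mu).

Let bias_pair N0 (X X' Y Y' : nat -> T -> R) c :
  (forall n, (N0 <= n)%N -> X n = X' n) -> (forall n, (N0 <= n)%N -> Y n = Y' n) ->
  same_bias P N0 c X' Y' ->
  [/\ eventually_integrable P X, eventually_integrable P Y &
    exists l, bias_limit P X c l /\ bias_limit P Y c l].
Proof.
move=> XX' YY' [iX iY [l [cX cY]]].
have [eX bX] := bias_limit_of_Ex XX' iX cX.
have [eY bY] := bias_limit_of_Ex YY' iY cY.
by split => //; exists l.
Qed.

(** The agreement of [y] with [ydat] is asked for n > 0 only, as the sample mean does not remove
    [mu] when n = 0. *)
Lemma same_bias_to_order_1n_of_ydat p (phi : 'I_p -> R) b (y : nat -> T -> nat -> R) :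
  p = 1%N \/ p = 2%N -> admissible phi -> causal_stationary_AR phi mu sigma a z ->
  0 <= b <= 1 -> (forall n w, (0 < n)%N -> y n w = ydat x b n w) ->
  same_bias_to_order_1n P phi y.
Proof.
move=> [] pE; subst p => /= adm [noise stat eqn indep] b01 yE h hls j.
- have H : AR2 P x (past_events z) (phi ord0) 0 (2 * normal_peak sigma).
    apply: (AR2_of_stationary _ sigma0 noise stat _ indep).
      by move: adm; rewrite normr0 ltr_norml => /andP[? ?]; split; lra.
    by move=> t; apply: filterS (eqn t) => w; rewrite big_ord1 => ->; rewrite mul0r addr0.
  have hls' n : (164 <= n)%N -> {ae P, forall w, is_least_squares n (ydat x b n w) (fun j => h n j w)}.
    by move=> n0; apply: filterS (hls n) => w; rewrite yE//; apply: leq_trans n0.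
  rewrite (ord1 j).
  apply: bias_pair (same_bias1 H b01 erefl _ hls') => //.
  by move=> n n0; apply/funext => w /=; rewrite yE//; apply: leq_trans n0.
- have H : AR2 P x (past_events z) (phi ord0) (phi ord_max) (2 * normal_peak sigma).
    apply: (AR2_of_stationary _ sigma0 noise stat _ indep) => //.
    move=> t; apply: filterS (eqn t) => w; rewrite big_ord_recr big_ord1/= => ->.
    by congr (phi _ * _ + phi _ * _ + _); exact: val_inj.
  have hls' n : (164 <= n)%N -> {ae P, forall w, is_least_squares n (ydat x b n w) (fun j => h n j w)}.
    by move=> n0; apply: filterS (hls n) => w; rewrite yE//; apply: leq_trans n0.
  have [h1 h2] := same_bias2 H b01 (fun n j => measurable_funPT _) hls'.
  have [j0|j0] := eqVneq j ord0.
    subst j; apply: bias_pair h1 => //.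
    by move=> n n0; apply/funext => w /=; rewrite yE//; apply: leq_trans n0.
  have -> : j = ord_max by apply: val_inj; case: j j0 => -[|[|]].
  apply: bias_pair h2 => //.
  by move=> n n0; apply/funext => w /=; rewrite yE//; apply: leq_trans n0.
Qed.

End Reduction.

Theorem mainTheorem4 (d : measure_display) (T : measurableType d) (R : realType)
    (P : probability T R) (p : nat) (phi : 'I_p -> R) (mu sigma : R)
    (a z : int -> {RV P >-> R})
    (hp : p = 1%N \/ p = 2%N)
    (hsigma : 0 < sigma ^+ 2)
    (hphi : admissible phi)
    (hz : causal_stationary_AR phi mu sigma a z) :
  (mu = 0 -> same_bias_to_order_1n P phi (raw_data z)) /\
  same_bias_to_order_1n P phi (demeaned_data z).
Proof.
have sigma0 : sigma != 0 by apply: contraTneq hsigma => ->; rewrite expr0n/= ltxx.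
split => [mu0|].
  apply: (same_bias_to_order_1n_of_ydat sigma0 hp hphi hz (b := 0)); first by rewrite lexx ler01.
  by move=> n w _; apply/funext => t; rewrite /raw_data /ydat mu0 mul0r !subr0.
(* Demeaning is unaffected by the centring at [mu], so any value of [mu] is covered. *)
apply: (same_bias_to_order_1n_of_ydat sigma0 hp hphi hz (b := 1)); first by rewrite ler01 lexx.
move=> n w n0; apply/funext => t; rewrite /demeaned_data /ydat mul1r /xbar sumrB.
have n1 : n%:R != 0 :> R by rewrite pnatr_eq0 -lt0n.
rewrite sumr_const_nat subn1/= -[mu *+ n]mulr_natl mulrBr mulKf//; ring.
Qed.
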